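(* Let $(M,\omega)$ be a symplectic manifold of dimension $2m$. Then integrable $(\lambda,\ell)$-structures or integrable $(-1,1;n)$-structures on $(M,\omega)$ are smooth sections of a fiber bundle over $M$ with typical fiber $G/H$, according to the following list: - $\lambda=1$, $\ell=1$: $G=Gl(2m,\mathbb R)$, $H=Gl(m,\mathbb R)\times Gl(m,\mathbb R)$; - $\lambda=1$, $\ell=-1$: $G=U(m,m)$, $H=Gl(m,\mathbb C)$; - $\lambda=-1$, $\ell=1$, signature $n$ (that is, $(-1,1;n)$-structures): $G=U(m,m)$, $H=U(n,m-n)\times U(m-n,n)$; - $\lambda=-1$, $\ell=-1$: $G=Gl(2m,\mathbb R)$, $H=Gl(m,\mathbb C)$.
   Context: All objects are $C^\infty$. For a smooth manifold $M$ put $\mathbb{T}M=TM\oplus T^*M$, with the split pseudo-Riemannian structure $b(u+\sigma,v+\tau)=\tau(u)+\sigma(v)$ and the Courant bracket $[u+\sigma,v+\tau]=[u,v]+\mathcal L_u\tau-\mathcal L_v\sigma-\tfrac12 d(\tau(u)-\sigma(v))$. For a bilinear form $c$ on $V$, $c^\flat:V\to V^*$ is $c^\flat(u)(v)=c(u,v)$. A real linear isomorphism $S$ with $S^2=\lambda\,\mathrm{id}$, $\lambda=\pm1$, is called split if it has exactly two eigenspaces (in the complexification if $\lambda=-1$), of the same dimension (automatic if $\lambda=-1$). Let $S$ be a smooth section of $\mathrm{End}(\mathbb{T}M)$ with $S^2=\lambda\,\mathrm{id}$, $S$ split and skew-symmetric for $b$. $S$ is a generalized complex structure (if $\lambda=-1$),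 respectively generalized paracomplex structure (if $\lambda=1$), if the smooth sections of each of the $\pm\sqrt\lambda$-eigenbundles of $S$ are closed under the Courant bracket (extended $\mathbb C$-bilinearly to the complexification when $\lambda=-1$). For a symplectic manifold $(M,\omega)$ and $k=\pm1$ let $I_k=\begin{pmatrix}0&k(\omega^\flat)^{-1}\\ \omega^\flat&0\end{pmatrix}$ on $\mathbb{T}M$; write $I_-=I_{-1}$. For $\lambda=\pm1$, $\ell=\pm1$, an integrable $(\lambda,\ell)$-structure on $(M,\omega)$ is a generalized complex ($\lambda=-1$) or generalized paracomplex ($\lambda=1$) structure $S$ on $M$ such that $SI_{\lambda\ell}=I_{\lambda\ell}S$ and $I_{\lambda\ell}S$ is split. For an integrable $(-1,1)$-structure $S$, the form $\beta_S(x,y)=b(I_-Sx,y)$ on $\mathbb{T}M$ is symmetric; $S$ is called an integrable $(-1,1;n)$-structure if $\beta_S$ has signature $(4n,4m-4n)$ ($4n$ positive, $4m-4n$ negative), where $2m=\dim M$ and $0\le n\le m$. $U(p,q)$, $Gl(r,\mathbb R)$ and $Gl(r,\mathbb C)$ are the usual groups. *)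

(* Defs.v *)
From HB Require Import structures.
From mathcomp Require Import all_boot all_order all_algebra.
From mathcomp Require Import complex.
From mathcomp Require Import all_classical all_reals all_analysis.

Set Implicit Arguments.
Unset Strict Implicit.
Unset Printing Implicit Defensive.

Import Order.TTheory GRing.Theory Num.Theory.
Import numFieldNormedType.Exports.

Local Open Scope classical_set_scope.
Local Open Scope ring_scope.
Local Open Scope sesquilinear_scope.

(* Vectors are rows; a linear map f is encoded by the matrix A with
   f x = x *m A, so that f \o g corresponds to B *m A.  This agrees with the
   library conventions for [eigenspace] and [jacobian]. *)

(** * Smooth maps between subsets of finite-dimensional vector spaces *)

Section Smooth.
Context {R : realType}.

Definition iter_derive (V W : normedModType R) (vs : seq V) (f : V -> W) :
  V -> W := foldr (fun v g => fun x => 'D_v g x) f vs.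

(* C^oo on an open set O: all iterated directional derivatives exist and are
   differentiable on O. *)
Definition smooth_on (V W : normedModType R) (O : set V) (f : V -> W) : Prop :=
  forall (vs : seq V) x, O x -> differentiable (iter_derive vs f) x.

(* On an arbitrary subset X: locally the restriction of a smooth map defined
   on an open set. *)
Definition smooth_map (V W : normedModType R) (X : set V) (f : V -> W) : Prop :=
  forall x, X x -> exists (O : set V) (g : V -> W),
    [/\ open O, O x, smooth_on O g & forall z, X z -> O z -> f z = g z].

End Smooth.

(** * Matrix Lie groups and homogeneous spaces *)

Section Homogeneous.
Context {R : realType} {N : nat}.
Implicit Types (G H : set 'M[R]_N).

Definition lcoset_mx (g : 'M[R]_N) H : set 'M[R]_N := [set g *m h | h in H].

Definition quot G H : set (set 'M[R]_N) := [set lcoset_mx g H | g in G].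

(* For a closed subgroup H of a matrix Lie group G, the manifold G/H is
   characterized by G -> G/H being a surjective submersion.  Hence a map into
   G/H is smooth iff it lifts locally to a smooth map into G, and a map on
   Y x G/H is smooth iff its pull-back to Y x G is smooth. *)
Definition smooth_into_quot (V : normedModType R) (X : set V) G H
    (f : V -> set 'M[R]_N) : Prop :=
  forall x, X x -> exists (O : set V) (g : V -> 'M[R]_N),
    [/\ open O, O x, smooth_on O g
      & forall z, X z -> O z -> G (g z) /\ f z = lcoset_mx (g z) H].

Definition smooth_from_quot (V W : normedModType R) (Y : set V) G H
    (f : V * set 'M[R]_N -> W) : Prop :=
  smooth_map (Y `*` G) (fun z : V * 'M[R]_N => f (z.1, lcoset_mx z.2 H)).

End Homogeneous.

Section ClassicalGroups.
Context {R : realType}.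

Definition GL (F : fieldType) (r : nat) : set 'M[F]_r := [set g | g \in unitmx].

Definition mx_pq (p q : nat) : 'M[R[i]]_(p + q) :=
  block_mx 1%:M 0 0 (- 1%:M).

Definition unitary (p q : nat) : set 'M[R[i]]_(p + q) :=
  [set g | g ^t* *m mx_pq p q *m g = mx_pq p q].

(* The standard embedding of complex r x r matrices into real 2r x 2r ones;
   through it, complex matrix groups are viewed as real Lie groups. *)
Definition realify (r : nat) (g : 'M[R[i]]_r) : 'M[R]_(r + r) :=
  let X := map_mx (@complex.Re R) g in
  let Y := map_mx (@complex.Im R) g in
  block_mx X (- Y) Y X.

Definition GLxGL (m : nat) : set 'M[R]_(m + m) :=
  [set g | exists A D, [/\ @GL R m A, @GL R m D & g = block_mx A 0 0 D]].

(* A |-> P diag(A, A^-* ) P^-1 with P = 2^(-1/2) [1, 1; 1, -1], which carries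
   the Hermitian form [0, 1; 1, 0], preserved by diag(A, A^-* ), to mx_pq m m. *)
Definition GL_in_U (m : nat) (A : 'M[R[i]]_m) : 'M[R[i]]_(m + m) :=
  let B := invmx (A ^t* ) in
  2^-1 *: block_mx (A + B) (A - B) (A - B) (A + B).

(* (A, D) |-> A (+) D for C^(n,q) (+) C^(q,n) = C^(n+q,n+q).  The positive
   coordinates of the sum are the n positive ones of A, then the q positive ones
   of D; the negative ones are the n of D, then the q of A. *)
Definition UxU_in_U (n q : nat) (A : 'M[R[i]]_(n + q)) (D : 'M[R[i]]_(q + n)) :
    'M[R[i]]_((n + q) + (n + q)) :=
  block_mx (block_mx (ulsubmx A) 0 0 (ulsubmx D))
           (block_mx 0 (ursubmx A) (ursubmx D) 0)
           (block_mx 0 (dlsubmx D) (dlsubmx A) 0)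
           (block_mx (drsubmx D) 0 0 (drsubmx A)).

Definition UxU (m n : nat) (nm : (n <= m)%N) : set 'M[R[i]]_(m + m) :=
  let e := congr2 addn (subnKC nm) (subnKC nm) in
  [set g | exists A D,
    [/\ @unitary n (m - n) A, @unitary (m - n) n D
      & g = castmx (e, e) (UxU_in_U A D)]].

End ClassicalGroups.
Arguments GL F r : clear implicits.
Arguments GLxGL R m : clear implicits.
Arguments unitary R p q : clear implicits.
Arguments UxU R {m n} nm.
Arguments realify {R r} g.
Arguments GL_in_U {R m} A.

(** * Smooth manifolds *)

Record chart (R : realType) (d : nat) (T : topologicalType) := Chart {
  dom : set T;
  fwd :> T -> 'rV[R]_d;
  bwd : 'rV[R]_d -> T }.

Definition cimg (R : realType) d (T : topologicalType) (c : chart R d T) :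
  set 'rV[R]_d := c @` dom c.

Definition is_chart (R : realType) d (T : topologicalType) (c : chart R d T) :
    Prop :=
  [/\ open (dom c), open (cimg c),
      forall x, dom c x -> bwd c (c x) = x,
      forall x, dom c x -> {for x, continuous (fwd c)}
    & forall y, cimg c y -> {for y, continuous (bwd c)}].

Record manifold (R : realType) (d : nat) := Manifold {
  carrier :> topologicalType;
  atlas : set (chart R d carrier);
  chart_at : carrier -> chart R d carrier;
  atlas_chart : forall c, atlas c -> is_chart c;
  chart_at_atlas : forall p, atlas (chart_at p);
  chart_at_dom : forall p, dom (chart_at p) p;
  atlas_compat : forall c c', atlas c -> atlas c' ->
    smooth_on (c @` (dom c `&` dom c')) (fun y => c' (bwd c y));
  carrier_hausdorff : hausdorff_space carrier;
  carrier_second_countable : @second_countable carrier }.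

(** * Tensor fields *)

(* T_pM is identified with R^d by the chart chart_at p, and T*_pM with R^d by
   the dual basis, sigma(v) being sigma *m v^T.  Fields are thus functions on M
   with matrix values, and geometric notions are expressed through their
   components in the charts. *)
Section Fields.
Context {R : realType} {d : nat} (M : manifold R d).
Implicit Types (c : chart R d M) (p : M).

(* The differential at p of c, from T_pM to R^d. *)
Definition tframe c p : 'M[R]_d :=
  jacobian (fun y => c (bwd (chart_at p) y)) (chart_at p p).

(* The isomorphism from T_pM (+) T*_pM to R^d (+) (R^d)* induced by c. *)
Definition gframe c p : 'M[R]_(d + d) :=
  block_mx (tframe c p) 0 0 (invmx (tframe c p))^T.

Definition section_in c (s : M -> 'rV[R]_(d + d)) (y : 'rV[R]_d) :
    'rV[R]_(d + d) :=
  s (bwd c y) *m gframe c (bwd c y).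

Definition smooth_section (s : M -> 'rV[R]_(d + d)) : Prop :=
  forall c, atlas c -> smooth_on (cimg c) (section_in c s).

Definition endo_coord c p (A : 'M[R]_(d + d)) : 'M[R]_(d + d) :=
  invmx (gframe c p) *m A *m gframe c p.

Definition endo_in c (S : M -> 'M[R]_(d + d)) (y : 'rV[R]_d) :
    'M[R]_(d + d) :=
  endo_coord c (bwd c y) (S (bwd c y)).

Definition smooth_endo (S : M -> 'M[R]_(d + d)) : Prop :=
  forall c, atlas c -> smooth_on (cimg c) (endo_in c S).

(* A bilinear form w on T_pM is encoded by W with w(u, v) = u *m W *m v^T, so
   that w^flat u = u *m W. *)
Definition form_in c (w : M -> 'M[R]_d) (y : 'rV[R]_d) : 'M[R]_d :=
  let J := invmx (tframe c (bwd c y)) in J *m w (bwd c y) *m J^T.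

Definition pderiv (i : 'I_d) (f : 'rV[R]_d -> R^o) (y : 'rV[R]_d) : R :=
  'D_(delta_mx 0 i) f y.

Definition closed_form (w : M -> 'M[R]_d) : Prop :=
  forall c, atlas c -> forall y, cimg c y -> forall i j k,
    pderiv i (fun z => form_in c w z j k) y
    + pderiv j (fun z => form_in c w z k i) y
    + pderiv k (fun z => form_in c w z i j) y = 0.

Record symplectic := Symplectic {
  sform :> M -> 'M[R]_d;
  sform_skew : forall p, (sform p)^T = - sform p;
  sform_nondeg : forall p, sform p \in unitmx;
  sform_smooth : forall c, atlas c -> smooth_on (cimg c) (form_in c sform);
  sform_closed : closed_form sform }.

(** ** The Courant bracket *)

Definition lie_covector (u tau : 'rV[R]_d -> 'rV[R]_d) (y : 'rV[R]_d) :
    'rV[R]_d :=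
  'D_(u y) tau y + tau y *m (jacobian u y)^T.

Definition courant_Rd (s t : 'rV[R]_d -> 'rV[R]_(d + d)) (y : 'rV[R]_d) :
    'rV[R]_(d + d) :=
  let u z := lsubmx (s z) in let sigma z := rsubmx (s z) in
  let v z := lsubmx (t z) in let tau z := rsubmx (t z) in
  let h z := (tau z *m (u z)^T) 0 0 - (sigma z *m (v z)^T) 0 0 in
  row_mx ('D_(u y) v y - 'D_(v y) u y)
         (lie_covector u tau y - lie_covector v sigma y
          - 2^-1 *: \row_i pderiv i h y).

(* gframe (chart_at p) p is the identity, so that the value at p computed in
   chart_at p needs no conversion. *)
Definition courant (s t : M -> 'rV[R]_(d + d)) (p : M) : 'rV[R]_(d + d) :=
  let c := chart_at p in courant_Rd (section_in c s) (section_in c t) (c p).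

Definition cplx_mx (a b : nat) (A : 'M[R]_(a, b)) : 'M[R[i]]_(a, b) :=
  map_mx (@real_complex R) A.

Definition re_sec (s : M -> 'rV[R[i]]_(d + d)) (p : M) : 'rV[R]_(d + d) :=
  map_mx (@complex.Re R) (s p).

Definition im_sec (s : M -> 'rV[R[i]]_(d + d)) (p : M) : 'rV[R]_(d + d) :=
  map_mx (@complex.Im R) (s p).

Definition smooth_csection (s : M -> 'rV[R[i]]_(d + d)) : Prop :=
  smooth_section (re_sec s) /\ smooth_section (im_sec s).

Definition imag : R[i] := (0 +i* 1)%C.

Definition courantC (s t : M -> 'rV[R[i]]_(d + d)) (p : M) :
    'rV[R[i]]_(d + d) :=
  cplx_mx (courant (re_sec s) (re_sec t) p - courant (im_sec s) (im_sec t) p)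
  + imag *: cplx_mx (courant (re_sec s) (im_sec t) p
                     + courant (im_sec s) (re_sec t) p).

Definition eigenbundle_involutive (S : M -> 'M[R]_(d + d)) (a : R) : Prop :=
  forall s t, smooth_section s -> smooth_section t ->
    (forall p, s p *m S p = a *: s p) -> (forall p, t p *m S p = a *: t p) ->
    forall p, courant s t p *m S p = a *: courant s t p.

Definition eigenbundle_involutiveC (S : M -> 'M[R]_(d + d)) (a : R[i]) : Prop :=
  forall s t, smooth_csection s -> smooth_csection t ->
    (forall p, s p *m cplx_mx (S p) = a *: s p) ->
    (forall p, t p *m cplx_mx (S p) = a *: t p) ->
    forall p, courantC s t p *m cplx_mx (S p) = a *: courantC s t p.

End Fields.

(** * Linear algebra on T (+) T* *)

Section Pointwise.
Context {R : realType}.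

Definition two_equal_eigenspaces (F : fieldType) k (A : 'M[F]_k) : Prop :=
  exists a b : F, [/\ a != b, forall c, eigenvalue A c = (c \in [:: a; b])
    & \rank (eigenspace A a) = \rank (eigenspace A b)].

(* Here and below lam and ell are only meant to be 1 or -1. *)
Definition is_split (lam : R) k (S : 'M[R]_k) : Prop :=
  S *m S = lam%:M /\
  (if lam == 1 then two_equal_eigenspaces S
   else two_equal_eigenspaces (cplx_mx S)).

(* The symmetric bilinear form x *m B *m y^T has p positive and q negative
   squares. *)
Definition has_signature (p q : nat) k (B : 'M[R]_k) : Prop :=
  exists2 P : 'M[R]_k, P \in unitmx &
    P *m B *m P^T =
      diag_mx (\row_i (if (i < p)%N then 1 else if (i < p + q)%N then -1 else 0)).

Context {d : nat}.
Implicit Types (W : 'M[R]_d) (S : 'M[R]_(d + d)).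

Definition pairing : 'M[R]_(d + d) := block_mx 0 1%:M 1%:M 0.

Definition is_skew S : Prop := S *m pairing = - (pairing *m S^T).

Definition I_mx (k : R) W : 'M[R]_(d + d) := block_mx 0 W (k *: invmx W) 0.

(* The form (x, y) |-> b(I_- (S x), y). *)
Definition beta W S : 'M[R]_(d + d) := S *m I_mx (-1) W *m pairing.

End Pointwise.

(** * Integrable (lam, ell)-structures *)

Section Structures.
Context {R : realType} {d : nat} {M : manifold R d}.
Implicit Types (w : symplectic M) (S : M -> 'M[R]_(d + d)).

Definition generalized_structure (lam : R) S : Prop :=
  [/\ smooth_endo S, forall p, is_split lam (S p), forall p, is_skew (S p)
    & if lam == 1
      then eigenbundle_involutive S 1 /\ eigenbundle_involutive S (-1)
      else eigenbundle_involutiveC S imag /\ eigenbundle_involutiveC S (- imag)].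

Definition integrable_structure w (lam ell : R) S : Prop :=
  generalized_structure lam S /\
  forall p, let I := I_mx (lam * ell) (w p) in
    S p *m I = I *m S p /\ is_split ell (S p *m I).

(* The algebraic conditions at a single point: the candidate fibre over p. *)
Definition fibre w (lam ell : R) (p : M) : set 'M[R]_(d + d) :=
  [set A | let I := I_mx (lam * ell) (w p) in
    [/\ is_split lam A, is_skew A, A *m I = I *m A & is_split ell (A *m I)]].

End Structures.

Section SignedStructures.
Context {R : realType} {m : nat} {M : manifold R (m + m)}.

Definition integrable_structure_n (w : symplectic M) (n : nat)
    (S : M -> 'M[R]_((m + m) + (m + m))) : Prop :=
  integrable_structure w (-1) 1 S /\
  forall p, has_signature (4 * n) (4 * m - 4 * n) (beta (w p) (S p)).

Definition fibre_n (w : symplectic M) (n : nat) (p : M) :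
    set 'M[R]_((m + m) + (m + m)) :=
  [set A | fibre w (-1) 1 p A /\
           has_signature (4 * n) (4 * m - 4 * n) (beta (w p) A)].

End SignedStructures.

(** * Fibre bundles with typical fibre G/H inside End(TM (+) T*M) *)

Section Bundles.
Context {R : realType} {d : nat} {M : manifold R d}.
Implicit Types (c : chart R d M) (E : forall p : M, set 'M[R]_(d + d)).

(* The part over O of the total space of E, in the chart of End(TM (+) T*M)
   induced by c. *)
Definition total_in c (O : set M) E : set ('rV[R]_d * 'M[R]_(d + d)) :=
  [set z | exists p A, [/\ O p, E p A & z = (c p, endo_coord c p A)]].

(* The total space of E carries the smooth structure induced by
   End(TM (+) T*M).  A trivialization over O consists of mutually inverse smooth
   maps over O between the part of E over O and O x G/H, read in the chart c:
   z |-> (z.1, tau z) and (y, q) |-> (y, sigma (y, q)). *)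
Definition trivialization E N (G H : set 'M[R]_N) c (O : set M)
    (tau : 'rV[R]_d * 'M[R]_(d + d) -> set 'M[R]_N)
    (sigma : 'rV[R]_d * set 'M[R]_N -> 'M[R]_(d + d)) : Prop :=
  let X := total_in c O E in
  [/\ [/\ atlas c, open O & O `<=` dom c],
      forall z, X z -> quot G H (tau z) /\ sigma (z.1, tau z) = z.2,
      forall y q, (c @` O) y -> quot G H q ->
        X (y, sigma (y, q)) /\ tau (y, sigma (y, q)) = q,
      smooth_into_quot X G H tau
    & smooth_from_quot (c @` O) G H sigma].

Definition fibre_bundle E N (G H : set 'M[R]_N) : Prop :=
  forall p : M, exists c (O : set M) tau sigma,
    O p /\ trivialization E G H c O tau sigma.

Definition smooth_section_of E N (G H : set 'M[R]_N)
    (S : M -> 'M[R]_(d + d)) : Prop :=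
  (forall p, E p (S p)) /\
  forall c (O : set M) tau sigma, trivialization E G H c O tau sigma ->
    smooth_into_quot (c @` O) G H
      (fun y => tau (y, endo_in c S y)).

Definition sections_of_bundle (P : (M -> 'M[R]_(d + d)) -> Prop) E
    N (G H : set 'M[R]_N) : Prop :=
  fibre_bundle E G H /\ forall S, P S -> smooth_section_of E G H S.

End Bundles.

(* Main.v *)
(* In a chart, the fibre over a point is the set of endomorphisms satisfying
   algebraic conditions with respect to I = I_(lam ell), the pairing b and the matrix
   W of the symplectic form.  If lam ell = 1, then T + T* is the direct sum of the
   eigenspaces [1, W] and [1, -W] of I, which are b-isotropic and dual to each other,
   so that a structure is determined by its restriction to the first one: an
   arbitrary split endomorphism B of R^2m with B^2 = lam, that is, a point of a single
   conjugacy class of Gl(2m, R).  If lam ell = -1, then I is a complex structure, b is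
   the real part of a Hermitian form, which is iW in suitable coordinates, of
   signature (m, m), and a structure is an element B of the Lie algebra u(m, m) with
   B^2 = lam: again a single U(m, m)-orbit, once the signature is fixed if lam = -1.
   In both cases H is the stabilizer of a well-chosen point B0 of the orbit.

   Smooth local sections of G -> G/H come from T = (1 + lam B B0) / 2, which satisfies
   T B0 = B T and is the identity at B0.  For U(m, m), T is corrected by a smooth C
   commuting with B0 that carries the Hermitian form pulled back by T to the standard
   one.  Such a C, and the smooth frames of the Hermitian form iW, are obtained by a
   triangular (L D L^* ) decomposition, in which only square roots of real numbers
   occur. *)

(* The obstacle is that G/H has no charts here: maps into it are smooth when they lift locally to G,
   maps out of it when their pull-backs to G are. A trivialization is therefore extracted from a
   smooth map (y, g) -> fibre over y whose level sets in g are the cosets of H and which has smooth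
   local sections. By homogeneity a section near B0 suffices; translations move it elsewhere.

   The spectral theorem diagonalizes a Hermitian form at one point, but not smoothly in the form. It
   is used pointwise only; smooth dependence comes from elimination near a form that is already
   diagonal with entries 1 and -1, where no pivot vanishes. Elimination moreover commutes with every
   diagonal matrix that commutes with the form, which settles the correction for lam = -1, where B0
   is diagonal. For lam = 1, ell = -1, B0 exchanges the two halves of C^2m, its eigenspaces are
   isotropic, and the correction only takes the inverse of one block.

   Dimension 0 has to be excluded: an endomorphism of the zero space has no eigenvalue, so the
   fibres would be empty while G/H is a point. *)
Require Import Defs.
From HB Require Import structures.
From mathcomp Require Import all_boot all_order all_algebra.
From mathcomp Require Import perm complex.
From mathcomp Require Import all_classical all_reals all_analysis.
Set Implicit Arguments.
Unset Strict Implicit.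
Unset Printing Implicit Defensive.
Import Order.TTheory GRing.Theory Num.Theory.
Import numFieldNormedType.Exports.
Local Open Scope classical_set_scope.
Local Open Scope ring_scope.
Local Open Scope sesquilinear_scope.

(** * Smooth maps *)

Lemma open_setI_preimage (T T' : topologicalType) (O : set T) (f : T -> T')
    (A : set T') :
  open O -> (forall x, O x -> {for x, continuous f}) -> open A ->
  open (O `&` f @^-1` A).
Proof.
rewrite !openE => oO cf oA x [Ox Afx].
by apply: filterI; [exact: oO|apply: cf => //; exact: oA].
Qed.

Section Smoothness.
Context {R : realType}.
Implicit Types (V W U : normedModType R).

(** Derivatives are peeled off next to [f], whereas [iter_derive] recurses on the outermost one. In
    this form the Leibniz and chain rules go by induction on the order. *)
Fixpoint Ck (n : nat) V W (O : set V) (f : V -> W) : Prop :=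
  (forall x, O x -> differentiable f x) /\
  (if n is k.+1 then forall v, Ck k O (fun x => 'D_v f x) else True).

Lemma Ck_diff n V W (O : set V) (f : V -> W) x :
  Ck n O f -> O x -> differentiable f x.
Proof. by case: n => [|n] [h _] Ox; apply: h. Qed.

Lemma Ck_pred n V W (O : set V) (f : V -> W) : Ck n.+1 O f -> Ck n O f.
Proof.
elim: n f => [|n IH] f [h1 h2]; split => // v.
exact: IH (h2 v).
Qed.

Lemma smooth_onP V W (O : set V) (f : V -> W) :
  smooth_on O f <-> forall n, Ck n O f.
Proof.
have deriv (g : V -> W) v : smooth_on O g -> smooth_on O (fun x => 'D_v g x).
  move=> sg vs x Ox; have := sg (rcons vs v) x Ox.
  by rewrite /iter_derive foldr_rcons.
split=> [sf n|sf vs].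
  elim: n f sf => [|n IH] f sf; split; do ?[by move=> x Ox; exact: (sf [::])|by []].
  by move=> v; apply: IH; exact: deriv.
elim/last_ind: vs f sf => [|vs v IH] f sf x Ox.
  exact: Ck_diff (sf 0%N) Ox.
rewrite /iter_derive foldr_rcons; apply: IH => // n.
by have [_] := sf n.+1; apply.
Qed.

Lemma near_eq_differentiable V W (f g : V -> W) x :
  (\near x, f x = g x) -> differentiable f x -> differentiable g x.
Proof.
move=> fg df.
have E : g \o shift x = cst (g x) + 'd f x +o_ 0 id.
  apply/eqaddoP => e e0.
  have /eqaddoP /(_ e e0) := diff_locally df.
  have fg0 : \forall h \near 0, f (h + x) = g (h + x).
    by rewrite (near_shift x) sub0r; near do rewrite /= subrK.
  apply: filterS2 fg0 => h; rewrite !fctE /= => E.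
  by rewrite -E (nbhs_singleton fg).
have cf := diff_continuous df.
by apply/diff_locallyP; rewrite (diff_unique cf E).
Unshelve. all: by end_near. Qed.

Lemma near_eq_open V W (O : set V) (f g : V -> W) x :
  open O -> {in O, f =1 g} -> O x -> \near x, f x = g x.
Proof.
move=> oO fg Ox; apply: filterS (open_nbhs_nbhs (conj oO Ox)) => z Oz.
by apply: fg; exact: mem_set.
Qed.

Lemma Ck_eq n V W (O : set V) (f g : V -> W) :
  open O -> {in O, f =1 g} -> Ck n O f -> Ck n O g.
Proof.
move=> oO; elim: n f g => [|n IH] f g fg [h1 h2].
  by split=> // x Ox; apply: near_eq_differentiable (near_eq_open oO fg Ox) (h1 x Ox).
split=> [x Ox|v].
  exact: near_eq_differentiable (near_eq_open oO fg Ox) (h1 x Ox).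
apply: IH (h2 v) => x /set_mem Ox.
exact: near_eq_derive (near_eq_open oO fg Ox).
Qed.

Lemma Ck_sub n V W (O O' : set V) (f : V -> W) :
  O' `<=` O -> Ck n O f -> Ck n O' f.
Proof.
move=> sO; elim: n f => [|n IH] f [h1 h2]; split => //.
- by move=> x /sO; exact: h1.
- by move=> x /sO; exact: h1.
- by move=> v; exact: IH (h2 v).
Qed.

Lemma Ck_cst n V W (O : set V) (a : W) : Ck n O (fun _ : V => a).
Proof.
elim: n a => [|n IH] a; split=> //; do ?[by move=> x _; exact: differentiable_cst].
move=> v; suff -> : (fun x => 'D_v (fun _ : V => a) x) = (fun=> 0) by [].
by apply/funext => x; exact: derive_cst.
Qed.

Lemma CkD n V W (O : set V) (f g : V -> W) : open O ->
  Ck n O f -> Ck n O g -> Ck n O (fun x => f x + g x).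
Proof.
move=> oO; elim: n f g => [|n IH] f g [f1 f2] [g1 g2]; split=> //.
- by move=> x Ox; apply: differentiableD; [exact: f1|exact: g1].
- by move=> x Ox; apply: differentiableD; [exact: f1|exact: g1].
move=> v; apply: (Ck_eq oO) (IH _ _ (f2 v) (g2 v)) => x /set_mem Ox.
by rewrite deriveD //; apply: diff_derivable; [exact: f1|exact: g1].
Qed.

Lemma CkN n V W (O : set V) (f : V -> W) : open O ->
  Ck n O f -> Ck n O (fun x => - f x).
Proof.
move=> oO; elim: n f => [|n IH] f [f1 f2]; split=> //.
- by move=> x Ox; apply: differentiableN; exact: f1.
- by move=> x Ox; apply: differentiableN; exact: f1.
move=> v; apply: (Ck_eq oO) (IH _ (f2 v)) => x /set_mem Ox.
by rewrite deriveN //; apply: diff_derivable; exact: f1.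
Qed.

Lemma CkM n V (O : set V) (f g : V -> R) : open O ->
  Ck n O f -> Ck n O g -> Ck n O (fun x => f x * g x).
Proof.
move=> oO; elim: n f g => [|n IH] f g.
  move=> [f1 f2] [g1 g2]; split=> //.
  by move=> x Ox; apply: differentiableM; [exact: f1|exact: g1].
move=> /[dup] /Ck_pred f0 [f1 f2] /[dup] /Ck_pred g0 [g1 g2]; split=> [x Ox|v].
  by apply: differentiableM; [exact: f1|exact: g1].
apply: (Ck_eq oO) (CkD oO (IH _ _ f0 (g2 v)) (IH _ _ g0 (f2 v))) => x /set_mem Ox.
by rewrite deriveM //; apply: diff_derivable; [exact: f1|exact: g1].
Qed.

(** The derivative is [- f^-2 * 'D_v f], in which the inverse occurs only to order [n], so the
    induction hypothesis covers it. [CkSqrt] closes in the same way through [1 / (2 sqrt f)]. *)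
Lemma CkV n V (O : set V) (f : V -> R) : open O ->
  (forall x, O x -> f x != 0) -> Ck n O f -> Ck n O (fun x => (f x)^-1).
Proof.
move=> oO f0; elim: n f f0 => [|n IH] f f0.
  move=> [f1 _]; split=> // x Ox.
  by apply: differentiableV; [exact: f1|exact: f0].
move=> /[dup] /Ck_pred fn [f1 f2]; split=> [x Ox|v].
  by apply: differentiableV; [exact: f1|exact: f0].
have h := IH _ f0 fn.
apply: (Ck_eq oO) (CkN oO (CkM oO (CkM oO h h) (f2 v))) => x /set_mem Ox.
rewrite deriveV ?f0 //; last by apply: diff_derivable; exact: f1.
by rewrite /GRing.scale /= mulNr -exprVn expr2.
Qed.

Lemma CkSqrt n V (O : set V) (f : V -> R) : open O ->
  (forall x, O x -> 0 < f x) -> Ck n O f -> Ck n O (fun x => Num.sqrt (f x)).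
Proof.
move=> oO f0.
have ds (y : R) : 0 < y -> differentiable (@Num.sqrt R) y.
  by move=> y0; apply/derivable1_diffP; have [] := is_derive1_sqrt y0.
have dsf x : differentiable f x -> O x -> differentiable (Num.sqrt \o f) x.
  by move=> df Ox; apply: differentiable_comp => //; apply/ds/f0.
elim: n f f0 dsf => [|n IH] f f0 dsf.
  by move=> [f1 _]; split=> // x Ox; apply: dsf => //; exact: f1.
move=> /[dup] /Ck_pred fn [f1 f2]; split=> [x Ox|v].
  by apply: dsf => //; exact: f1.
have h := IH _ f0 dsf fn.
have nz x : O x -> 2 * Num.sqrt (f x) != 0.
  by move=> /f0 fx; rewrite mulf_neq0 ?pnatr_eq0 // gt_eqF // sqrtr_gt0.
apply: (Ck_eq oO) (CkM oO (f2 v) (CkV oO nz (CkM oO (Ck_cst _ _ (2 : R)) h))) => x.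
move=> /set_mem Ox; have fx := f0 _ Ox; have dfx := f1 _ Ox; have dx := ds _ fx.
rewrite [RHS]deriveE; last exact: dsf.
rewrite (diff_comp dfx dx) /= deriv1E; last exact/derivable1_diffP.
by rewrite derive1E derive_sqrt // deriveE.
Qed.

Lemma Ck_lin n V W U (L : {linear W -> U}) (O : set V) (f : V -> W) :
  continuous L -> open O -> Ck n O f -> Ck n O (fun x => L (f x)).
Proof.
move=> cL oO; elim: n f => [|n IH] f [f1 f2]; split=> //.
- move=> x Ox; apply: differentiable_comp; first exact: f1.
  exact: linear_differentiable.
- move=> x Ox; apply: differentiable_comp; first exact: f1.
  exact: linear_differentiable.
move=> v; apply: (Ck_eq oO) (IH _ (f2 v)) => x /set_mem Ox.
have dL := linear_differentiable (f x) cL.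
rewrite [RHS]deriveE; last by apply: differentiable_comp => //; exact: f1.
rewrite diff_comp //=; last exact: f1.
by rewrite diff_lin // deriveE //; exact: f1.
Qed.

Lemma Ck_sum n V (I : Type) (r : seq I) (P : pred I) (O : set V)
    (f : I -> V -> R) : open O ->
  (forall i, Ck n O (f i)) -> Ck n O (fun x => \sum_(i <- r | P i) f i x).
Proof.
move=> oO fi; elim: r => [|i r IH].
  by under eq_fun do rewrite big_nil; exact: Ck_cst.
under eq_fun do rewrite big_cons; case: (P i) => //.
exact: CkD.
Qed.

Lemma Ck_coord n V p q (O : set V) (f : V -> 'M[R]_(p, q)) i j : open O ->
  Ck n O f -> Ck n O (fun x => f x i j).
Proof.
move=> oO; have lin : linear (fun M : 'M[R]_(p, q) => M i j : R).
  by move=> a A B; rewrite !mxE.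
pose LM := GRing.isLinear.Build _ _ _ _ _ lin.
pose L : {linear _ -> _} := HB.pack (fun M : 'M[R]_(p, q) => M i j : R) LM.
by apply: (@Ck_lin _ _ _ _ L) => //; exact: coord_continuous.
Qed.

Lemma differentiable_mx V p q (f : V -> 'M[R]_(p, q)) x :
  (forall i j, differentiable (fun x => f x i j : R) x) -> differentiable f x.
Proof.
move=> fij; have -> : f = \sum_(i < p) \sum_(j < q)
    (fun x => (f x i j : R) *: delta_mx i j).
  apply/funext => y; rewrite {1}[f y]matrix_sum_delta fct_sumE.
  by apply: eq_bigr => i _; rewrite fct_sumE.
apply: differentiable_sum => i; apply: differentiable_sum => j.
exact: differentiableZl.
Qed.

Lemma Ck_mx n V p q (O : set V) (f : V -> 'M[R]_(p, q)) : open O ->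
  (forall i j, Ck n O (fun x => f x i j : R)) -> Ck n O f.
Proof.
move=> oO; elim: n f => [|n IH] f fij.
  split=> // x Ox; apply: differentiable_mx => i j.
  by have [h _] := fij i j; exact: h.
have df x : O x -> differentiable f x.
  by move=> Ox; apply: differentiable_mx => i j; have [h _] := fij i j; exact: h.
split=> // v; apply: IH => i j; have [_ /(_ v)] := fij i j.
apply: Ck_eq => // x /set_mem Ox; rewrite derive_mx ?mxE //.
exact/diff_derivable/df.
Qed.

(* A finite coordinate system whose coordinate functionals are smooth; it turns
   the chain rule into a sum of products of real functions. *)
Definition has_coords W := exists (I : finType) (e : I -> W) (l : I -> W -> R),
  (forall x, x = \sum_i l i x *: e i) /\
  forall i n V (O : set V) (f : V -> W), open O -> Ck n O f ->
    Ck n O (fun x => l i (f x)).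

Lemma has_coords_mx p q : has_coords 'M[R]_(p, q).
Proof.
exists ('I_p * 'I_q)%type, (fun ij => delta_mx ij.1 ij.2),
  (fun ij (M : 'M[R]_(p, q)) => M ij.1 ij.2); split => [A|i n V O f oO]; last exact: Ck_coord.
by rewrite {1}[A]matrix_sum_delta pair_bigA.
Qed.

Lemma continuous_fst_nm V W : continuous (@fst V W).
Proof. by move=> x; exact: cvg_fst. Qed.

Lemma continuous_snd_nm V W : continuous (@snd V W).
Proof. by move=> x; exact: cvg_snd. Qed.

Lemma Ck_fst n V W U (O : set V) (f : V -> W * U) : open O ->
  Ck n O f -> Ck n O (fun x => (f x).1).
Proof. by move=> oO; apply: (@Ck_lin _ _ _ _ fst) => //; exact: continuous_fst_nm. Qed.

Lemma Ck_snd n V W U (O : set V) (f : V -> W * U) : open O ->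
  Ck n O f -> Ck n O (fun x => (f x).2).
Proof. by move=> oO; apply: (@Ck_lin _ _ _ _ snd) => //; exact: continuous_snd_nm. Qed.

Lemma Ck_pair n V W U (O : set V) (f : V -> W) (g : V -> U) : open O ->
  Ck n O f -> Ck n O g -> Ck n O (fun x => (f x, g x)).
Proof.
move=> oO; elim: n f g => [|n IH] f g [f1 f2] [g1 g2]; split=> //.
- by move=> x Ox; apply: differentiable_pair; [exact: f1|exact: g1].
- by move=> x Ox; apply: differentiable_pair; [exact: f1|exact: g1].
move=> v; apply: (Ck_eq oO) (IH _ _ (f2 v) (g2 v)) => x /set_mem Ox.
have [dfx dgx] := (f1 x Ox, g1 x Ox).
by rewrite [RHS]deriveE ?diff_pair -?deriveE //; exact: differentiable_pair.
Qed.

Lemma has_coords_prod W U : has_coords W -> has_coords U -> has_coords (W * U)%type.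
Proof.
move=> [I [e [l [el sl]]]] [J [e' [l' [el' sl']]]].
exists (I + J)%type, (fun k => match k with inl i => (e i, 0) | inr j => (0, e' j) end),
  (fun k z => match k with inl i => l i z.1 | inr j => l' j z.2 end).
split=> [[x y]|[i|j] n V O f oO fn].
- rewrite big_sumType /= {1}[x]el {1}[y]el'.
  have E1 : \sum_i l i x *: (e i, 0 : U) = (\sum_i l i x *: e i, 0).
    rewrite [LHS]surjective_pairing; congr (_, _).
      by rewrite (raddf_sum (@fst W U)); apply: eq_bigr.
    by rewrite (raddf_sum (@snd W U)) big1 //= => i _; rewrite scaler0.
  have E2 : \sum_j l' j y *: (0 : W, e' j) = (0, \sum_j l' j y *: e' j).
    rewrite [LHS]surjective_pairing; congr (_, _).
      by rewrite (raddf_sum (@fst W U)) big1 //= => i _; rewrite scaler0.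
    by rewrite (raddf_sum (@snd W U)); apply: eq_bigr.
  by rewrite E1 E2; congr (_, _); rewrite /= ?addr0 ?add0r.
- exact: sl (Ck_fst oO fn).
- exact: sl' (Ck_snd oO fn).
Qed.

(** The derivative is a sum of products of [l i ('D_v f)] with ['D_(e i) g] composed with [f]; the
    latter is again a composition, one order lower. Real-valued [g] suffice because matrices are
    treated entrywise. *)
Lemma Ck_comp_real n V W (O : set V) (O' : set W) (f : V -> W) (g : W -> R) :
  has_coords W -> open O -> (forall x, O x -> O' (f x)) ->
  Ck n O f -> Ck n O' g -> Ck n O (fun x => g (f x)).
Proof.
move=> [I [e [l [el sl]]]] oO fO.
elim: n f fO g => [|n IH] f fO g.
  move=> [f1 _] [g1 _]; split=> // x Ox.
  exact: differentiable_comp (f1 x Ox) (g1 _ (fO _ Ox)).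
move=> /[dup] /Ck_pred fn [f1 f2] [g1 g2]; split=> [x Ox|v].
  exact: differentiable_comp (f1 x Ox) (g1 _ (fO _ Ox)).
have h : Ck n O (fun x => \sum_i l i ('D_v f x) * 'D_(e i) g (f x)).
  apply: Ck_sum => // i; apply: CkM => //; first exact: sl (f2 v).
  exact: (IH f fO (fun y => 'D_(e i) g y) fn (g2 (e i))).
apply: Ck_eq h => // x /set_mem Ox.
have [dfx dgx] := (f1 x Ox, g1 _ (fO _ Ox)).
rewrite [RHS]deriveE; last exact: differentiable_comp.
rewrite diff_comp //= -(deriveE v dfx) [X in _ = 'd g (f x) X]el linear_sum /=.
by apply: eq_bigr => i _; rewrite linearZ /= (deriveE _ dgx).
Qed.

(** * Smoothness at a point, and its stability under matrix operations *)

(** Smoothness on some neighbourhood of [x]. The closure lemmas shrink the domain themselves, so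
    that conditions such as invertibility are checked at [x] only. *)
Definition smooth_at V W (f : V -> W) (x : V) : Prop :=
  exists O : set V, [/\ open O, O x & smooth_on O f].

Lemma smooth_at_on V W (O : set V) (f : V -> W) :
  (forall x, O x -> smooth_at f x) -> smooth_on O f.
Proof. by move=> h vs x /h [? [_ ? sf]]; exact: sf. Qed.

Lemma smooth_on_at V W (O : set V) (f : V -> W) x :
  open O -> smooth_on O f -> O x -> smooth_at f x.
Proof. by move=> oO sf Ox; exists O. Qed.

Lemma smooth_at_continuous V W (f : V -> W) x :
  smooth_at f x -> {for x, continuous f}.
Proof. by case=> O [_ Ox /(_ [::] x Ox)]; exact: differentiable_continuous. Qed.

Lemma smooth_at_eq V W (f g : V -> W) x :
  (\near x, f x = g x) -> smooth_at f x -> smooth_at g x.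
Proof.
move=> fg0; have : nbhs x [set y | f y = g y] by exact: fg0.
rewrite nbhsE => -[ O' [oO' O'x] fg] [ O [oO Ox /smooth_onP sf]].
have oI := openI oO oO'; exists (O `&` O'); split => //.
apply/smooth_onP => n; apply: (@Ck_eq n _ _ _ f) => //.
  by move=> z /set_mem [_ /fg].
by apply: Ck_sub (sf n) => z [].
Qed.

Lemma smooth_at_op1 V W U (h : (V -> W) -> V -> U) f x :
  (forall (O : set V) n, open O -> Ck n O f -> Ck n O (h f)) ->
  smooth_at f x -> smooth_at (h f) x.
Proof.
move=> hh [ O [oO Ox /smooth_onP sf]]; exists O; split => //.
by apply/smooth_onP => n; exact: hh (sf n).
Qed.

Lemma smooth_at_op2 V W1 W2 U (h : (V -> W1) -> (V -> W2) -> V -> U) f g x :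
  (forall (O : set V) n, open O -> Ck n O f -> Ck n O g -> Ck n O (h f g)) ->
  smooth_at f x -> smooth_at g x -> smooth_at (h f g) x.
Proof.
move=> hh [ O [oO Ox /smooth_onP sf]] [ O' [oO' O'x /smooth_onP sg]].
have oI := openI oO oO'; exists (O `&` O'); split => //.
apply/smooth_onP => n; apply: hh => //.
  by apply: Ck_sub (sf n) => z [].
by apply: Ck_sub (sg n) => z [].
Qed.

Lemma smooth_at_cst V W (a : W) (x : V) : smooth_at (fun=> a) x.
Proof.
exists setT; split=> //; first exact: openT.
by apply/smooth_onP => n; exact: Ck_cst.
Qed.

Lemma smooth_at_id V (x : V) : smooth_at (fun y : V => y) x.
Proof.
exists setT; split=> //; first exact: openT.
apply/smooth_onP => -[|n]; split=> //.
move=> v; have -> : (fun y : V => 'D_v (fun y : V => y) y) = (fun=> v).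
  by apply/funext => y; exact: derive_id.
exact: Ck_cst.
Qed.

Lemma smooth_atD V W (f g : V -> W) x :
  smooth_at f x -> smooth_at g x -> smooth_at (fun y => f y + g y) x.
Proof. by apply: (smooth_at_op2 (h := fun f g y => f y + g y)) => O n; exact: CkD. Qed.

Lemma smooth_atN V W (f : V -> W) x :
  smooth_at f x -> smooth_at (fun y => - f y) x.
Proof. by apply: (smooth_at_op1 (h := fun f y => - f y)) => O n; exact: CkN. Qed.

Lemma smooth_atM V (f g : V -> R) x :
  smooth_at f x -> smooth_at g x -> smooth_at (fun y => f y * g y) x.
Proof.
by apply: (smooth_at_op2 (W1 := R) (W2 := R) (U := R)
  (h := fun f g y => f y * g y)) => O n; exact: CkM.
Qed.

Lemma smooth_at_coord V p q (f : V -> 'M[R]_(p, q)) i j x :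
  smooth_at f x -> smooth_at (fun y => f y i j : R) x.
Proof.
by apply: (smooth_at_op1 (W := 'M[R]_(p, q)) (U := R)
  (h := fun f y => f y i j)) => O n; exact: Ck_coord.
Qed.

Lemma smooth_at_fst V W U (f : V -> W * U) x :
  smooth_at f x -> smooth_at (fun y => (f y).1) x.
Proof. by apply: (smooth_at_op1 (h := fun f y => (f y).1)) => O n; exact: Ck_fst. Qed.

Lemma smooth_at_snd V W U (f : V -> W * U) x :
  smooth_at f x -> smooth_at (fun y => (f y).2) x.
Proof. by apply: (smooth_at_op1 (h := fun f y => (f y).2)) => O n; exact: Ck_snd. Qed.

Lemma smooth_at_pair V W U (f : V -> W) (g : V -> U) x :
  smooth_at f x -> smooth_at g x -> smooth_at (fun y => (f y, g y)) x.
Proof. by apply: (smooth_at_op2 (h := fun f g y => (f y, g y))) => O n; exact: Ck_pair. Qed.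

Lemma smooth_at_sum V (I : finType) (P : pred I) (f : I -> V -> R) x :
  (forall i, smooth_at (f i) x) ->
  smooth_at (fun y => \sum_(i | P i) f i y) x.
Proof.
move=> fi; elim: (index_enum I) => [|i r IH].
  by under eq_fun do rewrite big_nil; exact: smooth_at_cst.
under eq_fun do rewrite big_cons; case: (P i) => //.
exact: smooth_atD.
Qed.

Lemma smooth_at_prod V (I : finType) (P : pred I) (f : I -> V -> R) x :
  (forall i, smooth_at (f i) x) ->
  smooth_at (fun y => \prod_(i | P i) f i y) x.
Proof.
move=> fi; elim: (index_enum I) => [|i r IH].
  by under eq_fun do rewrite big_nil; exact: smooth_at_cst.
under eq_fun do rewrite big_cons; case: (P i) => //.
exact: smooth_atM.
Qed.

(** An open condition [A] satisfied by [f] at [x] persists nearby by continuity. Inverses, square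
    roots and compositions are all smooth under a condition of this kind. *)
Lemma smooth_at_restrict V W U (A : set W) (f : V -> W) (h : V -> U) x :
  open A -> A (f x) -> smooth_at f x ->
  (forall (O : set V) n, open O -> (forall y, O y -> A (f y)) ->
     Ck n O f -> Ck n O h) -> smooth_at h x.
Proof.
move=> oA Afx [ O [oO Ox /smooth_onP sf]] hh.
have cf y : O y -> {for y, continuous f}.
  move=> Oy; apply: differentiable_continuous.
  by have [h1 _] := sf 0%N; exact: h1.
have oI : open (O `&` f @^-1` A) by exact: open_setI_preimage.
exists (O `&` f @^-1` A); split => //.
apply/smooth_onP => n; apply: hh => //; first by move=> y [].
by apply: Ck_sub (sf n) => z [].
Qed.

Lemma smooth_atV V (f : V -> R) x :
  f x != 0 -> smooth_at f x -> smooth_at (fun y => (f y)^-1) x.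
Proof.
move=> fx sf; apply: (smooth_at_restrict (@open_neq R 0) fx sf).
by move=> O n oO O0; exact: CkV.
Qed.

Lemma smooth_at_sqrt V (f : V -> R) x :
  0 < f x -> smooth_at f x -> smooth_at (fun y => Num.sqrt (f y)) x.
Proof.
move=> fx sf; apply: (smooth_at_restrict (@open_gt R 0) fx sf).
by move=> O n oO O0; exact: CkSqrt.
Qed.

Lemma smooth_at_mx V p q (f : V -> 'M[R]_(p, q)) x :
  (forall i j, smooth_at (fun y => f y i j : R) x) -> smooth_at f x.
Proof.
move=> fij; have /choice [ O hO] : forall ij : 'I_p * 'I_q, exists O : set V,
    [/\ open O, O x & smooth_on O (fun y => f y ij.1 ij.2 : R)].
  by case=> i j; exact: fij.
have /= : nbhs x [set y | forall ij, O ij y].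
  apply: filter_forall => ij; apply: open_nbhs_nbhs.
  by have [oO Ox _] := hO ij; split.
rewrite nbhsE => -[A [oA Ax] AO]; exists A; split => //.
apply/smooth_onP => n; apply: Ck_mx => // i j.
have [_ _ /smooth_onP /(_ n)] := hO (i, j).
by apply: Ck_sub => y /AO /(_ (i, j)).
Qed.

Lemma smooth_at_comp V W p q (f : V -> W) (g : W -> 'M[R]_(p, q)) x :
  has_coords W -> smooth_at f x -> smooth_at g (f x) ->
  smooth_at (fun y => g (f y)) x.
Proof.
move=> cW sf [ O' [oO' O'fx /smooth_onP sg]].
apply: smooth_at_mx => i j.
apply: (smooth_at_restrict (U := R) oO' O'fx sf) => O n oO fO fn.
exact: (Ck_comp_real cW oO fO fn (Ck_coord i j oO' (sg n))).
Qed.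

Lemma smooth_at_mulmx V p q r (f : V -> 'M[R]_(p, q)) (g : V -> 'M[R]_(q, r)) x :
  smooth_at f x -> smooth_at g x -> smooth_at (fun y => f y *m g y) x.
Proof.
move=> sf sg; apply: smooth_at_mx => i j.
under eq_fun do rewrite mxE.
by apply: smooth_at_sum => k; apply: smooth_atM; exact: smooth_at_coord.
Qed.

Lemma smooth_at_reindex V p q p' q' (f : V -> 'M[R]_(p, q)) (g : 'M[R]_(p, q) -> 'M[R]_(p', q')) 
    (a : 'I_p' -> 'I_q' -> 'I_p) (b : 'I_p' -> 'I_q' -> 'I_q) x :
  (forall A i j, g A i j = A (a i j) (b i j)) ->
  smooth_at f x -> smooth_at (fun y => g (f y)) x.
Proof.
move=> gE sf; apply: smooth_at_mx => i j.
by under eq_fun do rewrite gE; exact: smooth_at_coord.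
Qed.

Lemma smooth_at_trmx V p q (f : V -> 'M[R]_(p, q)) x :
  smooth_at f x -> smooth_at (fun y => (f y)^T) x.
Proof. by apply: smooth_at_reindex => A i j; rewrite mxE. Qed.

Lemma smooth_at_lsubmx V p q r (f : V -> 'M[R]_(p, q + r)) x :
  smooth_at f x -> smooth_at (fun y => lsubmx (f y)) x.
Proof. by apply: smooth_at_reindex => A i j; rewrite mxE. Qed.

Lemma smooth_at_usubmx V p q r (f : V -> 'M[R]_(p + q, r)) x :
  smooth_at f x -> smooth_at (fun y => usubmx (f y)) x.
Proof. by apply: smooth_at_reindex => A i j; rewrite mxE. Qed.

Lemma smooth_at_dsubmx V p q r (f : V -> 'M[R]_(p + q, r)) x :
  smooth_at f x -> smooth_at (fun y => dsubmx (f y)) x.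
Proof. by apply: smooth_at_reindex => A i j; rewrite mxE. Qed.

Lemma smooth_at_row_mx V p q r (f : V -> 'M[R]_(p, q)) (g : V -> 'M[R]_(p, r)) x :
  smooth_at f x -> smooth_at g x -> smooth_at (fun y => row_mx (f y) (g y)) x.
Proof.
move=> sf sg; apply: smooth_at_mx => i j; under eq_fun do rewrite mxE.
by case: (fintype.split j) => k; exact: smooth_at_coord.
Qed.

Lemma smooth_at_col_mx V p q r (f : V -> 'M[R]_(p, r)) (g : V -> 'M[R]_(q, r)) x :
  smooth_at f x -> smooth_at g x -> smooth_at (fun y => col_mx (f y) (g y)) x.
Proof.
move=> sf sg; apply: smooth_at_mx => i j; under eq_fun do rewrite mxE.
by case: (fintype.split i) => k; exact: smooth_at_coord.
Qed.

Lemma smooth_at_block_mx V p q r s (f : V -> 'M[R]_(p, r)) (g : V -> 'M[R]_(p, s))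
    (h : V -> 'M[R]_(q, r)) (k : V -> 'M[R]_(q, s)) x :
  smooth_at f x -> smooth_at g x -> smooth_at h x -> smooth_at k x ->
  smooth_at (fun y => block_mx (f y) (g y) (h y) (k y)) x.
Proof.
by move=> sf sg sh sk; apply: smooth_at_col_mx; exact: smooth_at_row_mx.
Qed.

Lemma smooth_atZ V p q (a : V -> R) (f : V -> 'M[R]_(p, q)) x :
  smooth_at a x -> smooth_at f x -> smooth_at (fun y => a y *: f y) x.
Proof.
move=> sa sf; apply: smooth_at_mx => i j; under eq_fun do rewrite mxE.
by apply: smooth_atM => //; exact: smooth_at_coord.
Qed.

Lemma smooth_at_det V n (f : V -> 'M[R]_n) x :
  smooth_at f x -> smooth_at (fun y => \det (f y)) x.
Proof.
move=> sf; apply: smooth_at_sum => s; apply: smooth_atM.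
  exact: smooth_at_cst.
by apply: smooth_at_prod => i; exact: smooth_at_coord.
Qed.

Lemma near_unitmx V n (f : V -> 'M[R]_n) x :
  smooth_at f x -> f x \in unitmx -> \near x, f x \in unitmx.
Proof.
move=> sf; rewrite unitmxE unitfE => fx.
have h : \forall y \near x, \det (f y) != 0 :=
  smooth_at_continuous (smooth_at_det sf) (open_nbhs_nbhs (conj (@open_neq R 0) fx)).
by apply: filterS h => y; rewrite unitmxE unitfE.
Qed.

Lemma smooth_at_invmx V n (f : V -> 'M[R]_n) x :
  f x \in unitmx -> smooth_at f x -> smooth_at (fun y => invmx (f y)) x.
Proof.
move=> fx sf.
(* [invmx] returns its argument on singular matrices, so the cofactor formula is available only near
   [x]. *)
have /smooth_at_eq h : \near x, (fun y => (\det (f y))^-1 *: \adj (f y)) x = invmx (f x).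
  by apply: filterS (near_unitmx sf fx) => y fy; rewrite /invmx fy.
apply: h; apply: smooth_atZ.
  by apply: (smooth_atV _ (smooth_at_det sf)); rewrite -unitfE -unitmxE.
apply: smooth_at_mx => i j; under eq_fun do rewrite mxE.
apply: smooth_atM; first exact: smooth_at_cst.
apply: smooth_at_det; apply: smooth_at_mx => k l.
by under eq_fun do rewrite !mxE; exact: smooth_at_coord.
Qed.

End Smoothness.

(** * Charts and trivializations *)

Section ChartLemmas.
Context {R : realType} {d : nat} (M : manifold R d).
Implicit Types (c : chart R d M) (p : M).

Lemma open_chart_image c (A : set M) :
  is_chart c -> open A -> A `<=` dom c -> open (c @` A).
Proof.
move=> [_ oi ck _ cb] oA Ad.
have -> : c @` A = cimg c `&` bwd c @^-1` A.
  apply/seteqP; split=> [_ [x Ax <-]|y [[x dx <-] /=]].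
    by split; [exists x => //; exact: Ad|rewrite /= ck //; exact: Ad].
  by rewrite ck // => Ax; exists x.
exact: open_setI_preimage.
Qed.

(** The transition maps between [c] and [chart_at p] are inverse to each other near the image of
    [p], so by the chain rule their Jacobians are inverse matrices. *)
Lemma tframe_unit c p : atlas c -> dom c p -> tframe c p \in unitmx.
Proof.
move=> ac dp; set c0 := chart_at p.
have ac0 : atlas c0 := chart_at_atlas p; have dp0 : dom c0 p := chart_at_dom p.
have [od0 _ ck0 _ _] := atlas_chart ac0; have [od _ ck _ _] := atlas_chart ac.
pose f y := c (bwd c0 y); pose g y := c0 (bwd c y).
have df : differentiable f (c0 p).
  by apply: (atlas_compat ac0 ac [::]); exists p.
have fp : f (c0 p) = c p by rewrite /f ck0.
have dg : differentiable g (f (c0 p)).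
  by rewrite fp; apply: (atlas_compat ac ac0 [::]); exists p.
have gf : \forall y \near c0 p, (g \o f) y = id y.
  have oU : open (c0 @` (dom c0 `&` dom c)).
    apply: open_chart_image (atlas_chart ac0) _ _; last by move=> x [].
    exact: openI.
  have : (c0 @` (dom c0 `&` dom c)) (c0 p) by exists p.
  move=> /(conj oU) /open_nbhs_nbhs; apply: filterS => _ [x [d0 dx] <-] /=.
  by rewrite /f /g ck0 ?ck.
suff : tframe c p *m jacobian g (f (c0 p)) = 1%:M by move=> /mulmx1_unit [h _]; exact: h.
apply/row_matrixP => i; rewrite row_mul row1 (rowE i (tframe c p)).
have E : 'D_(delta_mx 0 i) (g \o f) (c0 p) = delta_mx 0 i.
  by rewrite (near_eq_derive _ gf) derive_id.
rewrite -[RHS]E [RHS]deriveE; last exact: differentiable_comp.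
by rewrite diff_comp //= /jacobian !mul_rV_lin1.
Qed.

Lemma gframe_unit c p : atlas c -> dom c p -> gframe c p \in unitmx.
Proof.
move=> ac dp; have tu := tframe_unit ac dp.
rewrite unitmxE /gframe det_ublock unitrM -!unitmxE tu.
by rewrite unitmx_tr unitmx_inv.
Qed.

End ChartLemmas.

(** * Bundle trivializations from smooth group actions *)

Section Bundles.
Context {R : realType} {d : nat} {M : manifold R d}.
Implicit Types (c : chart R d M) (E : forall p : M, set 'M[R]_(d + d)).

(** A trivialization already provides local lifts of [tau] to [G]; composing such a lift with the
    smooth graph of [endo_in c S] lifts the section. *)
Lemma smooth_sectionP E N (G H : set 'M[R]_N) (S : M -> 'M[R]_(d + d)) :
  smooth_endo S -> (forall p, E p (S p)) -> smooth_section_of E G H S.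
Proof.
move=> sS ES; split=> // c O tau sigma [[ac oO Od] _ _ tauG _].
have [_ oi ck _ _] := atlas_chart ac.
have XS y : (c @` O) y -> total_in c O E (y, endo_in c S y).
  move=> [x Ox <-]; exists x, (S x); split; [exact: Ox|exact: ES|].
  by rewrite /endo_in (ck x (Od x Ox)).
move=> y0 Oy0; have cy0 : cimg c y0 by case: Oy0 => x /Od dx <-; exists x.
have [U [g [oU Uy gs gU]]] := tauG _ (XS _ Oy0).
have sS0 y : cimg c y -> smooth_at (fun y => (y, endo_in c S y)) y.
  move=> cy; apply: smooth_at_pair; first exact: smooth_at_id.
  exact: smooth_on_at (sS c ac) cy.
exists (cimg c `&` (fun y => (y, endo_in c S y)) @^-1` U),
  (fun y => g (y, endo_in c S y)); split.
- by apply: open_setI_preimage => // y cy; exact: smooth_at_continuous (sS0 y cy).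
- by [].
- apply: smooth_at_on => y [cy Uy']; apply: smooth_at_comp (sS0 y cy) _.
    by apply: has_coords_prod; exact: has_coords_mx.
  exact: smooth_on_at gs Uy'.
- by move=> y Oy [_ Uy']; apply: gU => //; exact: XS.
Qed.

(** The map [act] parametrizes each fibre by [G], exactly modulo [H]. It induces [sigma], whose
    smoothness is that of [act], and the local sections [gam] are the lifts required of the inverse
    map [tau]. *)
Lemma fibre_bundle_of_action E N (G H : set 'M[R]_N) :
  (forall p, exists c (O : set M) (act : 'rV[R]_d * 'M[R]_N -> 'M[R]_(d + d)),
    [/\ [/\ atlas c, open O, O `<=` dom c & O p],
        (forall y g, (c @` O) y -> G g -> total_in c O E (y, act (y, g))),
        (forall y g g', (c @` O) y -> G g -> G g' ->
           (act (y, g) = act (y, g') <-> lcoset_mx g H = lcoset_mx g' H)),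
        (forall y g, (c @` O) y -> G g -> smooth_at act (y, g))
      & forall z, total_in c O E z -> exists gam : 'rV[R]_d * 'M[R]_(d + d) -> 'M[R]_N,
          smooth_at gam z /\
          \forall z' \near z, total_in c O E z' ->
            G (gam z') /\ act (z'.1, gam z') = z'.2]) ->
  fibre_bundle E G H.
Proof.
move=> h p; have [c [ O [act [[ac oO Od Op] actX actH act_smooth lift]]]] := h p.
set X := total_in c O E in actX lift.
have XO z : X z -> (c @` O) z.1 by move=> [q [A [Oq _ ->]]]; exists q.
have transitive z : X z -> exists g, G g /\ act (z.1, g) = z.2.
  by move=> Xz; have [gam [_ /nbhs_singleton /(_ Xz)]] := lift z Xz; exists (gam z).
(* The representatives chosen by [get] depend on nothing smoothly; [actH] makes [tau] and [sigma]
   independent of the choice. *)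
pose tau z := lcoset_mx (get [set g | G g /\ act (z.1, g) = z.2]) H.
pose sigma (z : 'rV[R]_d * set 'M[R]_N) :=
  act (z.1, get [set g | G g /\ z.2 = lcoset_mx g H]).
have tauP z g : X z -> G g -> act (z.1, g) = z.2 -> tau z = lcoset_mx g H.
  move=> Xz Gg gz; have [Gh hz] := getI (P := [set g | G g /\ act (z.1, g) = z.2]) (conj Gg gz).
  by apply/(actH z.1) => //; [exact: XO|rewrite hz].
have sigmaP y g : (c @` O) y -> G g -> sigma (y, lcoset_mx g H) = act (y, g).
  move=> Oy Gg; rewrite /sigma /=.
  have [Gh hz] := getI (P := [set h | G h /\ lcoset_mx g H = lcoset_mx h H]) (conj Gg erefl).
  exact/(actH y).
exists c, O, tau, sigma; split=> //; split.
- by [].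
- move=> z Xz; have [g [Gg gz]] := transitive z Xz.
  rewrite (tauP z g) // sigmaP //; last exact: XO.
  by split => //; exists g.
- move=> y q Oy [g Gg <-]; rewrite sigmaP //.
  by split; [exact: actX|apply: tauP => //; exact: actX].
- move=> z Xz; have [gam [[U [oU Uz gs]] gamG]] := lift z Xz.
  have : nbhs z [set z' | total_in c O E z' -> G (gam z') /\ act (z'.1, gam z') = z'.2].
    exact: gamG.
  rewrite nbhsE => -[U' [oU' U'z] UG]; exists (U `&` U'), gam; split => //.
  + exact: openI.
  + by move=> vs x [Ux _]; exact: gs.
  + by move=> z' Xz' [_ /UG /(_ Xz') [Gg gz]]; split => //; exact: tauP.
- move=> [y g] [Oy Gg]; have [U [oU Uyg sU]] := act_smooth y g Oy Gg.
  exists U, act; split=> // -[y' g'] [Oy' Gg'] _ /=.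
  exact: sigmaP.
Qed.

End Bundles.

(** * Reduction to a homogeneous model *)

Lemma invmx_mul (F : comUnitRingType) n (A B : 'M[F]_n) :
  A \in unitmx -> B \in unitmx -> invmx (A *m B) = invmx B *m invmx A.
Proof.
move=> uA uB; have uAB : A *m B \in unitmx by rewrite unitmx_mul uA.
by rewrite -[RHS](mulmxK uAB) -(mulmxA (invmx B)) mulKmx // mulVmx // mul1mx.
Qed.

Section HomogeneousModel.
Context {R : realType} {N : nat}.
Implicit Types (G H E : set 'M[R]_N) (B g h : 'M[R]_N).

(* E is the conjugacy class of B0 under G, with stabilizer H, and G -> E has a smooth
   section near B0. *)
Record homogeneous_model G H E B0 : Prop := HomogeneousModel {
  hm_unit : forall g, G g -> g \in unitmx;
  hmM : forall g h, G g -> G h -> G (g *m h);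
  hmV : forall g, G g -> G (invmx g);
  hm_stab : forall h, H h <-> G h /\ h *m B0 = B0 *m h;
  hm_orbit : forall B, E B <-> exists g, G g /\ B = g *m B0 *m invmx g;
  hm_section : exists gam : 'M[R]_N -> 'M[R]_N, smooth_at gam B0 /\
    \forall B \near B0, E B -> G (gam B) /\ gam B *m B0 = B *m gam B }.

Variables (G H E : set 'M[R]_N) (B0 : 'M[R]_N).
Hypothesis mod : homogeneous_model G H E B0.

Lemma conj_eqP g g' : g \in unitmx -> g' \in unitmx ->
  (g *m B0 *m invmx g = g' *m B0 *m invmx g' <->
   invmx g *m g' *m B0 = B0 *m (invmx g *m g')).
Proof.
move=> ug ug'; split=> [E1|E1].
  rewrite -mulmxA -[g' *m B0](mulmxKV ug') -E1 -!mulmxA mulKmx //.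
have {}E1 : g' *m B0 = g *m B0 *m (invmx g *m g').
  by rewrite -mulmxA -E1 -!mulmxA mulKVmx.
by rewrite E1 mulmxA mulmxK.
Qed.

(** Both sides say that [invmx g *m g'] commutes with [B0], that is, lies in the stabilizer [H]. *)
Lemma conj_lcosetP g g' : G g -> G g' ->
  g *m B0 *m invmx g = g' *m B0 *m invmx g' <->
  lcoset_mx g H = lcoset_mx g' H.
Proof.
move=> Gg Gg'; have [ug ug'] := (hm_unit mod Gg, hm_unit mod Gg').
pose k := invmx g *m g'; have Gk : G k := hmM mod (hmV mod Gg) Gg'.
have g'E : g' = g *m k by rewrite mulKVmx.
have uk := hm_unit mod Gk.
apply: (iff_trans (conj_eqP ug ug')); rewrite -/k.
clearbody k; split=> [kB|E1].
  have kVB : invmx k *m B0 = B0 *m invmx k.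
    by rewrite -[LHS](mulmxK uk) -(mulmxA _ B0) -kB mulKmx.
  apply/seteqP; split=> _ [h /(hm_stab mod) [Gh hB] <-].
    exists (invmx k *m h); last by rewrite g'E -!mulmxA mulKVmx.
    apply/(hm_stab mod); split; first exact: (hmM mod (hmV mod Gk) Gh).
    by rewrite -mulmxA hB !mulmxA kVB.
  exists (k *m h); last by rewrite g'E -!mulmxA.
  apply/(hm_stab mod); split; first exact: (hmM mod Gk Gh).
  by rewrite -mulmxA hB !mulmxA kB.
have H1 : H 1%:M.
  apply/(hm_stab mod); split; last by rewrite mul1mx mulmx1.
  by rewrite -(mulmxV ug); exact: (hmM mod Gg (hmV mod Gg)).
have : lcoset_mx g H g' by rewrite E1; exists 1%:M => //; rewrite mulmx1.
move=> [h Hh gh]; suff -> : k = h by have /(hm_stab mod) [] := Hh.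
by rewrite -[k](mulKmx ug) -g'E -gh mulKmx.
Qed.

(** If [g1] carries [B0] to [B1], conjugating back by [g1], applying the section near [B0] and
    multiplying by [g1] gives a section near [B1]. *)
Lemma hm_section_at B1 : E B1 -> exists gam : 'M[R]_N -> 'M[R]_N,
  smooth_at gam B1 /\
  \forall B \near B1, E B -> G (gam B) /\ gam B *m B0 *m invmx (gam B) = B.
Proof.
move=> /(hm_orbit mod) [g1 [Gg1 B1E]]; have ug1 := hm_unit mod Gg1.
have [gam [sg gamP]] := hm_section mod.
pose f B := invmx g1 *m B *m g1.
have sf B : smooth_at f B.
  apply: smooth_at_mulmx; last exact: smooth_at_cst.
  by apply: smooth_at_mulmx; [exact: smooth_at_cst|exact: smooth_at_id].
have fB1 : f B1 = B0 by rewrite /f B1E -!mulmxA mulKmx // mulVmx // mulmx1.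
exists (fun B => g1 *m gam (f B)); split.
  apply: smooth_at_mulmx; first exact: smooth_at_cst.
  by apply: smooth_at_comp (sf B1) _; [exact: has_coords_mx|rewrite fB1].
have cf : f B @[B --> B1] --> B0.
  by rewrite -fB1; exact: smooth_at_continuous (sf B1).
have : \forall B \near B1, E (f B) ->
  G (gam (f B)) /\ gam (f B) *m B0 = f B *m gam (f B) := cf _ gamP.
apply: filterS => B h /(hm_orbit mod) [g [Gg BE]].
have [] := h.
  apply/(hm_orbit mod); exists (invmx g1 *m g).
  split; first exact: (hmM mod (hmV mod Gg1) Gg).
  have ug := hm_unit mod Gg.
  by rewrite invmx_mul ?unitmx_inv // invmxK BE /f -!mulmxA.
move=> Gg2 gE; split; first exact: (hmM mod Gg1 Gg2).
have ug := hm_unit mod Gg2; have ugg := hm_unit mod (hmM mod Gg1 Gg2).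
apply: (canLR (mulmxK ugg)); rewrite -mulmxA gE /f.
by rewrite !mulmxA mulmxV // mul1mx.
Qed.

End HomogeneousModel.

Section LocalModel.
Context {R : realType} {d : nat} {M : manifold R d} (w : symplectic M).

Lemma form_in_unit (c : chart R d M) p :
  atlas c -> dom c p -> form_in c w (c p) \in unitmx.
Proof.
move=> ac dp; have [_ _ ck _ _] := atlas_chart ac.
rewrite /form_in ck // !unitmx_mul unitmx_tr unitmx_inv tframe_unit //=.
by rewrite andbT; exact: sform_nondeg.
Qed.

Lemma form_in_skew (c : chart R d M) y : (form_in c w y)^T = - form_in c w y.
Proof.
by rewrite /form_in !trmx_mul trmxK sform_skew mulNmx mulmxN mulmxA.
Qed.

(** In a chart the fibre depends on the point only through the matrix [W] of the symplectic form, so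
    the family [F] is trivialized over the space of forms and then pulled back. Smoothness is meant
    in the ambient space of all matrices, and no manifold of skew invertible matrices is needed. *)
Definition local_model N (F : 'M[R]_d -> set 'M[R]_(d + d)) (E : set 'M[R]_N)
    (W0 : 'M[R]_d) : Prop :=
  exists (theta : 'M[R]_d * 'M[R]_(d + d) -> 'M[R]_N)
         (psi : 'M[R]_d * 'M[R]_N -> 'M[R]_(d + d)),
  \forall W \near W0, W^T = - W -> W \in unitmx ->
    (forall A, F W A ->
       [/\ E (theta (W, A)), psi (W, theta (W, A)) = A & smooth_at theta (W, A)]) /\
    (forall B, E B ->
       [/\ F W (psi (W, B)), theta (W, psi (W, B)) = B & smooth_at psi (W, B)]).

Variables (Fp : forall p : M, set 'M[R]_(d + d)) (F : 'M[R]_d -> set 'M[R]_(d + d)).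
Hypothesis FpE : forall (c : chart R d M) p A, atlas c -> dom c p ->
  (Fp p A <-> F (form_in c w (c p)) (endo_coord c p A)).

Lemma total_inP c (O : set M) z : atlas c -> O `<=` dom c ->
  (total_in c O Fp z <-> (c @` O) z.1 /\ F (form_in c w z.1) z.2).
Proof.
move=> ac Od; split=> [[p [A [Op FA ->]]]|[[p Op pz] Fz]].
  by split; [exists p|exact/(FpE _ ac (Od _ Op))].
have gu := gframe_unit ac (Od _ Op).
exists p, (gframe c p *m z.2 *m invmx (gframe c p)).
have zE : endo_coord c p (gframe c p *m z.2 *m invmx (gframe c p)) = z.2.
  by rewrite /endo_coord -!mulmxA mulVmx // mulmx1 mulKmx.
split; [exact: Op| |].
  by apply/(FpE _ ac (Od _ Op)); rewrite zE pz.
by rewrite zE pz -surjective_pairing.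
Qed.

(** The action is conjugation of [B0] by [g], carried to the fibre by [psi] over the form at [y].
    Its local sections are those of the orbit of [B0], precomposed with [theta]. *)
Lemma fibre_bundle_of_model N (G H E : set 'M[R]_N) (B0 : 'M[R]_N) :
  homogeneous_model G H E B0 ->
  (forall W0 : 'M[R]_d, W0^T = - W0 -> W0 \in unitmx -> local_model F E W0) ->
  fibre_bundle Fp G H.
Proof.
move=> mod loc; apply: fibre_bundle_of_action => p.
pose c := chart_at p; have ac : atlas c := chart_at_atlas p.
have dp : dom c p := chart_at_dom p.
have [od oi ck cf _] := atlas_chart ac.
pose W y := form_in c w y.
have [theta [psi tp]] := loc (W (c p)) (form_in_skew c _) (form_in_unit ac dp).
have : nbhs (W (c p)) [set W | W^T = - W -> W \in unitmx ->
    (forall A, F W A ->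
       [/\ E (theta (W, A)), psi (W, theta (W, A)) = A & smooth_at theta (W, A)]) /\
    (forall B, E B ->
       [/\ F W (psi (W, B)), theta (W, psi (W, B)) = B & smooth_at psi (W, B)])].
  exact: tp.
rewrite nbhsE => -[U [oU Up] {}tp].
have sW y : cimg c y -> smooth_at W y.
  by move=> cy; exact: (smooth_on_at oi (sform_smooth w ac) cy).
have cimgP q : dom c q -> cimg c (c q) by exists q.
have oV : open (cimg c `&` W @^-1` U).
  by apply: (open_setI_preimage oi _ oU) => y /sW h; exact: (smooth_at_continuous h).
(* The part of the chart where the form stays in the neighbourhood [U] on which the local model is
   valid. *)
pose O := dom c `&` c @^-1` (cimg c `&` W @^-1` U).
have Od : O `<=` dom c by move=> q [].
have model y : (c @` O) y ->
    (forall A, F (W y) A ->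
       [/\ E (theta (W y, A)), psi (W y, theta (W y, A)) = A & smooth_at theta (W y, A)]) /\
    (forall B, E B ->
       [/\ F (W y) (psi (W y, B)), theta (W y, psi (W y, B)) = B & smooth_at psi (W y, B)]).
  by move=> [q [dq [cq Uq]] <-]; apply: tp => //; [exact: form_in_skew|exact: form_in_unit].
have orbit g : G g -> E (g *m B0 *m invmx g).
  by move=> Gg; apply/(hm_orbit mod); exists g.
have cO y : (c @` O) y -> cimg c y by move=> [q [dq _] <-]; exact: cimgP.
exists c, O, (fun z => psi (W z.1, z.2 *m B0 *m invmx z.2)); split.
- split; [exact: ac|exact: (open_setI_preimage od cf oV)|exact: Od|].
  by split; [exact: dp|split; [exact: cimgP|exact: Up]].
- move=> y g Oy Gg; apply/total_inP => //; split => //=.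
  by have [_ /(_ _ (orbit g Gg)) []] := model y Oy.
- move=> y g g' Oy Gg Gg' /=; apply: (iff_trans _ (conj_lcosetP mod Gg Gg')).
  split=> [E1|->//].
  have [_ m2] := model y Oy.
  have [_ <- _] := m2 _ (orbit g Gg); have [_ <- _] := m2 _ (orbit g' Gg').
  by rewrite E1.
- move=> y g Oy Gg; have ug := hm_unit mod Gg.
  apply: (@smooth_at_comp _ _ _ _ _ (fun z => (W z.1, z.2 *m B0 *m invmx z.2)) psi).
  + by apply: has_coords_prod; exact: has_coords_mx.
  + have s2 : smooth_at (fun z : 'rV[R]_d * 'M[R]_N => z.2) (y, g).
      by apply: smooth_at_snd; exact: smooth_at_id.
    apply: smooth_at_pair.
      apply: (@smooth_at_comp _ _ _ _ _ fst W); first exact: has_coords_mx.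
        by apply: smooth_at_fst; exact: smooth_at_id.
      by apply: sW; exact: cO.
    apply: smooth_at_mulmx; last exact: smooth_at_invmx.
    by apply: smooth_at_mulmx => //; exact: smooth_at_cst.
  + by have [_ /(_ _ (orbit g Gg)) []] := model y Oy.
- move=> [y A] /(total_inP _ ac Od) [/= Oy FA].
  have [/(_ A FA) [Et _ st] _] := model y Oy.
  have [gam [sg gamP]] := hm_section_at mod Et.
  pose f (z : 'rV[R]_d * 'M[R]_(d + d)) := theta (W z.1, z.2).
  have sf : smooth_at f (y, A).
    apply: (@smooth_at_comp _ _ _ _ _ (fun z => (W z.1, z.2)) theta).
    + by apply: has_coords_prod; exact: has_coords_mx.
    + apply: smooth_at_pair; last by apply: smooth_at_snd; exact: smooth_at_id.
      apply: (@smooth_at_comp _ _ _ _ _ fst W); first exact: has_coords_mx.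
        by apply: smooth_at_fst; exact: smooth_at_id.
      by apply: sW; exact: cO.
    + exact: st.
  exists (fun z => gam (f z)); split.
    by apply: smooth_at_comp sf sg; exact: has_coords_mx.
  have : \forall z \near (y, A), E (f z) ->
      G (gam (f z)) /\ gam (f z) *m B0 *m invmx (gam (f z)) = f z.
    exact: (smooth_at_continuous sf gamP).
  apply: filterS => z h /(total_inP _ ac Od) [Oz Fz].
  have [/(_ _ Fz) [Ez zE _] _] := model z.1 Oz.
  by have [Gz gz] := h Ez; split => //; rewrite gz.
Qed.

End LocalModel.

(** * Split endomorphisms *)

(** Since [S] squares to [r * r], its only possible eigenvalues are [r] and [- r]. Ranks of shifts
    replace dimensions of eigenspaces because they behave well under conjugation, blocks and
    complexification. *)
Lemma two_equal_eigenspacesP (F : fieldType) k (S : 'M[F]_k) (r : F) :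
  (0 < k)%N -> r + r != 0 -> S *m S = (r * r)%:M ->
  (two_equal_eigenspaces S <-> \rank (S - r%:M)%R = \rank (S + r%:M)%R).
Proof.
move=> k0 rr SS.
have rN : r != - r by rewrite -subr_eq0 opprK.
have rkE a : \rank (eigenspace S a)%R = (k - \rank (S - a%:M)%R)%N by exact: mxrank_ker.
have evE a : eigenvalue S a -> (a == r) || (a == - r).
  move=> /eigenvalueP [v vS vn0]; rewrite -eqf_sqr -subr_eq0.
  have : (a ^+ 2 - r ^+ 2) *: v = 0.
    rewrite scalerBl !expr2 -!scalerA -vS scalemxAl -vS -mulmxA SS.
    by rewrite mul_mx_scalar -scalerA subrr.
  by move=> /eqP; rewrite scaler_eq0 (negPf vn0) orbF.
have le a : (\rank (S - a%:M)%R <= k)%N by exact: rank_leq_row.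
have NE : S - (- r)%:M = S + r%:M by rewrite raddfN opprK.
have le' : (\rank (S + r%:M)%R <= k)%N by exact: rank_leq_row.
split=> [[a [b [ab ev eqr]]]|eqr].
  have ea : eigenvalue S a by rewrite ev mem_head.
  have eb : eigenvalue S b by rewrite ev !inE eqxx orbT.
  move: eqr; rewrite !rkE.
  case/orP: (evE a ea) (evE b eb) ab => /eqP -> /orP [] /eqP ->;
    rewrite ?eqxx // ?NE => _ E1.
    by apply/eqP; rewrite -(eqn_sub2lE (le r) le') E1.
  by apply/esym/eqP; rewrite -(eqn_sub2lE le' (le r)) E1.
have prod0 : (S - r%:M) *m (S + r%:M) = 0.
  by rewrite mulmxBl !mulmxDr SS -!scalar_mxC -scalar_mxM addrKA subrr.
(* Both eigenvalues must occur: if [S - r] were invertible, [S + r] would vanish, and the equality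
   of ranks would force the size [k] to be 0. *)
have nfull : (\rank (S - r%:M)%R < k)%N.
  rewrite ltn_neqAle le andbT; apply/eqP => full.
  have u : S - r%:M \in unitmx by rewrite -row_full_unit /row_full full.
  have S0 : S + r%:M = 0 by rewrite -[LHS](mulKmx u) prod0 mulmx0.
  by move: k0; rewrite -full eqr S0 mxrank0.
exists r, (- r); split => // [c|].
  apply/idP/idP; first by move=> /evE; rewrite !inE.
  have evP a : \rank (S - a%:M)%R = \rank (S - r%:M)%R -> eigenvalue S a.
    by move=> E1; rewrite /eigenvalue -mxrank_eq0 rkE E1 subn_eq0 -ltnNge.
  by rewrite !inE => /orP [] /eqP ->; apply: evP => //; rewrite NE.
by rewrite !rkE NE eqr.
Qed.

Section IsSplit.
Context {R : realType}.

Lemma is_split1P k (S : 'M[R]_k) : (0 < k)%N ->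
  is_split 1 S <-> S *m S = 1%:M /\ \rank (S - 1%:M)%R = \rank (S + 1%:M)%R.
Proof.
move=> k0; rewrite /is_split eqxx; split=> -[SS].
  have SS' : S *m S = (1 * 1)%:M by rewrite mulr1.
  by move=> /(two_equal_eigenspacesP k0 _ SS') h; split => //; apply: h.
have SS' : S *m S = (1 * 1)%:M by rewrite mulr1.
by move=> rk; split => //; apply/(two_equal_eigenspacesP k0 _ SS').
Qed.

Lemma imagM : imag * imag = -1 :> R[i].
Proof. by rewrite /imag; simpc. Qed.

Lemma conj_imag : (imag : R[i])^* = - imag.
Proof. by rewrite /imag; simpc. Qed.

Lemma cplx_mx_mul a b c (A : 'M[R]_(a, b)) (B : 'M[R]_(b, c)) :
  cplx_mx (A *m B) = cplx_mx A *m cplx_mx B.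
Proof. exact: map_mxM. Qed.

Lemma conj_cplx_mx a b (A : 'M[R]_(a, b)) : map_mx Num.conj (cplx_mx A) = cplx_mx A.
Proof. by apply/matrixP => i j; rewrite !mxE; simpc. Qed.

(** Complex conjugation exchanges the eigenspaces of a real matrix for [imag] and [- imag], so their
    dimensions agree. *)
Lemma is_splitN1P k (S : 'M[R]_k) : (0 < k)%N ->
  is_split (-1) S <-> S *m S = (-1)%:M.
Proof.
move=> k0; have N1 : (-1 == 1 :> R) = false by rewrite -subr_eq0 -opprD oppr_eq0 gt_eqF.
rewrite /is_split N1; split=> [[]//|SS]; split => //.
have SS' : cplx_mx S *m cplx_mx S = (imag * imag)%:M.
  by rewrite -cplx_mx_mul SS imagM /cplx_mx map_scalar_mx rmorphN1.
apply/(two_equal_eigenspacesP k0 _ SS').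
  by rewrite -mulr2n mulrn_eq0 /= /imag eq_complex /= oner_eq0 andbF.
rewrite -(mxrank_map (@Num.conj _)) map_mxB map_scalar_mx conj_cplx_mx.
by rewrite /= conj_imag raddfN opprK.
Qed.

Lemma has_signature_conj p q k (X B : 'M[R]_k) : X \in unitmx ->
  (has_signature p q (X *m B *m X^T) <-> has_signature p q B).
Proof.
move=> uX; split=> -[P uP PB].
  exists (P *m X); first by rewrite unitmx_mul uP.
  by rewrite -PB trmx_mul !mulmxA.
exists (P *m invmx X); first by rewrite unitmx_mul uP unitmx_inv.
rewrite -PB trmx_mul trmx_inv !mulmxA mulmxKV // -!mulmxA mulKVmx //.
by rewrite unitmx_tr.
Qed.

Lemma mxrank_conj (F : fieldType) k (X A : 'M[F]_k) : X \in unitmx ->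
  \rank (X *m A *m invmx X)%R = \rank A.
Proof.
move=> uX; rewrite mxrankMfree ?row_free_unit ?unitmx_inv //.
by rewrite -mxrank_tr trmx_mul mxrankMfree ?mxrank_tr // row_free_unit unitmx_tr.
Qed.

Lemma is_split_conj (lam : R) k (X S : 'M[R]_k) : (0 < k)%N ->
  lam = 1 \/ lam = -1 -> X \in unitmx ->
  (is_split lam (X *m S *m invmx X) <-> is_split lam S).
Proof.
move=> k0 lam1 uX.
have sq (T : 'M[R]_k) (a : R) : (X *m T *m invmx X) *m (X *m T *m invmx X) = a%:M <->
    T *m T = a%:M.
  rewrite !mulmxA mulmxKV // -(mulmxA X T); split=> E1.
    have := congr1 (fun B => invmx X *m B *m X) E1.
    by rewrite !mulmxA mulVmx // mul1mx mulmxKV // scalar_mxC mulmxKV.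
  by rewrite E1 scalar_mxC mulmxK.
have shift (a : R) : X *m S *m invmx X + a%:M = X *m (S + a%:M) *m invmx X.
  by rewrite mulmxDr mulmxDl scalar_mxC mulmxK.
case: lam1 => ->.
  rewrite !is_split1P // sq -raddfN !shift !mxrank_conj //.
by rewrite !is_splitN1P.
Qed.

End IsSplit.

(** * The fibres in a chart *)

Section AlgCond.
Context {R : realType}.

(** The conditions on a fibre, for an arbitrary operator [I] and form [P], so that a change of basis
    can act on operators by conjugation and on forms by congruence. *)
Definition alg_cond (lam ell : R) k (I P A : 'M[R]_k) : Prop :=
  [/\ is_split lam A, A *m P = - (P *m A^T), A *m I = I *m A
    & is_split ell (A *m I)].

Lemma conjmx_mul k (X A B : 'M[R]_k) : X \in unitmx ->
  (X *m A *m invmx X) *m (X *m B *m invmx X) = X *m (A *m B) *m invmx X.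
Proof. by move=> uX; rewrite !mulmxA mulmxKV. Qed.

Lemma conjmx_inj k (X A B : 'M[R]_k) : X \in unitmx ->
  X *m A *m invmx X = X *m B *m invmx X <-> A = B.
Proof.
move=> uX; split=> [E1|->//].
by rewrite -[A](mulKmx uX) -[B](mulKmx uX) -[X *m A](mulmxKV uX) E1 mulmxKV.
Qed.

Lemma alg_cond_conj lam ell k (X I P A : 'M[R]_k) : (0 < k)%N ->
  (lam = 1 \/ lam = -1) -> (ell = 1 \/ ell = -1) -> X \in unitmx ->
  alg_cond lam ell (X *m I *m invmx X) (X *m P *m X^T) (X *m A *m invmx X) <->
  alg_cond lam ell I P A.
Proof.
move=> k0 lam1 ell1 uX; have uXT : X^T \in unitmx by rewrite unitmx_tr.
have skew : (X *m A *m invmx X) *m (X *m P *m X^T) =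
    - ((X *m P *m X^T) *m (X *m A *m invmx X)^T) <-> A *m P = - (P *m A^T).
  have -> : (X *m A *m invmx X) *m (X *m P *m X^T) = X *m (A *m P) *m X^T.
    by rewrite !mulmxA mulmxKV.
  have -> : (X *m P *m X^T) *m (X *m A *m invmx X)^T = X *m (P *m A^T) *m X^T.
    by rewrite !trmx_mul trmx_inv -!mulmxA mulKVmx.
  rewrite -mulNmx -mulmxN; split=> [E1|->//].
  by rewrite -[LHS](mulKmx uX) -[X *m (A *m P)](mulmxK uXT) E1 mulmxK // mulKmx.
have sp l S := @is_split_conj _ l k X S k0 ^~ uX.
split=> -[s1 s2 s3 s4]; split.
- exact/(sp _ _ lam1).
- exact/skew.
- by apply/(conjmx_inj _ _ uX); rewrite -!conjmx_mul.
- by apply/(sp _ _ ell1); rewrite -conjmx_mul.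
- exact/(sp _ _ lam1).
- exact/skew.
- by rewrite !conjmx_mul // s3.
- by rewrite (conjmx_mul _ _ uX); apply/(sp _ (A *m I) ell1); exact: s4.
Qed.

Context {d : nat}.

Definition fib (lam ell : R) (W : 'M[R]_d) : set 'M[R]_(d + d) :=
  [set A | alg_cond lam ell (I_mx (lam * ell) W) pairing A].

(** The map induced on T + T* by a change of frame [t] of T. It is orthogonal for the pairing, hence
    affects the fibre conditions only through [W]. *)
Definition gdiag (t : 'M[R]_d) : 'M[R]_(d + d) := block_mx t 0 0 (invmx t)^T.

Lemma gdiag_unit t : t \in unitmx -> gdiag t \in unitmx.
Proof.
move=> tu; rewrite unitmxE /gdiag det_ublock unitrM -!unitmxE tu.
by rewrite unitmx_tr unitmx_inv.
Qed.

Lemma gdiagV t : t \in unitmx -> invmx (gdiag t) = gdiag (invmx t).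
Proof.
move=> tu; have gu := gdiag_unit tu.
suff E : gdiag t *m gdiag (invmx t) = 1%:M by rewrite -[LHS]mulmx1 -E mulKmx.
rewrite /gdiag mulmx_block !mulmx0 !mul0mx !addr0 !add0r mulmxV //.
by rewrite -trmx_mul invmxK mulmxV // trmx1 -scalar_mx_block.
Qed.

Lemma gdiag_pairing t : t \in unitmx ->
  gdiag t *m pairing *m (gdiag t)^T = pairing.
Proof.
move=> tu; rewrite /gdiag /pairing tr_block_mx !mulmx_block !trmx0 trmxK.
rewrite !(mulmx0, mul0mx, mulmx1, addr0, add0r) mulmxV //.
by rewrite -trmx_mul mulmxV // trmx1.
Qed.

Lemma gdiag_I_mx k t (W : 'M[R]_d) : t \in unitmx -> W \in unitmx ->
  gdiag t *m I_mx k W *m invmx (gdiag t) = I_mx k (t *m W *m t^T).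
Proof.
move=> tu Wu; rewrite gdiagV // /gdiag /I_mx !mulmx_block.
rewrite !(mulmx0, mul0mx, mulmx1, addr0, add0r) invmxK.
congr (block_mx _ _ _ _).
rewrite -!mulmxA !invmx_mul ?unitmx_mul ?unitmx_tr ?Wu //.
by rewrite -scalemxAl -scalemxAr trmx_inv mulmxA.
Qed.

Lemma alg_cond_gdiag lam ell t (W : 'M[R]_d) A : (0 < d)%N ->
  (lam = 1 \/ lam = -1) -> (ell = 1 \/ ell = -1) ->
  t \in unitmx -> W \in unitmx ->
  fib lam ell (t *m W *m t^T) (gdiag t *m A *m invmx (gdiag t)) <->
  fib lam ell W A.
Proof.
move=> d0 l1 l2 tu Wu; have gu := gdiag_unit tu.
have k0 : (0 < d + d)%N by rewrite addn_gt0 d0.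
have h := alg_cond_conj (I_mx (lam * ell) W) pairing A k0 l1 l2 gu.
by rewrite (gdiag_pairing tu) (gdiag_I_mx _ tu Wu) in h.
Qed.

Lemma beta_gdiag t (W : 'M[R]_d) A : t \in unitmx -> W \in unitmx ->
  beta (t *m W *m t^T) (gdiag t *m A *m invmx (gdiag t)) =
  gdiag t *m beta W A *m (gdiag t)^T.
Proof.
move=> tu Wu; have gu := gdiag_unit tu.
rewrite /beta -(gdiag_I_mx _ tu Wu) -[X in _ *m X = _](gdiag_pairing tu) !mulmxA.
by rewrite !mulmxKV.
Qed.

End AlgCond.

Section FibreCharts.
Context {R : realType} {m : nat} {M : manifold R (m + m)} (w : symplectic M).

Lemma endo_coordE (c : chart R (m + m) M) p A : atlas c -> dom c p ->
  endo_coord c p A =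
  gdiag (invmx (tframe c p)) *m A *m invmx (gdiag (invmx (tframe c p))).
Proof.
move=> ac dp; have tu := tframe_unit ac dp.
by rewrite -(gdiagV tu) invmxK.
Qed.

Lemma form_inE (c : chart R (m + m) M) p : atlas c -> dom c p ->
  form_in c w (c p) = invmx (tframe c p) *m w p *m (invmx (tframe c p))^T.
Proof.
by move=> ac dp; have [_ _ ck _ _] := atlas_chart ac; rewrite /form_in ck.
Qed.

(** Reading the fibre in [c] is the change of frame by the inverse of [tframe c p], which acts on
    the form by congruence and on endomorphisms through [gdiag]. *)
Lemma fibre_in_chart lam ell (c : chart R (m + m) M) p A : (0 < m)%N ->
  (lam = 1 \/ lam = -1) -> (ell = 1 \/ ell = -1) -> atlas c -> dom c p ->
  fibre w lam ell p A <-> fib lam ell (form_in c w (c p)) (endo_coord c p A).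
Proof.
move=> m0 l1 l2 ac dp; have tu := tframe_unit ac dp.
rewrite (endo_coordE _ ac dp) (form_inE ac dp).
have d0 : (0 < m + m)%N by rewrite addn_gt0 m0.
have tiu : invmx (tframe c p) \in unitmx by rewrite unitmx_inv.
exact: iff_sym (alg_cond_gdiag A d0 l1 l2 tiu (sform_nondeg w p)).
Qed.

Definition fib_n n (W : 'M[R]_(m + m)) : set 'M[R]_((m + m) + (m + m)) :=
  [set A | fib (-1) 1 W A /\ has_signature (4 * n) (4 * m - 4 * n) (beta W A)].

Lemma fibre_n_in_chart n (c : chart R (m + m) M) p A : (0 < m)%N ->
  atlas c -> dom c p ->
  fibre_n w n p A <-> fib_n n (form_in c w (c p)) (endo_coord c p A).
Proof.
move=> m0 ac dp; have tu := tframe_unit ac dp.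
have h1 : fibre w (-1) 1 p A <-> fib (-1) 1 (form_in c w (c p)) (endo_coord c p A).
  exact: (fibre_in_chart A m0 (or_intror erefl) (or_introl erefl) ac dp).
have tiu : invmx (tframe c p) \in unitmx by rewrite unitmx_inv.
have wu := sform_nondeg w p.
have h2 : has_signature (4 * n) (4 * m - 4 * n)
    (beta (form_in c w (c p)) (endo_coord c p A)) <->
    has_signature (4 * n) (4 * m - 4 * n) (beta (w p) A).
  rewrite (endo_coordE _ ac dp) (form_inE ac dp) (beta_gdiag _ tiu wu).
  exact: has_signature_conj (gdiag_unit tiu).
split=> -[f s]; split.
- exact: (h1.1 f).
- exact: (h2.2 s).
- exact: (h1.2 f).
- exact: (h2.1 s).
Qed.

End FibreCharts.

(** * Complex matrices as real matrices *)

Section Realify.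
Context {R : realType}.
Local Notation C := R[i].

Lemma Re_add (x y : C) : complex.Re (x + y) = complex.Re x + complex.Re y.
Proof. by case: x => a b; case: y. Qed.

Lemma Im_add (x y : C) : complex.Im (x + y) = complex.Im x + complex.Im y.
Proof. by case: x => a b; case: y. Qed.

Lemma Re_mul (x y : C) :
  complex.Re (x * y) = complex.Re x * complex.Re y - complex.Im x * complex.Im y.
Proof. by case: x => a b; case: y. Qed.

Lemma Im_mul (x y : C) :
  complex.Im (x * y) = complex.Re x * complex.Im y + complex.Im x * complex.Re y.
Proof. by case: x => a b; case: y. Qed.

Definition re_mx p q (A : 'M[C]_(p, q)) : 'M[R]_(p, q) := map_mx (@complex.Re R) A.
Definition im_mx p q (A : 'M[C]_(p, q)) : 'M[R]_(p, q) := map_mx (@complex.Im R) A.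

Lemma reim_eq p q (A B : 'M[C]_(p, q)) :
  re_mx A = re_mx B -> im_mx A = im_mx B -> A = B.
Proof.
move=> /matrixP rE /matrixP iE; apply/matrixP => i j.
by move: (rE i j) (iE i j); rewrite !mxE; case: (A i j) (B i j) => a b [c e] /= -> ->.
Qed.

Lemma re_mxM p q r (A : 'M[C]_(p, q)) (B : 'M[C]_(q, r)) :
  re_mx (A *m B) = re_mx A *m re_mx B - im_mx A *m im_mx B.
Proof.
apply/matrixP => i j; rewrite !mxE (big_morph _ Re_add (erefl : complex.Re (0 : C) = 0)).
by rewrite -sumrB; apply: eq_bigr => k _; rewrite Re_mul !mxE.
Qed.

Lemma im_mxM p q r (A : 'M[C]_(p, q)) (B : 'M[C]_(q, r)) :
  im_mx (A *m B) = re_mx A *m im_mx B + im_mx A *m re_mx B.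
Proof.
apply/matrixP => i j; rewrite !mxE (big_morph _ Im_add (erefl : complex.Im (0 : C) = 0)).
by rewrite -big_split; apply: eq_bigr => k _; rewrite Im_mul !mxE.
Qed.

Lemma re_mxD p q (A B : 'M[C]_(p, q)) : re_mx (A + B) = re_mx A + re_mx B.
Proof. by apply/matrixP => i j; rewrite !mxE Re_add. Qed.

Lemma im_mxD p q (A B : 'M[C]_(p, q)) : im_mx (A + B) = im_mx A + im_mx B.
Proof. by apply/matrixP => i j; rewrite !mxE Im_add. Qed.

Lemma re_mxN p q (A : 'M[C]_(p, q)) : re_mx (- A) = - re_mx A.
Proof. by apply/matrixP => i j; rewrite !mxE; case: (A i j). Qed.

Lemma im_mxN p q (A : 'M[C]_(p, q)) : im_mx (- A) = - im_mx A.
Proof. by apply/matrixP => i j; rewrite !mxE; case: (A i j). Qed.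

Lemma re_cplx_mx p q (A : 'M[R]_(p, q)) : re_mx (cplx_mx A) = A.
Proof. by apply/matrixP => i j; rewrite !mxE. Qed.

Lemma im_cplx_mx p q (A : 'M[R]_(p, q)) : im_mx (cplx_mx A) = 0.
Proof. by apply/matrixP => i j; rewrite !mxE. Qed.

Lemma re_imagZ p q (A : 'M[C]_(p, q)) : re_mx (imag *: A) = - im_mx A.
Proof. by apply/matrixP => i j; rewrite !mxE Re_mul /= mul0r mul1r sub0r. Qed.

Lemma im_imagZ p q (A : 'M[C]_(p, q)) : im_mx (imag *: A) = re_mx A.
Proof. by apply/matrixP => i j; rewrite !mxE Im_mul /= mul0r mul1r add0r. Qed.

Lemma re_tc p q (A : 'M[C]_(p, q)) : re_mx (A ^t*) = (re_mx A)^T.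
Proof. by apply/matrixP => i j; rewrite !mxE; case: (A j i). Qed.

Lemma im_tc p q (A : 'M[C]_(p, q)) : im_mx (A ^t*) = - (im_mx A)^T.
Proof. by apply/matrixP => i j; rewrite !mxE; case: (A j i). Qed.

Lemma tcM p q r (A : 'M[C]_(p, q)) (B : 'M[C]_(q, r)) :
  (A *m B) ^t* = B ^t* *m A ^t*.
Proof. by rewrite trmx_mul map_mxM. Qed.

Lemma tcK p q (A : 'M[C]_(p, q)) : A ^t* ^t* = A.
Proof. exact: trmxCK. Qed.

Lemma tcD p q (A B : 'M[C]_(p, q)) : (A + B) ^t* = A ^t* + B ^t*.
Proof. by rewrite linearD map_mxD. Qed.

Lemma tcN p q (A : 'M[C]_(p, q)) : (- A) ^t* = - A ^t*.
Proof. by rewrite linearN map_mxN. Qed.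

Lemma tcV n (A : 'M[C]_n) : (invmx A) ^t* = invmx (A ^t*).
Proof. by rewrite trmx_inv map_invmx. Qed.

Lemma tc_unit n (A : 'M[C]_n) : (A ^t* \in unitmx) = (A \in unitmx).
Proof. by rewrite map_unitmx unitmx_tr. Qed.

Lemma tc_block p q r s (A : 'M[C]_(p, r)) (B : 'M[C]_(p, s)) (D : 'M[C]_(q, r))
    (E : 'M[C]_(q, s)) :
  (block_mx A B D E) ^t* = block_mx (A ^t*) (D ^t*) (B ^t*) (E ^t*).
Proof. by rewrite tr_block_mx map_block_mx. Qed.

Lemma tc0 p q : (0 : 'M[C]_(p, q)) ^t* = 0.
Proof. by rewrite trmx0 map_mx0. Qed.

Lemma tc1 n : (1%:M : 'M[C]_n) ^t* = 1%:M.
Proof. by rewrite trmx1 map_mx1. Qed.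

Lemma realifyE r (A : 'M[C]_r) :
  realify A = block_mx (re_mx A) (- im_mx A) (im_mx A) (re_mx A).
Proof. by []. Qed.

Lemma realifyM r (A B : 'M[C]_r) : realify (A *m B) = realify A *m realify B.
Proof.
rewrite !realifyE mulmx_block re_mxM im_mxM !mulNmx !mulmxN.
by congr (block_mx _ _ _ _); rewrite ?opprD // addrC.
Qed.

Lemma realifyD r (A B : 'M[C]_r) : realify (A + B) = realify A + realify B.
Proof. by rewrite !realifyE add_block_mx re_mxD im_mxD opprD. Qed.

Lemma realifyN r (A : 'M[C]_r) : realify (- A) = - realify A.
Proof. by rewrite !realifyE opp_block_mx re_mxN im_mxN. Qed.

Lemma realify1 r : realify (1%:M : 'M[C]_r) = 1%:M.
Proof.
rewrite realifyE scalar_mx_block; congr (block_mx _ _ _ _);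
  by apply/matrixP => i j; rewrite !mxE; case: (i == j); rewrite ?oppr0.
Qed.

Lemma realify_tc r (A : 'M[C]_r) : realify (A ^t*) = (realify A)^T.
Proof. by rewrite !realifyE tr_block_mx re_tc im_tc opprK linearN. Qed.

Lemma realify_inj r : injective (@realify R r).
Proof.
by move=> A B /eq_block_mx [rE _ iE _]; apply: reim_eq.
Qed.

Lemma realify_unit r (A : 'M[C]_r) : A \in unitmx -> realify A \in unitmx.
Proof.
move=> uA; have := congr1 (@realify R r) (mulmxV uA).
by rewrite realifyM realify1 => /mulmx1_unit [].
Qed.

Lemma realifyV r (A : 'M[C]_r) : A \in unitmx -> realify (invmx A) = invmx (realify A).
Proof.
move=> uA; rewrite -[LHS](mulKmx (realify_unit uA)) -realifyM mulmxV //.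
by rewrite realify1 mulmx1.
Qed.

(** Only the left blocks are read. This is smooth on all real matrices, and inverts [realify] on
    those commuting with [Jcplx]. *)
Definition unrealify r (A : 'M[R]_(r + r)) : 'M[C]_r :=
  cplx_mx (ulsubmx A) + imag *: cplx_mx (dlsubmx A).

Lemma re_unrealify r (A : 'M[R]_(r + r)) : re_mx (unrealify A) = ulsubmx A.
Proof. by rewrite re_mxD re_imagZ re_cplx_mx im_cplx_mx oppr0 addr0. Qed.

Lemma im_unrealify r (A : 'M[R]_(r + r)) : im_mx (unrealify A) = dlsubmx A.
Proof. by rewrite im_mxD im_imagZ re_cplx_mx im_cplx_mx add0r. Qed.

Lemma realifyK r : cancel (@realify R r) (@unrealify r).
Proof.
by move=> A; apply: reim_eq; rewrite ?re_unrealify ?im_unrealify realifyE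
  ?block_mxKul ?block_mxKdl.
Qed.

Definition Jcplx r : 'M[R]_(r + r) := block_mx 0 (- 1%:M) 1%:M 0.

Lemma realify_imag r : realify (imag%:M : 'M[C]_r) = Jcplx r.
Proof.
rewrite realifyE /Jcplx; congr (block_mx _ _ _ _);
  by apply/matrixP => i j; rewrite !mxE; case: (i == j); rewrite ?oppr0.
Qed.

Lemma realify_commJ r (A : 'M[C]_r) : realify A *m Jcplx r = Jcplx r *m realify A.
Proof. by rewrite -realify_imag -!realifyM scalar_mxC. Qed.

Lemma commJ_realify r (A : 'M[R]_(r + r)) :
  A *m Jcplx r = Jcplx r *m A -> A = realify (unrealify A).
Proof.
rewrite realifyE re_unrealify im_unrealify -{1 2 3}[A]submxK /Jcplx.
rewrite !mulmx_block !(mulmx0, mul0mx, mulmxN, mulNmx, mulmx1, mul1mx, addr0, add0r).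
by move=> /eq_block_mx [-> _ -> _].
Qed.

(** Gaussian elimination reduces to [pid_mx], because [realify] is multiplicative and preserves
    invertibility. *)
Lemma mxrank_realify r (A : 'M[C]_r) : \rank (realify A) = (\rank A + \rank A)%N.
Proof.
have pidE k : realify (pid_mx k : 'M[C]_r) = block_mx (pid_mx k) 0 0 (pid_mx k).
  rewrite realifyE; congr (block_mx _ _ _ _);
    by apply/matrixP => i j; rewrite !mxE; case: (_ && _); rewrite ?oppr0.
have rk k (U B L : 'M[R]_k) : L \in unitmx -> U \in unitmx -> \rank (L *m B *m U) = \rank B.
  move=> uL uU; rewrite mxrankMfree ?row_free_unit //.
  by rewrite -mxrank_tr trmx_mul mxrankMfree ?mxrank_tr // row_free_unit unitmx_tr.
rewrite -{1}(mulmx_ebase A) !realifyM pidE rk; last first.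
- exact/realify_unit/row_ebase_unit.
- exact/realify_unit/col_ebase_unit.
by rewrite rank_diag_block_mx !rank_pid_mx ?rank_leq_row.
Qed.

Lemma unitmx_realify r (A : 'M[C]_r) : (realify A \in unitmx) = (A \in unitmx).
Proof.
apply/idP/idP => [uA|]; last exact: realify_unit.
rewrite -row_free_unit /row_free; have := mxrank_realify A.
by rewrite mxrank_unit // !addnn => /double_inj <-.
Qed.

End Realify.

(** * Involutions, complex structures and the models over GL *)

Section Halves.
Variable F : numFieldType.

Lemma two_neq0 : 2%:R != 0 :> F. Proof. by rewrite pnatr_eq0. Qed.

Lemma half_add p q (X : 'M[F]_(p, q)) : 2^-1 *: (X + X) = X.
Proof.
by rewrite -[X + X]mulr2n -[X *+ 2]scaler_nat scalerA mulVf ?scale1r // two_neq0.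
Qed.

Lemma opp_fix p q (X : 'M[F]_(p, q)) : X = - X -> X = 0.
Proof. by move=> XN; rewrite -[X]half_add {1}XN addNr scaler0. Qed.

End Halves.

Section Involutions.
Variable F : fieldType.
Hypothesis two : 2%:R != 0 :> F.

Lemma row_basis_of_rank p q r (A : 'M[F]_(p, q)) : \rank A = r ->
  exists V : 'M[F]_(r, q), (V :=: A)%MS.
Proof. by move=> <-; exists (row_base A); exact: eq_row_base. Qed.

(** The identity is half the difference of [B + 1] and [B - 1], so their ranks add up to at least
    2m; their product is 0, so to at most 2m. Being equal, both ranks are m. The rows of [B + 1] are
    fixed by [B], those of [B - 1] are negated. *)
Lemma involution_basis m (B : 'M[F]_(m + m)) :
  B *m B = 1%:M -> \rank (B - 1%:M)%R = \rank (B + 1%:M)%R ->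
  exists V V' : 'M[F]_(m, m + m),
    [/\ V *m B = V, V' *m B = - V' & col_mx V V' \in unitmx].
Proof.
move=> BB rk.
have full : (1%:M <= (B + 1%:M)%R + (B - 1%:M)%R)%MS.
  suff : (2^-1 *: (B + 1%:M)%R - 2^-1 *: (B - 1%:M)%R <= (B + 1%:M)%R + (B - 1%:M)%R)%MS.
    rewrite -scalerBr (_ : (_ - _)%R = 2%:M); last by rewrite opprB addrC subrKA -raddfD.
    by rewrite scale_scalar_mx mulVf.
  by rewrite addmx_sub_adds ?eqmx_opp ?scalemx_sub.
have prod0 : (B + 1%:M) *m (B - 1%:M) = 0.
  by rewrite mulmxDl !mulmxBr BB !mul1mx !mulmx1 addrC subrKA subrr.
have rkB : \rank (B + 1%:M)%R = m.
  have le1 : (m + m <= \rank (B + 1%:M)%R + \rank (B - 1%:M)%R)%N.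
    by rewrite -{1}(mxrank1 F (m + m)) (leq_trans (mxrankS full)) // mxrank_adds_leqif.
  have le2 : (\rank (B + 1%:M)%R + \rank (B - 1%:M)%R <= m + m)%N.
    have := mxrank_mul_min (B + 1%:M) (B - 1%:M).
    by rewrite prod0 mxrank0 leqn0 subn_eq0.
  move: le1 le2; rewrite rk; move: (\rank _) => r le1 le2.
  by apply/eqP; rewrite eqn_leq -(leq_double r) -(leq_double m) -!addnn le1 le2.
have [V VE] := row_basis_of_rank rkB.
have [V' V'E] := row_basis_of_rank (etrans rk rkB).
exists V, V'; split.
- have /submxP [D ->] : (V <= (B + 1%:M)%R)%MS by rewrite VE.
  by rewrite -mulmxA mulmxDl BB mul1mx addrC.
- have /submxP [D ->] : (V' <= (B - 1%:M)%R)%MS by rewrite V'E.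
  by rewrite -mulmxA mulmxBl BB mul1mx -mulmxN opprB.
rewrite -row_full_unit -sub1mx -addsmxE.
by rewrite (submx_trans full) // addsmxS // ?VE ?V'E.
Qed.

End Involutions.

Section GLModels.
Context {R : realType}.

(** The matrix [E = - imag *: B] is a complex involution with conjugate [- E], so its eigenspaces
    have the same dimension. The real and imaginary parts of a basis [V] of the first one form the
    required real basis. *)
Lemma complex_structure_basis m (B : 'M[R]_(m + m)) : B *m B = (-1)%:M ->
  exists2 P : 'M[R]_(m + m), P \in unitmx & P *m B = Jcplx m *m P.
Proof.
move=> BB; pose E : 'M[R[i]]_(m + m) := - imag *: cplx_mx B.
have EE : E *m E = 1%:M.
  rewrite /E -scalemxAl -scalemxAr scalerA -cplx_mx_mul BB mulrNN imagM.
  by rewrite /cplx_mx map_scalar_mx scale_scalar_mx rmorphN1 mulrNN mulr1.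
have rkE : \rank (E - 1%:M)%R = \rank (E + 1%:M)%R.
  have EN : map_mx Num.conj E = - E.
    by rewrite map_mxZ conj_cplx_mx rmorphN /= conj_imag -scaleNr.
  by rewrite -(mxrank_map (@Num.conj _)) map_mxB map_mx1 EN -opprD eqmx_opp.
have [V [V' [VE _ uV]]] := involution_basis (two_neq0 R[i]) EE rkE.
pose X := re_mx V; pose Y := im_mx V.
have VB : V *m cplx_mx B = imag *: V.
  by rewrite -{2}VE /E -scalemxAr scalerA mulrN imagM opprK scale1r.
have XB : X *m B = - Y.
  have := congr1 (@re_mx R _ _) VB; rewrite re_mxM re_imagZ.
  by rewrite re_cplx_mx im_cplx_mx mulmx0 subr0.
have YB : Y *m B = X.
  have := congr1 (@im_mx R _ _) VB; rewrite im_mxM im_imagZ.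
  by rewrite re_cplx_mx im_cplx_mx mulmx0 add0r.
exists (col_mx X Y); last first.
  by rewrite mul_col_mx XB YB /Jcplx mul_block_col !mul0mx mulNmx !mul1mx add0r addr0.
(* A real relation [a X + b Y = 0], together with its image under [B], says that [(a - i b) V = 0];
   the rows of [V] are independent, so [a] and [b] vanish. *)
rewrite -row_free_unit -kermx_eq0; apply/eqP.
set K := kermx _; pose a := lsubmx K; pose b := rsubmx K.
have E1 : a *m X + b *m Y = 0.
  by have := mulmx_ker (col_mx X Y); rewrite -/K -{1}[K]hsubmxK mul_row_col.
have E2 : b *m X - a *m Y = 0.
  have := congr1 (mulmx^~ B) E1; rewrite mul0mx mulmxDl -!mulmxA XB YB.
  by rewrite mulmxN addrC.
have D0 : (cplx_mx a - imag *: cplx_mx b) *m V = 0.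
  apply: reim_eq.
    rewrite re_mxM re_mxD re_mxN re_imagZ im_mxD im_mxN im_imagZ !re_cplx_mx !im_cplx_mx.
    rewrite !oppr0 addr0 add0r mulNmx opprK -/X -/Y E1.
    by apply/matrixP => i j; rewrite !mxE.
  rewrite im_mxM re_mxD re_mxN re_imagZ im_mxD im_mxN im_imagZ !re_cplx_mx !im_cplx_mx.
  rewrite !oppr0 addr0 add0r mulNmx -/X -/Y -opprB E2 oppr0.
  by apply/matrixP => i j; rewrite !mxE.
have D1 : cplx_mx a - imag *: cplx_mx b = 0.
  have : row_mx (cplx_mx a - imag *: cplx_mx b) 0 *m col_mx V V' = 0.
    by rewrite mul_row_col D0 mul0mx addr0.
  move=> /(congr1 (mulmx^~ (invmx (col_mx V V')))); rewrite mulmxK // mul0mx.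
  by move=> /(congr1 lsubmx); rewrite row_mxKl => ->; apply/matrixP => i j; rewrite !mxE.
have z0 (A : 'M[R[i]]_(m + m, m)) : A = 0 -> re_mx A = 0 /\ im_mx A = 0.
  by move=> ->; split; apply/matrixP => i j; rewrite !mxE.
have [] := z0 _ D1.
rewrite re_mxD re_mxN re_imagZ im_mxD im_mxN im_imagZ !re_cplx_mx !im_cplx_mx.
rewrite !oppr0 addr0 add0r => a0 /eqP; rewrite oppr_eq0 => /eqP b0.
by rewrite -[K]hsubmxK -/a -/b a0 b0 row_mx0.
Qed.

(** The last clause, used with [X] the complex structure, shows that the intertwiner of two complex
    linear maps is complex linear. *)
Lemma smooth_intertwiner N (lam : R) (B0 : 'M[R]_N) :
  lam * lam = 1 -> B0 *m B0 = lam%:M ->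
  exists gam : 'M[R]_N -> 'M[R]_N, [/\ forall B, smooth_at gam B, gam B0 = 1%:M,
      forall B, B *m B = lam%:M -> gam B *m B0 = B *m gam B
    & forall B X, X *m B = B *m X -> X *m B0 = B0 *m X -> X *m gam B = gam B *m X].
Proof.
move=> ll BB0; exists (fun B => 2^-1 *: (1%:M + lam *: (B *m B0))); split.
- move=> B; apply: smooth_atZ; first exact: smooth_at_cst.
  apply: smooth_atD; first exact: smooth_at_cst.
  apply: smooth_atZ; first exact: smooth_at_cst.
  by apply: smooth_at_mulmx; [exact: smooth_at_id|exact: smooth_at_cst].
- by rewrite BB0 scale_scalar_mx ll -raddfD /= scale_scalar_mx mulVf ?pnatr_eq0.
- move=> B BB; rewrite -scalemxAl -scalemxAr mulmxDl mulmxDr mul1mx mulmx1.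
  rewrite -scalemxAl -scalemxAr -mulmxA BB0 mulmxA BB mul_mx_scalar mul_scalar_mx.
  by rewrite !scalerA ll !scale1r addrC.
- move=> B X XB XB0; rewrite -scalemxAl -scalemxAr mulmxDl mulmxDr mul1mx mulmx1.
  by rewrite -scalemxAl -scalemxAr mulmxA XB -!mulmxA XB0.
Qed.

(** For the full linear group the intertwiner itself is the section: it is 1 at [B0], hence
    invertible nearby. *)
Lemma GL_model N (lam : R) (H : set 'M[R]_N) (B0 : 'M[R]_N) : (0 < N)%N ->
  lam = 1 \/ lam = -1 -> is_split lam B0 ->
  (forall h, H h <-> h \in unitmx /\ h *m B0 = B0 *m h) ->
  (forall B, is_split lam B -> exists2 P, P \in unitmx & P *m B = B0 *m P) ->
  homogeneous_model (GL R N) H [set B | is_split lam B] B0.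
Proof.
move=> N0 l1 sB0 HP basis; split.
- by [].
- by move=> g h ug uh; rewrite /GL /= unitmx_mul; apply/andP.
- by move=> g ug; rewrite /GL /= unitmx_inv.
- exact: HP.
- move=> B; split=> [/basis [P uP PB]|[g [ug ->]]].
    exists (invmx P); split; first by rewrite /GL /= unitmx_inv.
    by rewrite invmxK -mulmxA -PB mulKmx.
  exact/is_split_conj.
have ll : lam * lam = 1 by case: l1 => ->; rewrite ?mulrNN mulr1.
have [gam [sg g0 gP _]] := smooth_intertwiner ll (proj1 sB0).
exists gam; split; first exact: sg.
have : \forall B \near B0, gam B \in unitmx.
  by apply: near_unitmx (sg B0) _; rewrite g0 unitmx1.
apply: filterS => B uB [BB _]; split; first exact: uB.
exact: gP.
Qed.

Definition sgn_block m : 'M[R]_(m + m) := block_mx 1%:M 0 0 (- 1%:M).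

Lemma GLxGL_model m : (0 < m)%N ->
  homogeneous_model (GL R (m + m)) (GLxGL R m) [set B | is_split 1 B] (sgn_block m).
Proof.
move=> m0; have N0 : (0 < m + m)%N by rewrite addn_gt0 m0.
apply: GL_model => //; first by left.
- apply/(is_split1P _ N0); split.
    rewrite mulmx_block !(mulmx0, mul0mx, mulmxN, mulNmx, mul1mx, addr0, add0r) opprK.
    by rewrite -scalar_mx_block.
  rewrite scalar_mx_block opp_block_mx !add_block_mx !oppr0 !addr0 subrr addNr.
  rewrite !rank_diag_block_mx !mxrank0 add0n addn0 -opprD eqmx_opp.
  by [].
- move=> h; rewrite -{3 4}[h]submxK /sgn_block.
  rewrite !mulmx_block !(mulmx0, mul0mx, mulmxN, mulNmx, mul1mx, mulmx1, addr0, add0r).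
  split=> [[A [D [uA uD ->]]]|[uh]].
    rewrite block_mxKur block_mxKdl oppr0; split=> //.
    rewrite unitmxE det_ublock unitrM -2!unitmxE.
    by apply/andP; split; [exact: uA|exact: uD].
  move=> /eq_block_mx [_ /esym/opp_fix ur /opp_fix dl _].
  move: uh; rewrite -[h]submxK ur dl unitmxE det_ublock unitrM -2!unitmxE => /andP [uA uD].
  by exists (ulsubmx h), (drsubmx h).
- move=> B /(is_split1P _ N0) [BB rk].
  have [V [V' [VB VB' uV]]] := involution_basis (two_neq0 R) BB rk.
  exists (col_mx V V') => //.
  by rewrite mul_col_mx VB VB' /sgn_block mul_block_col !mul0mx mulNmx !mul1mx addr0 add0r.
Qed.

Lemma GLC_model m : (0 < m)%N ->
  homogeneous_model (GL R (m + m)) (realify @` GL R[i] m) [set B | is_split (-1) B]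
    (Jcplx m).
Proof.
move=> m0; have N0 : (0 < m + m)%N by rewrite addn_gt0 m0.
apply: GL_model => //; first by right.
- apply/(is_splitN1P _ N0); rewrite -realify_imag -realifyM -scalar_mxM imagM.
  by rewrite raddfN /= realifyN realify1 raddfN.
- move=> h; split=> [[g ug <-]|[uh /commJ_realify hE]].
    by split; [exact: realify_unit|exact: realify_commJ].
  exists (unrealify h); last by rewrite -hE.
  by rewrite /GL /= -unitmx_realify -hE.
- by move=> B /(is_splitN1P _ N0); exact: complex_structure_basis.
Qed.

End GLModels.

(** * Local models for lam ell = 1 *)

Section RealFrame.
Context {R : realType} {d : nat}.
Implicit Types (W B : 'M[R]_d) (A : 'M[R]_(d + d)).

(* The rows of [1, W] and [1, -W] span the eigenspaces of I_mx 1 W for 1 and -1,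
   each isotropic for the pairing. *)
Definition rframe W : 'M[R]_(d + d) := block_mx 1%:M W 1%:M (- W).

Definition rframeV W : 'M[R]_(d + d) :=
  2^-1 *: block_mx 1%:M 1%:M (invmx W) (- invmx W).

Lemma rframeM W : W \in unitmx -> rframe W *m rframeV W = 1%:M.
Proof.
move=> uW; rewrite /rframe /rframeV -scalemxAr mulmx_block.
rewrite !(mulmxN, mulNmx, mul1mx, mulmx1) mulmxV // opprK subrr.
by rewrite scale_block_mx !half_add scaler0 -scalar_mx_block.
Qed.

Lemma rframe_unit W : W \in unitmx -> rframe W \in unitmx.
Proof. by move=> /rframeM /mulmx1_unit []. Qed.

Lemma rframe_I W : W \in unitmx ->
  rframe W *m I_mx 1 W *m invmx (rframe W) = sgn_block d.
Proof.
move=> uW; apply: (canLR (mulmxK (rframe_unit uW))).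
rewrite /rframe /I_mx /sgn_block !mulmx_block scale1r mulNmx mulmxV //.
by rewrite !(mulmxN, mulNmx, mul1mx, mulmx1, mul0mx, mulmx0, oppr0, addr0, add0r) opprK.
Qed.

Lemma rframe_pairing W : W^T = - W ->
  rframe W *m pairing *m (rframe W)^T = block_mx 0 (W + W) (- (W + W)) 0.
Proof.
move=> Wt; rewrite /rframe /pairing tr_block_mx linearN /= Wt !trmx1 !mulmx_block.
rewrite !(mulmxN, mulNmx, mul1mx, mulmx1, mul0mx, mulmx0, addr0, add0r) !opprK.
by rewrite subrr addNr opprD.
Qed.

(** The two eigenspaces of I are paired with each other by [W + W], so skewness forces the second
    block to be minus the adjoint of the first with respect to [W]. *)
Definition dual_block W B : 'M[R]_(d + d) :=
  block_mx B 0 0 (- (W *m B^T *m invmx W)).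

Lemma skew_inv W : W \in unitmx -> W^T = - W -> (invmx W)^T = - invmx W.
Proof.
move=> uW Wt; have VW : (invmx W)^T *m W = - 1%:M.
  by apply: (canRL opprK); rewrite -mulmxN -Wt -trmx_mul mulmxV // trmx1.
by rewrite -[LHS](mulmxK uW) VW mulNmx mul1mx.
Qed.

Lemma mulmx_diag_block k (A B A' B' : 'M[R]_k) :
  block_mx A 0 0 B *m block_mx A' 0 0 B' = block_mx (A *m A') 0 0 (B *m B').
Proof. by rewrite mulmx_block !(mulmx0, mul0mx, addr0, add0r). Qed.

Lemma mxrank_diag_shift k (A B : 'M[R]_k) (a : R) :
  \rank (block_mx A 0 0 B + a%:M)%R = (\rank (A + a%:M)%R + \rank (B + a%:M)%R)%N.
Proof.
by rewrite scalar_mx_block add_block_mx !addr0 rank_diag_block_mx.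
Qed.

Lemma mxrank_trconj W B (a : R) : W \in unitmx ->
  \rank (W *m B^T *m invmx W + a%:M)%R = \rank (B + a%:M)%R.
Proof.
move=> uW; rewrite -(mxrank_tr (B + _)%R) linearD /= tr_scalar_mx.
rewrite -(mxrank_conj (B^T + _) uW) mulmxDr mulmxDl.
by rewrite [W *m a%:M]scalar_mxC mulmxK.
Qed.

(** Commuting with [sgn_block] kills the off-diagonal blocks. Splitness of [B] is read off from
    [A I], whose blocks [B] and [W B^T W^-1] have equal shifted ranks. In [A] the second block has
    the opposite sign, which exchanges the eigenvalues and balances the two eigenspaces. *)
Lemma alg_cond_dual_block (lam : R) W A : (0 < d)%N -> lam = 1 \/ lam = -1 ->
  W^T = - W -> W \in unitmx ->
  alg_cond lam lam (sgn_block d) (block_mx 0 (W + W) (- (W + W)) 0) A <->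
  exists2 B, is_split lam B & A = dual_block W B.
Proof.
move=> d0 l1 Wt uW; have dd0 : (0 < d + d)%N by rewrite addn_gt0 d0.
have uWW : W + W \in unitmx.
  have -> : W + W = 2%:M *m W by rewrite mul_scalar_mx scaler_nat mulr2n.
  rewrite unitmx_mul uW andbT unitmxE det_scalar unitfE expf_eq0.
  by rewrite (negPf (two_neq0 R)) andbF.
have dualE B : dual_block W B *m sgn_block d = block_mx B 0 0 (W *m B^T *m invmx W).
  by rewrite mulmx_diag_block mulmx1 mulmxN mulmx1 opprK.
have dualM B : B *m B = lam%:M ->
    (W *m B^T *m invmx W) *m (W *m B^T *m invmx W) = lam%:M.
  move=> BB; rewrite conjmx_mul // -trmx_mul BB tr_scalar_mx.
  by rewrite scalar_mxC mulmxK.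
have splitI B : B *m B = lam%:M ->
    (is_split lam (dual_block W B *m sgn_block d) <-> is_split lam B).
  move=> BB; have BB' := dualM B BB; rewrite dualE.
  have sq : block_mx B 0 0 (W *m B^T *m invmx W) *m
      block_mx B 0 0 (W *m B^T *m invmx W) = lam%:M.
    by rewrite mulmx_diag_block BB BB' -scalar_mx_block.
  case: l1 BB BB' sq => -> BB BB' sq.
    rewrite !is_split1P // -!raddfN /= !mxrank_diag_shift !mxrank_trconj //.
    have dbl a b : (a + a = b + b)%N -> a = b by rewrite !addnn => /double_inj.
    by split=> -[_ rk]; split => //; [exact: dbl|rewrite rk].
  by rewrite !is_splitN1P.
split.
- move=> [sA skewA comA sAI].
  move: comA; rewrite -{1 2}[A]submxK /sgn_block.
  rewrite !mulmx_block !(mulmx0, mul0mx, mulmxN, mulNmx, mul1mx, mulmx1, addr0, add0r).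
  move=> /eq_block_mx [_ /esym/opp_fix ur /opp_fix dl _].
  set B := ulsubmx A; set B' := drsubmx A.
  have AE : A = block_mx B 0 0 B' by rewrite -[LHS]submxK ur dl.
  have B'E : B' = - (W *m B^T *m invmx W).
    move: skewA; rewrite AE tr_block_mx !trmx0 !mulmx_block opp_block_mx.
    rewrite !(mulmx0, mul0mx, mulmxN, mulNmx, addr0, add0r) !opprK.
    move=> /eq_block_mx [_ _ /esym E _].
    have {E} : (W + W) *m B^T = - (B' *m (W + W)) by exact: E.
    rewrite mulmxDl mulmxDr opprD => E.
    have E2 : W *m B^T = - (B' *m W) by rewrite -[LHS]half_add E half_add.
    by rewrite E2 mulNmx mulmxK // opprK.
  have AE' : A = dual_block W B by rewrite AE B'E.
  exists B => //; apply/splitI; last by rewrite -AE'.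
  have [AA _] := sA; move: AA; rewrite AE mulmx_diag_block scalar_mx_block.
  by move=> /eq_block_mx [].
- move=> [B sB ->]; have [BB _] := sB; have BB' := dualM B BB.
  split; last by apply/splitI.
  + have sq : dual_block W B *m dual_block W B = lam%:M.
      by rewrite mulmx_diag_block mulmxN mulNmx opprK BB BB' -scalar_mx_block.
    case: l1 sq BB => -> sq BB; last by rewrite is_splitN1P.
    rewrite is_split1P //; split => //.
    rewrite -raddfN /= !mxrank_diag_shift addnC; congr (_ + _)%N.
      by rewrite -(eqmx_opp (_ + _)%R) opprD opprK -raddfN opprK mxrank_trconj.
    by rewrite -(eqmx_opp (- _ + _)%R) opprD opprK -raddfN mxrank_trconj.
  + rewrite /dual_block tr_block_mx !trmx0 !mulmx_block opp_block_mx.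
    rewrite !(mulmx0, mul0mx, mulmxN, mulNmx, addr0, add0r) !opprK oppr0.
    congr (block_mx _ _ _ _).
      rewrite linearN /= !trmx_mul trmxK Wt skew_inv // !(mulmxN, mulNmx) !opprK.
      by rewrite mulmxDl !mulmxA mulmxV // mul1mx mulmxDr.
    rewrite mulmxDr -!mulmxA mulVmx // mulmx1 mulmxDl.
    by [].
  + by rewrite dualE mulmx_diag_block mul1mx mulNmx mul1mx opprK.
Qed.

(** [rframe W] is given by one formula valid for every invertible [W], so no shrinking around [W0]
    takes place. *)
Lemma real_local_model (lam : R) W0 : (0 < d)%N -> lam = 1 \/ lam = -1 ->
  local_model (fib lam lam) [set B : 'M[R]_d | is_split lam B] W0.
Proof.
move=> d0 l1; have dd0 : (0 < d + d)%N by rewrite addn_gt0 d0.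
exists (fun z => ulsubmx (rframe z.1 *m z.2 *m invmx (rframe z.1))),
  (fun z => invmx (rframe z.1) *m dual_block z.1 z.2 *m rframe z.1).
apply: filterE => W Wt uW; have uF := rframe_unit uW.
have ll : lam * lam = 1 by case: l1 => ->; rewrite ?mulrNN mulr1.
have fibE A : fib lam lam W A <->
    exists2 B, is_split lam B & rframe W *m A *m invmx (rframe W) = dual_block W B.
  apply: (iff_trans _ (alg_cond_dual_block _ d0 l1 Wt uW)).
  rewrite -(rframe_I uW) -(rframe_pairing Wt) /fib /mkset ll.
  exact: iff_sym (alg_cond_conj _ _ _ dd0 l1 l1 uF).
have sfst p q (z : 'M[R]_d * 'M[R]_(p, q)) : smooth_at fst z.
  by apply: smooth_at_fst; exact: smooth_at_id.
have ssnd p q (z : 'M[R]_d * 'M[R]_(p, q)) : smooth_at snd z.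
  by apply: smooth_at_snd; exact: smooth_at_id.
have sF p q (B : 'M[R]_(p, q)) : smooth_at (fun z : 'M[R]_d * 'M[R]_(p, q) => rframe z.1) (W, B).
  apply: smooth_at_block_mx; try exact: smooth_at_cst; first exact: sfst.
  by apply: smooth_atN; exact: sfst.
split=> [A /fibE [B sB AE] /=|B sB /=].
- rewrite AE block_mxKul; split=> //.
    by rewrite -AE -!mulmxA mulKmx // mulVmx // mulmx1.
  apply: smooth_at_lsubmx; apply: smooth_at_usubmx.
  apply: smooth_at_mulmx; last by apply: smooth_at_invmx.
  by apply: smooth_at_mulmx; [exact: sF|exact: ssnd].
- have BE : rframe W *m (invmx (rframe W) *m dual_block W B *m rframe W) *m
      invmx (rframe W) = dual_block W B by rewrite !mulmxA mulmxV // mul1mx mulmxK.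
  split.
  + by apply/fibE; exists B.
  + by rewrite BE block_mxKul.
  + apply: smooth_at_mulmx; last exact: sF.
    apply: smooth_at_mulmx; first by apply: smooth_at_invmx.
    apply: smooth_at_block_mx; try exact: smooth_at_cst; first exact: ssnd.
    apply: smooth_atN; apply: smooth_at_mulmx; last by apply: smooth_at_invmx.
    apply: smooth_at_mulmx; first exact: sfst.
    by apply: smooth_at_trmx; exact: ssnd.
Qed.

End RealFrame.

(** * Smooth congruence of Hermitian forms *)

Section LDLStep.
Context {R : realType}.
Local Notation C := R[i].

Lemma conj_real (a : R) : (real_complex R a)^* = real_complex R a.
Proof. by rewrite /real_complex_def /=; simpc. Qed.

Lemma tcZ_real p q (a : R) (A : 'M[C]_(p, q)) :
  (real_complex R a *: A) ^t* = real_complex R a *: A ^t*.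
Proof. by rewrite linearZ /= map_mxZ /= conj_real. Qed.

(** Block elimination: the lower row of [L] clears the entries beside the pivot [al] and leaves the
    Schur complement, while [s] rescales the pivot. *)
Lemma ldl_step n (al s : R) (b : 'M[C]_(1, n)) (c : 'M[C]_(n, 1)) (D B : 'M[C]_n) :
  b ^t* = c -> al != 0 ->
  let L := block_mx (real_complex R s *: 1%:M) 0
    (- (real_complex R al^-1 *: (B *m c))) B in
  L *m block_mx (real_complex R al *: 1%:M) b c D *m L ^t* =
  block_mx (real_complex R (s * s * al) *: 1%:M) 0 0
    (B *m (D - real_complex R al^-1 *: (c *m b)) *m B ^t*).
Proof.
move=> bc al0 L; have cb : c ^t* = b by rewrite -bc trmxCK.
have ala : real_complex R al^-1 * real_complex R al = 1.
  by rewrite -rmorphM mulVf.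
rewrite /L tc_block tcN !tcZ_real tcM cb tc0 tc1 !mulmx_block.
rewrite !(mulmx0, mul0mx, addr0, add0r, mul1mx, mulmx1, mulNmx, mulmxN).
rewrite -!(scalemxAl, scalemxAr) !mulmx1 !mul1mx !scalerA.
rewrite ala scale1r addNr.
have sal : real_complex R s * real_complex R al * real_complex R al^-1 = real_complex R s.
  by rewrite -mulrA [real_complex R al * _]mulrC ala mulr1.
have ssE : real_complex R s * (real_complex R s * real_complex R al) =
    real_complex R (s * s * al) by rewrite -!rmorphM /= mulrA.
rewrite sal ssE addNr mul0mx !scaler0 oppr0 add0r.
by rewrite mulmxBr -scalemxAr !mulmxA [- _ + _]addrC.
Qed.

End LDLStep.

Section ComplexSmooth.
Context {R : realType} {V : normedModType R}.
Local Notation C := R[i].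

(** Smoothness over the reals, through real and imaginary parts; conjugate transposition is thus a
    smooth operation. *)
Definition csmooth_at p q (f : V -> 'M[C]_(p, q)) (x : V) : Prop :=
  smooth_at (fun y => re_mx (f y)) x /\ smooth_at (fun y => im_mx (f y)) x.

Lemma csmooth_at_cst p q (A : 'M[C]_(p, q)) x : csmooth_at (fun=> A) x.
Proof. by split; exact: smooth_at_cst. Qed.

Lemma csmooth_atM p q r (f : V -> 'M[C]_(p, q)) (g : V -> 'M[C]_(q, r)) x :
  csmooth_at f x -> csmooth_at g x -> csmooth_at (fun y => f y *m g y) x.
Proof.
move=> [f1 f2] [g1 g2]; split.
  under eq_fun do rewrite re_mxM.
  by apply: smooth_atD; [|apply: smooth_atN]; exact: smooth_at_mulmx.
under eq_fun do rewrite im_mxM.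
by apply: smooth_atD; exact: smooth_at_mulmx.
Qed.

Lemma csmooth_atD p q (f g : V -> 'M[C]_(p, q)) x :
  csmooth_at f x -> csmooth_at g x -> csmooth_at (fun y => f y + g y) x.
Proof.
move=> [f1 f2] [g1 g2]; split.
  by under eq_fun do rewrite re_mxD; exact: smooth_atD.
by under eq_fun do rewrite im_mxD; exact: smooth_atD.
Qed.

Lemma csmooth_atN p q (f : V -> 'M[C]_(p, q)) x :
  csmooth_at f x -> csmooth_at (fun y => - f y) x.
Proof.
move=> [f1 f2]; split.
  by under eq_fun do rewrite re_mxN; exact: smooth_atN.
by under eq_fun do rewrite im_mxN; exact: smooth_atN.
Qed.

Lemma csmooth_atZ p q (a : V -> R) (f : V -> 'M[C]_(p, q)) x :
  smooth_at a x -> csmooth_at f x -> csmooth_at (fun y => real_complex R (a y) *: f y) x.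
Proof.
move=> sa [f1 f2]; split.
  have -> : (fun y => re_mx (real_complex R (a y) *: f y)) = (fun y => a y *: re_mx (f y)).
    by apply/funext => y; apply/matrixP => i j; rewrite !mxE Re_mul /= mul0r subr0.
  exact: smooth_atZ.
have -> : (fun y => im_mx (real_complex R (a y) *: f y)) = (fun y => a y *: im_mx (f y)).
  by apply/funext => y; apply/matrixP => i j; rewrite !mxE Im_mul /= mul0r addr0.
exact: smooth_atZ.
Qed.

Lemma csmooth_at_imag p q (f : V -> 'M[C]_(p, q)) x :
  csmooth_at f x -> csmooth_at (fun y => imag *: f y) x.
Proof.
move=> [f1 f2]; split.
  by under eq_fun do rewrite re_imagZ; exact: smooth_atN.
by under eq_fun do rewrite im_imagZ.
Qed.

Lemma csmooth_at_cplx p q (f : V -> 'M[R]_(p, q)) x :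
  smooth_at f x -> csmooth_at (fun y => cplx_mx (f y)) x.
Proof.
move=> sf; split; first by under eq_fun do rewrite re_cplx_mx.
by under eq_fun do rewrite im_cplx_mx; exact: smooth_at_cst.
Qed.

Lemma csmooth_at_tc p q (f : V -> 'M[C]_(p, q)) x :
  csmooth_at f x -> csmooth_at (fun y => (f y) ^t*) x.
Proof.
move=> [f1 f2]; split.
  by under eq_fun do rewrite re_tc; exact: smooth_at_trmx.
by under eq_fun do rewrite im_tc; apply: smooth_atN; exact: smooth_at_trmx.
Qed.

Lemma csmooth_at_block p q r s (f : V -> 'M[C]_(p, r)) (g : V -> 'M[C]_(p, s))
    (h : V -> 'M[C]_(q, r)) (k : V -> 'M[C]_(q, s)) x :
  csmooth_at f x -> csmooth_at g x -> csmooth_at h x -> csmooth_at k x ->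
  csmooth_at (fun y => block_mx (f y) (g y) (h y) (k y)) x.
Proof.
move=> [f1 f2] [g1 g2] [h1 h2] [k1 k2]; split.
  have -> : (fun y => re_mx (block_mx (f y) (g y) (h y) (k y))) =
    (fun y => block_mx (re_mx (f y)) (re_mx (g y)) (re_mx (h y)) (re_mx (k y))).
    by apply/funext => y; exact: map_block_mx.
  exact: smooth_at_block_mx.
have -> : (fun y => im_mx (block_mx (f y) (g y) (h y) (k y))) =
  (fun y => block_mx (im_mx (f y)) (im_mx (g y)) (im_mx (h y)) (im_mx (k y))).
  by apply/funext => y; exact: map_block_mx.
exact: smooth_at_block_mx.
Qed.

Lemma csmooth_at_reindex p q p' q' (f : V -> 'M[C]_(p, q))
    (g : 'M[C]_(p, q) -> 'M[C]_(p', q'))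
    (a : 'I_p' -> 'I_q' -> 'I_p) (b : 'I_p' -> 'I_q' -> 'I_q) x :
  (forall A i j, g A i j = A (a i j) (b i j)) ->
  csmooth_at f x -> csmooth_at (fun y => g (f y)) x.
Proof.
move=> gE [f1 f2].
by split; apply: smooth_at_mx => i j; under eq_fun do rewrite mxE gE;
  [have := smooth_at_coord (a i j) (b i j) f1|have := smooth_at_coord (a i j) (b i j) f2];
  under eq_fun do rewrite mxE.
Qed.

Lemma csmooth_at_ul p q r s (f : V -> 'M[C]_(p + q, r + s)) x :
  csmooth_at f x -> csmooth_at (fun y => ulsubmx (f y)) x.
Proof. by apply: csmooth_at_reindex => A i j; rewrite !mxE. Qed.

Lemma csmooth_at_ur p q r s (f : V -> 'M[C]_(p + q, r + s)) x :
  csmooth_at f x -> csmooth_at (fun y => ursubmx (f y)) x.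
Proof. by apply: csmooth_at_reindex => A i j; rewrite !mxE. Qed.

Lemma csmooth_at_dl p q r s (f : V -> 'M[C]_(p + q, r + s)) x :
  csmooth_at f x -> csmooth_at (fun y => dlsubmx (f y)) x.
Proof. by apply: csmooth_at_reindex => A i j; rewrite !mxE. Qed.

Lemma csmooth_at_dr p q r s (f : V -> 'M[C]_(p + q, r + s)) x :
  csmooth_at f x -> csmooth_at (fun y => drsubmx (f y)) x.
Proof. by apply: csmooth_at_reindex => A i j; rewrite !mxE. Qed.

Lemma smooth_at_realify r (f : V -> 'M[C]_r) x :
  csmooth_at f x -> smooth_at (fun y => realify (f y)) x.
Proof.
move=> [f1 f2]; apply: smooth_at_block_mx => //.
exact: smooth_atN.
Qed.

Lemma csmooth_at_unrealify r (f : V -> 'M[R]_(r + r)) x :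
  smooth_at f x -> csmooth_at (fun y => unrealify (f y)) x.
Proof.
move=> sf; split.
  under eq_fun do rewrite re_unrealify.
  by apply: smooth_at_lsubmx; exact: smooth_at_usubmx.
under eq_fun do rewrite im_unrealify.
by apply: smooth_at_lsubmx; exact: smooth_at_dsubmx.
Qed.

Lemma near_cunitmx r (f : V -> 'M[C]_r) x :
  csmooth_at f x -> f x \in unitmx -> \forall y \near x, f y \in unitmx.
Proof.
move=> /smooth_at_realify sf; rewrite -unitmx_realify => uf.
apply: filterS (near_unitmx (f := fun y => realify (f y)) sf uf) => y.
by rewrite unitmx_realify.
Qed.

Lemma csmooth_at_inv r (f : V -> 'M[C]_r) x :
  f x \in unitmx -> csmooth_at f x -> csmooth_at (fun y => invmx (f y)) x.
Proof.
move=> ufx sf; have srf := smooth_at_realify sf; have urf := realify_unit ufx.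
have [h1 h2] := csmooth_at_unrealify
  (smooth_at_invmx (f := fun y => realify (f y)) urf srf).
have E : \forall y \near x, unrealify (invmx (realify (f y))) = invmx (f y).
  apply: filterS (near_cunitmx sf ufx) => y uy.
  by rewrite -realifyV // realifyK.
by split; [apply: smooth_at_eq h1|apply: smooth_at_eq h2]; apply: filterS E => y ->.
Qed.

(* Induction on the size, by passing to the Schur complement of the first entry.  The
   factor B commutes with the diagonal matrices that commute with K. *)
Lemma smooth_ldl n (K : V -> 'M[C]_n) (e : 'rV[C]_n) x :
  csmooth_at K x -> (forall i, e 0 i = 1 \/ e 0 i = -1) -> K x = diag_mx e ->
  exists2 B : V -> 'M[C]_n, csmooth_at B x &
    \forall y \near x, (K y) ^t* = K y ->
      B y *m K y *m (B y) ^t* = diag_mx e /\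
      forall E : 'rV[C]_n, diag_mx E *m K y = K y *m diag_mx E ->
        diag_mx E *m B y = B y *m diag_mx E.
Proof.
elim: n K e => [|n IH] K e sK e1 Kx.
  exists (fun=> 0); first exact: csmooth_at_cst.
  apply: filterE => y _; split; first by rewrite mul0mx [RHS]flatmx0 mul0mx.
  by move=> E _; rewrite mulmx0 mul0mx.
rewrite -[n.+1]/(1 + n)%N in K e sK e1 Kx *.
pose l := lsubmx e; pose e' := rsubmx e.
have eE : diag_mx e = block_mx (diag_mx l) 0 0 (diag_mx e').
  by rewrite -diag_mx_row hsubmxK.
(* The pivot of a Hermitian matrix is real. Its real part is taken so that [a] is a smooth real
   function also where [K y] is not Hermitian. *)
pose a y := complex.Re (ulsubmx (K y) 0 0).
have sa : smooth_at a x.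
  have [h _] := csmooth_at_ul sK.
  by have := smooth_at_coord 0 0 h; under eq_fun do rewrite mxE.
pose eps := complex.Re (l 0 0).
have epsE : l 0 0 = real_complex R eps /\ eps * eps = 1.
  by rewrite /eps /l mxE; case: (e1 (lshift n 0)) => -> /=;
    rewrite ?mulrNN mulr1; split => //; rewrite /real_complex_def /=; simpc.
have ax : a x = eps by rewrite /a Kx eE block_mxKul [diag_mx _ _ _]mxE eqxx mulr1n.
(* The pivot keeps the sign [eps] near [x]. Scaling by the inverse square root of [eps * a] turns it
   into [a / (eps * a) = eps], as [eps * eps = 1]. *)
have a0 : 0 < eps * a x by rewrite ax (proj2 epsE).
have a1 : a x != 0 by apply: contraTneq a0 => ->; rewrite mulr0 ltxx.
have sea : smooth_at (fun y => eps * a y) x.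
  by apply: smooth_atM => //; exact: smooth_at_cst.
pose K' y := drsubmx (K y) -
  real_complex R (a y)^-1 *: (dlsubmx (K y) *m ursubmx (K y)).
have sK' : csmooth_at K' x.
  apply: csmooth_atD; first exact: csmooth_at_dr.
  apply: csmooth_atN; apply: csmooth_atZ; first exact: smooth_atV.
  by apply: csmooth_atM; [exact: csmooth_at_dl|exact: csmooth_at_ur].
have K'x : K' x = diag_mx e'.
  by rewrite /K' Kx eE block_mxKdr block_mxKdl mul0mx scaler0 subr0.
have e'1 i : e' 0 i = 1 \/ e' 0 i = -1 by rewrite /e' mxE; exact: e1.
have [B' sB' BP] := IH K' e' sK' e'1 K'x.
pose B y : 'M[C]_(1 + n) := block_mx (real_complex R (Num.sqrt (eps * a y))^-1 *: 1%:M) 0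
  (- (real_complex R (a y)^-1 *: (B' y *m dlsubmx (K y)))) (B' y).
have sB : csmooth_at B x.
  apply: csmooth_at_block => //; try exact: csmooth_at_cst.
    apply: csmooth_atZ; last exact: csmooth_at_cst.
    apply: smooth_atV; first by rewrite gt_eqF // sqrtr_gt0.
    exact: smooth_at_sqrt.
  apply: csmooth_atN; apply: csmooth_atZ; first exact: smooth_atV.
  by apply: csmooth_atM => //; exact: csmooth_at_dl.
exists B => //.
have nea : \forall y \near x, 0 < eps * a y.
  exact: (smooth_at_continuous sea (open_nbhs_nbhs (conj (@open_gt R 0) a0))).
apply: filterS2 nea BP => y ay IHy Ky.
have ay0 : a y != 0 by apply: contraTneq ay => ->; rewrite mulr0 ltxx.
move: (Ky); rewrite -{1 2}[K y]submxK tc_block => /eq_block_mx [pp cb bc DD].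
have pE : ulsubmx (K y) = real_complex R (a y) *: 1%:M.
  apply/matrixP => i j; have /matrixP /(_ i j) := pp; rewrite !ord1 !mxE mulr1.
  rewrite /a !mxE; case: (K y _ _) => u v /= [] /esym/eqP.
  by rewrite -addr_eq0 -mulr2n mulrn_eq0 /= => /eqP ->.
have [|B'K' comB'] := IHy; first by rewrite /K' tcD tcN tcZ_real tcM bc cb DD.
split.
  rewrite -[K y]submxK pE (ldl_step _ _ _ bc ay0) -/(K' y) B'K' eE.
  congr (block_mx _ _ _ _).
  have -> : (Num.sqrt (eps * a y))^-1 * (Num.sqrt (eps * a y))^-1 * a y = eps.
    rewrite -invfM -expr2 sqr_sqrtr ?ltW //; apply: (mulfI (lt0r_neq0 ay)).
    by rewrite mulrA mulfV ?gt_eqF // mul1r mulrAC (proj2 epsE) mul1r.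
  by apply/matrixP => i j; rewrite !ord1 [RHS]mxE [LHS]mxE mxE (proj1 epsE) mulr1.
move=> E; rewrite -[K y]submxK -[E]hsubmxK diag_mx_row !mulmx_block.
rewrite !(mulmx0, mul0mx, addr0, add0r) => /eq_block_mx [Ep Eb Ec ED].
(* A diagonal matrix commuting with [K y] commutes blockwise, so its lower part commutes with the
   Schur complement and the induction hypothesis applies. *)
have EB' : diag_mx (rsubmx E) *m B' y = B' y *m diag_mx (rsubmx E).
  apply: comB'; rewrite /K' mulmxBr mulmxBl ED -scalemxAr -scalemxAl.
  by rewrite mulmxA Ec -!mulmxA Eb.
rewrite -scalemxAl -scalemxAr mul1mx mulmx1 EB' mulmxN mulNmx -scalemxAl -scalemxAr.
by rewrite (mulmxA (diag_mx _)) EB' -(mulmxA (B' y)) Ec mulmxA.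
Qed.

End ComplexSmooth.

(** * Sylvester's law of inertia *)

Section Signs.
Variable F : numFieldType.

Definition is_sign n (e : 'rV[F]_n) := forall i, e 0 i = 1 \/ e 0 i = -1.
Definition npos n (e : 'rV[F]_n) := #|[pred i | e 0 i == 1]|.

Lemma m1_neq1 : (-1 == 1 :> F) = false.
Proof. by rewrite eq_sym -addr_eq0 -[1 + 1]/(2%:R) pnatr_eq0. Qed.

(** A sign vector is a tuple of booleans, and two such tuples with the same number of [true] are
    permutations of each other; the permutation matrix reorders the diagonal. *)
Lemma sign_sort n (e f : 'rV[F]_n) : is_sign e -> is_sign f -> npos e = npos f ->
  exists s : 'S_n, perm_mx s *m diag_mx e *m (perm_mx s)^T = diag_mx f.
Proof.
move=> se sf ef.
pose te := [tuple e 0 i == 1 | i < n]; pose tf := [tuple f 0 i == 1 | i < n].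
have cntE (g : 'rV[F]_n) : count id [tuple g 0 i == 1 | i < n] = npos g.
  rewrite count_map /npos cardE -size_filter /= /enum_mem -filter_predI.
  by congr size; apply: eq_filter => i; rewrite /= !inE andbT.
have cnt (a : pred bool) (t : n.-tuple bool) :
    count a t = (a true * count id t + a false * (n - count id t))%N.
  have -> : (n - count id t = count negb t)%N.
    by rewrite -{1}(size_tuple t) -(count_predC id t) addKn.
  elim: (tval t) => [|[] s IH] /=; rewrite ?muln0 // IH;
    by case: (a true); case: (a false); rewrite /= ?mul1n ?mul0n ?addn0 ?add0n ?add1n ?addnS.
have : perm_eq tf te.
  by apply/seq.permP => a; rewrite (cnt a tf) (cnt a te) !cntE ef.
move=> /tuple_permP [s sE]; exists s.
have fe i : (f 0 i == 1) = (e 0 (s i) == 1).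
  have := congr1 (fun t => nth false t i) sE.
  by rewrite -!tnth_nth !tnth_mktuple.
rewrite -row_permE tr_perm_mx -col_permE.
apply/matrixP => i j; rewrite !mxE (inj_eq perm_inj).
case: eqVneq => // -> /=; congr (_ *+ _); have := fe j.
case: (se (s j)) => ->; case: (sf j) => -> //;
  by rewrite ?eqxx m1_neq1.
Qed.

End Signs.

Section Hermitian.
Context {R : realType}.
Local Notation C := R[i].

(** The spectral theorem, followed by division by the square roots of the absolute values of the
    eigenvalues. *)
Lemma hermitian_diag n (K : 'M[C]_n) : K ^t* = K -> K \in unitmx ->
  exists (P : 'M[C]_n) (e : 'rV[C]_n),
    [/\ P \in unitmx, is_sign e & P *m K *m P ^t* = diag_mx e].
Proof.
move=> Kh uK; have hK : K \is hermsymmx.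
  by apply/is_hermitianmxP; rewrite expr0 scale1r Kh.
have dr := hermitian_spectral_diag_real hK.
have /orthomx_spectralP := hermitian_normalmx hK.
set P := spectralmx K; set d := spectral_diag K => KE.
have uP : P \in unitmx := spectral_unit K.
have PV : invmx P = P ^t* by rewrite invmx_unitary // spectral_unitarymx.
have PKP : P *m K *m P ^t* = diag_mx d.
  by rewrite KE -PV -!mulmxA mulmxV // mulmx1 mulKVmx.
have d0 i : d 0 i != 0.
  have : diag_mx d \in unitmx by rewrite -PKP !unitmx_mul uP uK tc_unit.
  by rewrite unitmxE det_diag unitfE => /prodf_neq0 /(_ i isT).
have dR i : d 0 i \is Num.real by move/mxOverP: dr; apply.
pose s : 'rV[C]_n := \row_i (sqrtC `|d 0 i|)^-1.
have s0 i : 0 < s 0 i by rewrite mxE invr_gt0 sqrtC_gt0 normr_gt0.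
have uS : diag_mx s \in unitmx.
  by rewrite unitmxE det_diag unitfE; apply/prodf_neq0 => i _; rewrite gt_eqF.
exists (diag_mx s *m P), (\row_i (s 0 i * d 0 i * s 0 i)); split.
- by rewrite unitmx_mul uS.
- move=> i; rewrite mxE mulrAC -expr2 mxE exprVn sqrtCK.
  have /orP[di|di] : (0 <= d 0 i) || (d 0 i <= 0) by exact: dR.
    by left; rewrite ger0_norm // mulVf.
  by right; rewrite ler0_norm // invrN mulNr mulVf.
have -> : diag_mx s *m P *m K *m (diag_mx s *m P) ^t* =
    diag_mx s *m (P *m K *m P ^t*) *m (diag_mx s) ^t* by rewrite tcM !mulmxA.
rewrite PKP tr_diag_mx map_diag_mx.
apply/matrixP => i j; rewrite mul_mx_diag mul_diag_mx !mxE.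
case: eqVneq => [->|]; last by rewrite !mulr0n mulr0 mul0r.
rewrite !mulr1n; congr (_ * _); apply: geC0_conj.
by rewrite invr_ge0 sqrtC_ge0.
Qed.

(** If [f] had more positive entries than [e], some nonzero [y] supported on the positive
    coordinates of [f] would have an image [z = y P] vanishing on those of [e]. The same form would
    be positive at [y] and nonpositive at [z]. *)
Lemma inertia_le n (P : 'M[C]_n) (e f : 'rV[C]_n) :
  is_sign e -> is_sign f ->
  P *m diag_mx e *m P ^t* = diag_mx f -> (npos f <= npos e)%N.
Proof.
move=> se sf PeP; rewrite leqNgt; apply/negP => lt.
pose A := [pred i | f 0 i == 1]; pose B := [pred i | e 0 i == 1].
pose g (i : 'I_#|A|) : 'I_n := enum_val i; pose h (j : 'I_#|B|) : 'I_n := enum_val j.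
pose Q := mxsub g h P.
(* [Q] has more rows than columns. *)
have : kermx Q != 0.
  rewrite -mxrank_eq0 mxrank_ker subn_eq0 -ltnNge.
  by rewrite (leq_ltn_trans (rank_leq_col Q)).
move=> /rowV0Pn [x /sub_kermxP xQ x0].
pose y := x *m rowsub g 1%:M.
have yg k : y 0 (g k) = x 0 k.
  rewrite mxE (bigD1 k) //= !mxE eqxx mulr1 big1 ?addr0 // => l lk.
  by rewrite !mxE (inj_eq enum_val_inj) (negPf lk) mulr0.
have yA i : i \notin A -> y 0 i = 0.
  move=> iA; rewrite mxE big1 // => k _; rewrite !mxE.
  case: eqVneq => [E|]; last by rewrite mulr0.
  by move: iA; rewrite -E enum_valP.
pose z := y *m P.
have zB j : j \in B -> z 0 j = 0.
  move=> jB; have -> : z = x *m rowsub g P.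
    by rewrite /z /y -mulmxA; congr (_ *m _); rewrite mul_rowsub_mx mul1mx.
  rewrite -(enum_rankK_in jB jB) -/(h _).
  have := congr1 (fun M : 'rV_ _ => M 0 (enum_rank_in jB j)) xQ.
  by rewrite !mxE => xQ0; rewrite -[RHS]xQ0; apply: eq_bigr => k _; rewrite !mxE.
have form (u : 'rV[C]_n) (c : 'rV[C]_n) :
    (u *m diag_mx c *m u ^t*) 0 0 = \sum_i c 0 i * `|u 0 i| ^+ 2.
  rewrite mxE; apply: eq_bigr => i _; rewrite mul_mx_diag !mxE normCK.
  by rewrite mulrAC mulrC.
have Ey : (y *m diag_mx f *m y ^t*) 0 0 = (z *m diag_mx e *m z ^t*) 0 0.
  by rewrite -PeP /z (tcM y P) !mulmxA.
have ypos : 0 < (y *m diag_mx f *m y ^t*) 0 0.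
  have [k xk] : exists k, x 0 k != 0 by apply/rV0Pn.
  rewrite form (bigD1 (g k)) //= yg.
  have -> : f 0 (g k) = 1 by apply/eqP; exact: (enum_valP k).
  rewrite mul1r ltr_pwDl ?exprn_gt0 ?normr_gt0 //.
  apply: sumr_ge0 => i _; have [iA|iA] := boolP (i \in A).
    by rewrite (eqP iA) mul1r exprn_ge0.
  by rewrite yA // normr0 expr0n mulr0.
have zneg : (z *m diag_mx e *m z ^t*) 0 0 <= 0.
  rewrite form -oppr_ge0 -sumrN; apply: sumr_ge0 => i _.
  have [iB|iB] := boolP (i \in B); first by rewrite zB // normr0 expr0n mulr0 oppr0.
  case: (se i) => ei; first by move: iB; rewrite inE ei eqxx.
  by rewrite ei mulN1r opprK exprn_ge0.
by move: ypos; rewrite Ey => /lt_le_trans /(_ zneg); rewrite ltxx.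
Qed.

Lemma inertia n (P : 'M[C]_n) (e f : 'rV[C]_n) : P \in unitmx ->
  is_sign e -> is_sign f -> P *m diag_mx e *m P ^t* = diag_mx f -> npos f = npos e.
Proof.
move=> uP se sf PeP; apply/eqP; rewrite eqn_leq (inertia_le se sf PeP) /=.
apply: (inertia_le (P := invmx P)) => //; rewrite -PeP tcV.
by rewrite !mulmxA mulVmx // mul1mx mulmxK // tc_unit.
Qed.

End Hermitian.

(** * Local models for lam ell = -1 *)

Section ComplexFrame.
Context {R : realType} {m : nat}.
Local Notation C := R[i].
Local Notation d := (m + m)%N.
Implicit Types (W : 'M[R]_d).

Definition jsign : 'rV[C]_d := row_mx (const_mx 1) (const_mx (-1)).

Lemma mx_pqE : mx_pq m m = diag_mx jsign :> 'M[C]_d.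
Proof.
rewrite /jsign diag_mx_row /mx_pq !diag_const_mx.
by rewrite raddfN.
Qed.

Lemma jsignP : is_sign jsign.
Proof.
move=> i; rewrite mxE; case: (fintype.split i) => j; rewrite mxE; by [left|right].
Qed.

Lemma npos_row (F : numFieldType) p q (e : 'rV[F]_p) (f : 'rV[F]_q) :
  npos (row_mx e f) = (npos e + npos f)%N.
Proof.
rewrite /npos -!sum1_card big_split_ord /=; congr (_ + _)%N.
  by apply: eq_bigl => i; rewrite !inE row_mxEl.
by apply: eq_bigl => i; rewrite !inE row_mxEr.
Qed.

Lemma nposN (F : numFieldType) p (e : 'rV[F]_p) : is_sign e ->
  (npos (- e) + npos e)%N = p.
Proof.
move=> se; rewrite /npos -[RHS]card_ord addnC -(cardC [pred i | e 0 i == 1]).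
congr (_ + _)%N; apply: eq_card => i; rewrite !inE mxE.
by case: (se i) => ->; rewrite ?opprK ?eqxx ?m1_neq1.
Qed.

Lemma npos_const1 (F : numFieldType) p : npos (const_mx 1 : 'rV[F]_p) = p.
Proof. by rewrite /npos -[RHS]card_ord; apply: eq_card => i; rewrite !inE mxE eqxx. Qed.

Lemma npos_constN1 (F : numFieldType) p : npos (const_mx (-1) : 'rV[F]_p) = 0%N.
Proof. by rewrite /npos; apply: eq_card0 => i; rewrite !inE mxE m1_neq1. Qed.

Lemma npos_jsign : npos jsign = m.
Proof. by rewrite npos_row npos_const1 npos_constN1 addn0. Qed.

Lemma perm_mx_tc n (s : {perm 'I_n}) : (perm_mx s : 'M[C]_n) ^t* = (perm_mx s)^T.
Proof. by rewrite tr_perm_mx map_perm_mx. Qed.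

Lemma cplx_mx_unit n (A : 'M[R]_n) : (cplx_mx A \in unitmx) = (A \in unitmx).
Proof. exact: map_unitmx. Qed.

Lemma conj_map_mul p q r (A : 'M[C]_(p, q)) (B : 'M[C]_(q, r)) :
  map_mx Num.conj (A *m B) = map_mx Num.conj A *m map_mx Num.conj B.
Proof. exact: map_mxM. Qed.

Lemma conj_sign n (e : 'rV[C]_n) : is_sign e -> map_mx Num.conj e = e.
Proof.
move=> se; apply/matrixP => i j; rewrite ord1 mxE.
by case: (se j) => ->; rewrite ?rmorphN rmorph1.
Qed.

Definition iform W : 'M[C]_d := imag *: cplx_mx W.

Lemma iform_tc W : W^T = - W -> (iform W) ^t* = iform W.
Proof.
move=> Wt; apply: reim_eq.
  by rewrite re_tc !re_imagZ im_cplx_mx oppr0 trmx0.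
by rewrite im_tc !im_imagZ re_cplx_mx Wt opprK.
Qed.

Lemma iform_unit W : W \in unitmx -> iform W \in unitmx.
Proof.
move=> uW; rewrite /iform -mul_scalar_mx unitmx_mul cplx_mx_unit uW andbT.
rewrite unitmxE det_scalar unitfE expf_eq0.
by rewrite /imag eq_complex /= oner_eq0 andbF andbF.
Qed.

(* Complex conjugation turns the Hermitian form iW into its opposite, whence its
   signature is (m, m). *)
Lemma iform_normal W : W^T = - W -> W \in unitmx ->
  exists2 P : 'M[C]_d, P \in unitmx & P *m iform W *m P ^t* = mx_pq m m.
Proof.
move=> Wt uW.
have [P [e [uP se PK]]] := hermitian_diag (iform_tc Wt) (iform_unit uW).
have sNe : is_sign (- e).
  by move=> i; rewrite mxE; case: (se i) => ->; rewrite ?opprK; [right|left].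
pose Pc := map_mx Num.conj P; have uPc : Pc \in unitmx by rewrite map_unitmx.
have iN : map_mx Num.conj (iform W) = - iform W.
  by rewrite map_mxZ conj_cplx_mx /= conj_imag scaleNr.
have Ne : (Pc *m invmx P) *m diag_mx e *m (Pc *m invmx P) ^t* = diag_mx (- e).
  rewrite -PK tcM tcV !mulmxA mulmxKV // mulmxK ?tc_unit //.
  have := congr1 (map_mx Num.conj) PK.
  rewrite !conj_map_mul iN mulmxN mulNmx map_diag_mx conj_sign // => E.
  have -> : diag_mx (- e) = - diag_mx e by exact: raddfN.
  by rewrite -E opprK; congr (_ *m _); rewrite /Pc map_trmx.
have ePc : npos (- e) = npos e.
  have uPP : Pc *m invmx P \in unitmx by rewrite unitmx_mul uPc unitmx_inv.
  exact: (inertia uPP se sNe Ne).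
have em : npos e = npos jsign.
  rewrite npos_jsign; have := nposN se; rewrite ePc; move: (npos e) => k kk.
  by apply: double_inj; rewrite -!addnn.
have [s sE] := sign_sort se jsignP em.
exists (perm_mx s *m P); first by rewrite unitmx_mul unitmx_perm.
by rewrite mx_pqE -sE -PK tcM perm_mx_tc !mulmxA.
Qed.

Lemma smooth_at_near (V V' : normedModType R) (f : V -> V') x :
  smooth_at f x -> \forall y \near x, smooth_at f y.
Proof.
move=> [ O [oO Ox sf]]; apply: filterS (open_nbhs_nbhs (conj oO Ox)) => y Oy.
by exists O.
Qed.

(** A fixed [P] normalizes the form [iW] at [W0]. Nearby, [P iW P^*] is close to [mx_pq m m], and
    [smooth_ldl] supplies the smooth factor [B W] that restores the normal form. *)
Lemma cframe W0 : W0^T = - W0 -> W0 \in unitmx ->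
  exists F : 'M[R]_d -> 'M[R]_(d + d), \forall W \near W0,
    W^T = - W -> W \in unitmx ->
    [/\ F W \in unitmx, smooth_at F W,
        F W *m I_mx (-1) W *m invmx (F W) = - Jcplx d
      & F W *m pairing *m (F W)^T = realify (mx_pq m m)].
Proof.
move=> W0t uW0; have [P uP PK] := iform_normal W0t uW0.
pose K W := P *m iform W *m P ^t*.
have sK : csmooth_at K W0.
  apply: csmooth_atM; last exact: csmooth_at_cst.
  apply: csmooth_atM; first exact: csmooth_at_cst.
  by apply: csmooth_at_imag; apply: csmooth_at_cplx; exact: smooth_at_id.
have [|B sB BP] := smooth_ldl sK jsignP; first by rewrite -mx_pqE -PK.
(* In the basis of the rows of [G W], [I_mx (-1) W] becomes [- Jcplx d] and the pairing becomes the
   real form of [iW]. *)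
pose G W : 'M[R]_(d + d) := block_mx 1%:M 0 0 W.
pose F W := realify (B W *m P) *m G W.
have sF : smooth_at F W0.
  apply: smooth_at_mulmx.
    by apply: smooth_at_realify; apply: csmooth_atM => //; exact: csmooth_at_cst.
  by apply: smooth_at_block_mx; try exact: smooth_at_cst; exact: smooth_at_id.
exists F; apply: filterS2 (smooth_at_near sF) BP => W sFW BW Wt uW.
have [|BK _] := BW; first by rewrite /K !tcM tcK iform_tc // mulmxA.
pose c := B W *m P.
have cK : c *m iform W *m c ^t* = mx_pq m m.
  by rewrite mx_pqE -BK /c /K tcM !mulmxA.
have uc : c \in unitmx.
  have : mx_pq m m \in @unitmx C d.
    rewrite mx_pqE unitmxE det_diag unitfE; apply/prodf_neq0 => i _.
    by case: (jsignP i) => ->; rewrite ?oppr_eq0 oner_eq0.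
  by rewrite -cK !unitmx_mul => /andP [/andP []].
have uG : G W \in unitmx by rewrite unitmxE det_ublock det1 mul1r -unitmxE.
have urc := realify_unit uc.
have uF : F W \in unitmx by rewrite unitmx_mul urc.
have GI : G W *m I_mx (-1) W = - Jcplx d *m G W.
  rewrite /G /I_mx /Jcplx opp_block_mx !mulmx_block.
  rewrite !(mulmx0, mul0mx, addr0, add0r, oppr0, mul1mx, mulmx1, opprK).
  by rewrite scaleN1r mulmxN mulmxV.
have GP : G W *m pairing *m (G W)^T = realify (iform W).
  rewrite realifyE re_imagZ im_imagZ re_cplx_mx im_cplx_mx oppr0.
  rewrite /G /pairing tr_block_mx !trmx0 trmx1 Wt !mulmx_block.
  by rewrite !(mulmx0, mul0mx, addr0, add0r, mul1mx, mulmx1).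
split=> //.
  apply: (canLR (mulmxK uF)); rewrite /F -mulmxA GI !mulmxA mulmxN mulNmx.
  by rewrite realify_commJ !mulNmx.
have -> : F W *m pairing *m (F W)^T =
    realify c *m (G W *m pairing *m (G W)^T) *m (realify c)^T.
  by rewrite /F trmx_mul !mulmxA.
by rewrite GP -realify_tc -!realifyM cK.
Qed.

Lemma local_model_of_frame (Fib : 'M[R]_d -> set 'M[R]_(d + d)) (E : set 'M[R]_(d + d))
    (F : 'M[R]_d -> 'M[R]_(d + d)) W0 :
  (\forall W \near W0, W^T = - W -> W \in unitmx ->
    [/\ F W \in unitmx, smooth_at F W
      & forall A, Fib W A <-> E (F W *m A *m invmx (F W))]) ->
  local_model Fib E W0.
Proof.
move=> nF; exists (fun z => F z.1 *m z.2 *m invmx (F z.1)),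
  (fun z => invmx (F z.1) *m z.2 *m F z.1).
apply: filterS nF => W h Wt uW; have [uF sF fibE] := h Wt uW.
have sF1 (B : 'M[R]_(d + d)) :
    smooth_at (fun z : 'M[R]_d * 'M[R]_(d + d) => F z.1) (W, B).
  apply: (@smooth_at_comp _ _ _ _ _ fst F) => //; first exact: has_coords_mx.
  by apply: smooth_at_fst; exact: smooth_at_id.
have s2 (B : 'M[R]_(d + d)) :
    smooth_at (fun z : 'M[R]_d * 'M[R]_(d + d) => z.2) (W, B).
  by apply: smooth_at_snd; exact: smooth_at_id.
split=> [A /fibE EA|B EB] /=.
  split=> //.
    by rewrite -!mulmxA mulKmx // mulVmx // mulmx1.
  apply: smooth_at_mulmx; last by apply: smooth_at_invmx.
  by apply: smooth_at_mulmx; [exact: sF1|exact: s2].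
have BE : F W *m (invmx (F W) *m B *m F W) *m invmx (F W) = B.
  by rewrite !mulmxA mulmxV // mul1mx mulmxK.
split=> //; first by apply/fibE; rewrite BE.
apply: smooth_at_mulmx; last exact: sF1.
by apply: smooth_at_mulmx; [apply: smooth_at_invmx|exact: s2].
Qed.

Definition model_set (lam ell : R) : set 'M[R]_(d + d) :=
  [set B | alg_cond lam ell (- Jcplx d) (realify (mx_pq m m)) B].

Lemma complex_local_model (lam ell : R) W0 : (0 < m)%N ->
  lam = 1 \/ lam = -1 -> ell = 1 \/ ell = -1 -> lam * ell = -1 ->
  W0^T = - W0 -> W0 \in unitmx -> local_model (fib lam ell) (model_set lam ell) W0.
Proof.
move=> m0 l1 l2 ll W0t uW0; have [F nF] := cframe W0t uW0.
have dd0 : (0 < d + d)%N by rewrite !addn_gt0 m0.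
apply: (local_model_of_frame (F := F)); apply: filterS nF => W h Wt uW.
have [uF sF FI FP] := h Wt uW; split; [exact: uF|exact: sF|move=> A].
rewrite /fib /model_set /= ll -FI -FP; apply: iff_sym; exact: alg_cond_conj.
Qed.

Definition model_set_n n : set 'M[R]_(d + d) :=
  [set B | model_set (-1) 1 B /\
    has_signature (4 * n) (4 * m - 4 * n) (B *m (- Jcplx d) *m realify (mx_pq m m))].

Lemma complex_local_model_n n W0 : (0 < m)%N ->
  W0^T = - W0 -> W0 \in unitmx -> local_model (fib_n n) (model_set_n n) W0.
Proof.
move=> m0 W0t uW0; have [F nF] := cframe W0t uW0.
have dd0 : (0 < d + d)%N by rewrite !addn_gt0 m0.
apply: (local_model_of_frame (F := F)); apply: filterS nF => W h Wt uW.
have [uF sF FI FP] := h Wt uW; split; [exact: uF|exact: sF|move=> A].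
have bE : F W *m A *m invmx (F W) *m (- Jcplx d) *m realify (mx_pq m m) =
    F W *m beta W A *m (F W)^T.
  by rewrite -FI -FP /beta !mulmxA mulmxKV // mulmxKV.
have aE : alg_cond (-1) 1 (- Jcplx d) (realify (mx_pq m m)) (F W *m A *m invmx (F W)) <->
    fib (-1) 1 W A.
  rewrite /fib /= mulr1 -FI -FP.
  by apply: alg_cond_conj => //; [right|left].
rewrite /fib_n /model_set_n /model_set /= bE.
have sE := has_signature_conj (4 * n) (4 * m - 4 * n) (beta W A) uF.
split=> -[c s]; split.
- exact: (aE.2 c).
- exact: (sE.2 s).
- exact: (aE.1 c).
- exact: (sE.1 s).
Qed.

End ComplexFrame.

(** * Models over U(m, m) *)

Section UnitaryModel.
Context {R : realType} {m : nat}.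
Local Notation C := R[i].
Local Notation d := (m + m)%N.
Local Notation J := (mx_pq m m : 'M[C]_d).

Lemma mx_pqK : J *m J = 1%:M.
Proof.
rewrite /mx_pq mulmx_block !(mulmx0, mul0mx, addr0, add0r, mulmx1, mulmxN, mulNmx).
by rewrite opprK -scalar_mx_block.
Qed.

Lemma mx_pq_tc : J ^t* = J.
Proof. by rewrite /mx_pq tc_block tcN !tc0 !tc1. Qed.

Lemma mx_pq_unit : J \in unitmx.
Proof. by have /mulmx1_unit [] := mx_pqK. Qed.

Lemma congr_unit (p K : 'M[C]_d) : p *m K *m p ^t* = J -> p \in unitmx.
Proof.
move=> pK; have := mx_pq_unit; rewrite -pK !unitmx_mul.
by case/andP => /andP [].
Qed.

(** Acting on rows, [g] transforms forms by [g J g^*], while [unitary] is stated with [g^* J g]. The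
    two agree since either one makes [J g^* J] an inverse of [g], on one side and hence on both. *)
Lemma unitaryP (g : 'M[C]_d) : unitary R m m g <-> g *m J *m g ^t* = J.
Proof.
have half (h : 'M[C]_d) : h ^t* *m J *m h = J -> h *m J *m h ^t* = J.
  move=> hJ; have E : (J *m h ^t* *m J) *m h = 1%:M.
    by rewrite -!mulmxA (mulmxA _ J) hJ mx_pqK.
  have /(congr1 (mulmx^~ J)) : h *m (J *m h ^t* *m J) = 1%:M by apply: mulmx1C.
  by rewrite mul1mx -!mulmxA mx_pqK mulmx1 !mulmxA.
split=> [/half //|gJ]; rewrite /unitary /=.
by have := half (g ^t*); rewrite tcK; apply.
Qed.

Lemma unitary_unit (g : 'M[C]_d) : unitary R m m g -> g \in unitmx.
Proof. by move=> /unitaryP; exact: congr_unit. Qed.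

Lemma unitaryM (g h : 'M[C]_d) :
  unitary R m m g -> unitary R m m h -> unitary R m m (g *m h).
Proof.
move=> /unitaryP gJ /unitaryP hJ; apply/unitaryP; rewrite tcM.
by rewrite !mulmxA -(mulmxA g) -(mulmxA g) hJ.
Qed.

Lemma unitaryV (g : 'M[C]_d) : unitary R m m g -> unitary R m m (invmx g).
Proof.
move=> ug; have uu := unitary_unit ug; move/unitaryP: ug => gJ; apply/unitaryP.
by rewrite -{1}gJ tcV !mulmxA mulVmx // mul1mx mulmxK // tc_unit.
Qed.

(** Both [t] and [c] carry [K] to the standard form, so [t c^-1] preserves the latter. *)
Lemma unitary_correction (t c K : 'M[C]_d) :
  t *m K *m t ^t* = J -> c *m K *m c ^t* = J ->
  (t *m invmx c) *m J *m (t *m invmx c) ^t* = J.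
Proof.
move=> tK cK; have uc := congr_unit cK.
have cJ : invmx c *m J *m (invmx c) ^t* = K.
  by rewrite -[in LHS]cK !mulmxA mulVmx // mul1mx (tcV c) mulmxK // tc_unit.
by rewrite tcM mulmxA -(mulmxA t) -(mulmxA t) cJ.
Qed.

(** The form pulled back by [t] inherits Hermitian symmetry, and [b0] is skew for it because [b] is
    skew for the standard form and [t] intertwines the two. *)
Lemma transported_form (t b b0 : 'M[C]_d) : t \in unitmx -> t *m b0 = b *m t ->
  b *m J = - (J *m b ^t*) ->
  [/\ (invmx t *m J *m (invmx t) ^t*) ^t* = invmx t *m J *m (invmx t) ^t*,
     b0 *m (invmx t *m J *m (invmx t) ^t*) =
       - (invmx t *m J *m (invmx t) ^t* *m b0 ^t*)
   & t *m (invmx t *m J *m (invmx t) ^t*) *m t ^t* = J].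
Proof.
move=> ut tb bJ.
have tVb : invmx t *m b = b0 *m invmx t.
  by rewrite -[LHS](mulmxK ut) -(mulmxA _ b) -tb mulmxA mulVmx // mul1mx.
have tVt : (invmx t) ^t* *m t ^t* = 1%:M by rewrite -tcM mulmxV // tc1.
have tb' : (invmx t) ^t* *m b0 ^t* = b ^t* *m (invmx t) ^t* by rewrite -!tcM tVb.
split; first by rewrite !tcM tcK mx_pq_tc mulmxA.
  move: ((invmx t) ^t*) tb' => T tb'; rewrite -(mulmxA _ T) tb' !mulmxA -tVb.
  by rewrite -(mulmxA _ b) bJ mulmxN mulNmx mulmxA.
by rewrite -!mulmxA tVt mulmx1 mulKVmx.
Qed.

(** What the two U(m, m) cases share. Each case supplies a normal form for the elements of [E], the
    stabilizer of [b0], and, as last hypothesis, a smooth normalization by matrices commuting with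
    [b0] of the forms near [mx_pq m m] for which [b0] is skew. *)
Lemma unitary_model (lam : R) (E H : set 'M[R]_(d + d)) (b0 : 'M[C]_d) :
  lam * lam = 1 -> realify b0 *m realify b0 = lam%:M -> b0 *m J = - (J *m b0 ^t*) ->
  (forall B, E B -> exists b, [/\ B = realify b, B *m B = lam%:M,
     b *m J = - (J *m b ^t*) & exists p, p *m J *m p ^t* = J /\ p *m b = b0 *m p]) ->
  (forall g, unitary R m m g -> E (realify (g *m b0 *m invmx g))) ->
  (forall h, H h <-> exists g, [/\ unitary R m m g, h = realify g & g *m b0 = b0 *m g]) ->
  (forall (V : normedModType R) (K : V -> 'M[C]_d) x, csmooth_at K x -> K x = J ->
     exists c : V -> 'M[C]_d, csmooth_at c x /\
     \forall y \near x, (K y) ^t* = K y -> b0 *m K y = - (K y *m b0 ^t*) ->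
       c y *m K y *m (c y) ^t* = J /\ c y *m b0 = b0 *m c y) ->
  homogeneous_model (realify @` unitary R m m) H E (realify b0).
Proof.
move=> ll bb0 b0J EP GE HP cor; split.
- by move=> _ [g ug <-]; apply: realify_unit; exact: unitary_unit.
- move=> _ _ [g ug <-] [h uh <-]; exists (g *m h); last exact: realifyM.
  exact: unitaryM.
- move=> _ [g ug <-]; exists (invmx g); first exact: unitaryV.
  by apply: realifyV; exact: unitary_unit.
- move=> h; split=> [/HP [g [ug -> gb]]|[[g ug <-]]].
    by split; [exists g|rewrite -!realifyM gb].
  by rewrite -!realifyM => /realify_inj gb; apply/HP; exists g.
- move=> B; split=> [/EP [b [-> _ bJ [p [pJ pb]]]]|[_ [[g ug <-] ->]]].
    have up := congr_unit pJ.
    exists (realify (invmx p)); split.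
      by exists (invmx p) => //; apply: unitaryV; apply/unitaryP.
    rewrite -realifyV ?unitmx_inv // -!realifyM invmxK -mulmxA.
    by rewrite -pb mulKmx.
  by rewrite -realifyV ?unitary_unit // -!realifyM; exact: GE.
have [gam [sg g0 gP gcom]] := smooth_intertwiner ll bb0.
pose x := realify b0; pose t B := unrealify (gam B).
have st B : csmooth_at t B by exact: csmooth_at_unrealify.
have tx : t x = 1%:M by rewrite /t g0 -realify1 realifyK.
have utx : t x \in unitmx by rewrite tx unitmx1.
pose K B := invmx (t B) *m J *m (invmx (t B)) ^t*.
have sK : csmooth_at K x.
  apply: csmooth_atM; last by apply: csmooth_at_tc; exact: csmooth_at_inv.
  by apply: csmooth_atM; [exact: csmooth_at_inv|exact: csmooth_at_cst].
have Kx : K x = J by rewrite /K tx invmx1 tc1 mul1mx mulmx1.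
have [c [sc cP]] := cor _ K x sK Kx.
have ucx : c x \in unitmx.
  have [|| cJ _] := nbhs_singleton cP; rewrite ?Kx ?mx_pq_tc //.
  by apply: congr_unit; exact: cJ.
exists (fun B => realify (t B *m invmx (c B))); split.
  by apply: smooth_at_realify; apply: csmooth_atM; [exact: st|exact: csmooth_at_inv].
have ug : \forall B \near x, gam B \in unitmx.
  by apply: near_unitmx (sg x) _; rewrite g0 unitmx1.
apply: filterS2 cP ug => B cB uB /EP [b [BE BB bJ _]].
(* [B] and [B0] are complex linear, hence so is their intertwiner. *)
have gJ : gam B = realify (t B).
  apply: commJ_realify; apply/esym/gcom; last exact/esym/realify_commJ.
  by rewrite BE realify_commJ.
have tb : t B *m b0 = b *m t B.
  by apply: (@realify_inj R); rewrite !realifyM -gJ -BE gP.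
have ut : t B \in unitmx by rewrite -unitmx_realify -gJ.
have [Kh b0K tK] := transported_form ut tb bJ.
have [cK cb] := cB Kh b0K; have uc := congr_unit cK.
split.
  exists (t B *m invmx (c B)); last by [].
  exact/unitaryP/(unitary_correction tK cK).
have cVb : invmx (c B) *m b0 = b0 *m invmx (c B).
  by rewrite -[LHS](mulmxK uc) -(mulmxA _ b0) -cb mulmxA mulVmx // mul1mx.
have E1 : t B *m invmx (c B) *m b0 = b *m (t B *m invmx (c B)).
  by rewrite -mulmxA cVb !mulmxA tb.
by rewrite -realifyM E1 realifyM -BE.
Qed.

End UnitaryModel.

(** * The case lam = 1, ell = -1 *)

Definition blockE := (@mulmx0, @mul0mx, @addr0, @add0r, @mulmx1, @mul1mx, @mulmxN,
  @mulNmx, @oppr0, @opprK).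

Section ModelSet.
Context {R : realType} {m : nat}.
Local Notation C := R[i].
Local Notation d := (m + m)%N.
Local Notation J := (mx_pq m m : 'M[C]_d).
Hypothesis m0 : (0 < m)%N.

Lemma dd0 : (0 < d + d)%N. Proof. by rewrite !addn_gt0 m0. Qed.

Lemma realify_unitary (g : 'M[C]_d) : unitary R m m g ->
  realify g *m realify J *m (realify g)^T = realify J.
Proof. by move=> /unitaryP gJ; rewrite -realify_tc -!realifyM gJ. Qed.

Lemma realify_conjJ (g : 'M[C]_d) : g \in unitmx ->
  realify g *m (- Jcplx d) *m invmx (realify g) = - Jcplx d.
Proof.
by move=> ug; rewrite mulmxN realify_commJ mulNmx mulmxK // realify_unit.
Qed.

Lemma model_set_conj (lam ell : R) (g b : 'M[C]_d) :
  lam = 1 \/ lam = -1 -> ell = 1 \/ ell = -1 -> unitary R m m g ->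
  model_set lam ell (realify b) -> model_set lam ell (realify (g *m b *m invmx g)).
Proof.
move=> l1 l2 uU sb; have ug := unitary_unit uU; have urg := realify_unit ug.
have := alg_cond_conj (- Jcplx d) (realify J) (realify b) dd0 l1 l2 urg.
rewrite (realify_conjJ ug) (realify_unitary uU) -(realifyV ug) -!realifyM => h.
exact: (h.2 sb).
Qed.

(** Commuting with [- Jcplx d] means complex linearity, and this operator is the scalar [- imag]. *)
Lemma model_setP (lam ell : R) B : model_set lam ell B ->
  exists b, [/\ B = realify b, is_split lam B, b *m J = - (J *m b ^t*)
    & is_split ell (realify (b *m (- imag)%:M))].
Proof.
move=> [sB skew com sBJ]; exists (unrealify B).
have BE : B = realify (unrealify B).
  by apply: commJ_realify; move: com; rewrite mulmxN mulNmx => /oppr_inj.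
split; [exact: BE|exact: sB| |].
  by apply: (@realify_inj R); rewrite realifyN !realifyM realify_tc -BE.
move: sBJ; rewrite {1}BE; move: (unrealify B) => b.
by rewrite realifyM [(- imag)%:M]raddfN realifyN realify_imag.
Qed.

Lemma model_set_realify (lam ell : R) (b : 'M[C]_d) : is_split lam (realify b) ->
  b *m J = - (J *m b ^t*) -> is_split ell (realify (b *m (- imag)%:M)) ->
  model_set lam ell (realify b).
Proof.
move=> s1 bJ s2; split; first exact: s1.
- by rewrite -realify_tc -!realifyM bJ realifyN.
- by rewrite mulmxN realify_commJ mulNmx.
- by move: s2; rewrite realifyM [(- imag)%:M]raddfN realifyN realify_imag.
Qed.

Lemma is_split1_realify (b : 'M[C]_d) : is_split 1 (realify b) <->
  b *m b = 1%:M /\ \rank (b - 1%:M)%R = \rank (b + 1%:M)%R.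
Proof.
have dbl a c : (a + a = c + c)%N <-> a = c.
  by split=> [|->//]; rewrite !addnn => /double_inj.
have bE : realify b *m realify b = 1%:M <-> b *m b = 1%:M.
  split=> [|E]; last by rewrite -realifyM E realify1.
  by rewrite -realifyM -realify1 => /realify_inj.
have rE : \rank (realify b - 1%:M)%R = \rank (realify b + 1%:M)%R <->
    \rank (b - 1%:M)%R = \rank (b + 1%:M)%R.
  by rewrite -realify1 -realifyN -!realifyD !mxrank_realify dbl.
apply: (iff_trans (is_split1P _ dd0)).
by split=> -[h1 h2]; split; by [apply/bE|apply/rE].
Qed.

Lemma is_splitN1_realify (b : 'M[C]_d) : b *m b = - 1%:M -> is_split (-1) (realify b).
Proof.
move=> bb; apply/(is_splitN1P _ dd0).
by rewrite -realifyM bb realifyN realify1 raddfN.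
Qed.

End ModelSet.

Section SwapModel.
Context {R : realType} {m : nat}.
Local Notation C := R[i].
Local Notation d := (m + m)%N.
Local Notation J := (mx_pq m m : 'M[C]_d).
Hypothesis m0 : (0 < m)%N.

(** The base point for lam = 1. Its eigenspaces are isotropic and dual to each other under
    [mx_pq m m], so its centralizer in U(m, m) is Gl(m, C), acting on one eigenspace and
    contragrediently on the other. *)
Definition swap_mx : 'M[C]_d := block_mx 0 1%:M 1%:M 0.

Lemma swap_mxK : swap_mx *m swap_mx = 1%:M.
Proof. by rewrite mulmx_block !blockE -scalar_mx_block. Qed.

Lemma swap_mx_tc : swap_mx ^t* = swap_mx.
Proof. by rewrite tc_block !tc0 tc1. Qed.

Lemma swap_mx_J : swap_mx *m J = - (J *m swap_mx ^t*).
Proof. by rewrite swap_mx_tc /mx_pq !mulmx_block opp_block_mx !blockE. Qed.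

Lemma comm_swap (g : 'M[C]_d) : g *m swap_mx = swap_mx *m g <->
  exists a b, g = block_mx a b b a.
Proof.
split=> [|[a [b ->]]]; last by rewrite !mulmx_block !blockE.
rewrite -{1 2}[g]submxK !mulmx_block !blockE => /eq_block_mx [ur ul _ _].
by exists (ulsubmx g), (ursubmx g); rewrite -[LHS]submxK ul ur.
Qed.

Lemma half_sum p q (A B : 'M[C]_(p, q)) : 2^-1 *: (A + B) + 2^-1 *: (A - B) = A.
Proof. by rewrite -scalerDr addrACA subrr addr0 half_add. Qed.

Lemma half_diff p q (A B : 'M[C]_(p, q)) : 2^-1 *: (A + B) - 2^-1 *: (A - B) = B.
Proof. by rewrite -scalerBr opprB addrC addrA subrK half_add. Qed.

Lemma conj_half : (2^-1 : C)^* = 2^-1.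
Proof. by rewrite fmorphV rmorph_nat. Qed.

Lemma tcZ_half p q (A : 'M[C]_(p, q)) : (2^-1 *: A) ^t* = 2^-1 *: A ^t*.
Proof. by rewrite linearZ /= map_mxZ /= conj_half. Qed.

(* In the eigenbasis of the swap these matrices become block diagonal, respectively
   block antidiagonal. *)
Lemma swap_block_congr (a b k1 k2 : 'M[C]_m) :
  (a - b) *m (k1 + k2) *m (a + b) ^t* = 1%:M ->
  (a + b) *m (k1 - k2) *m (a - b) ^t* = 1%:M ->
  block_mx a b b a *m block_mx k1 k2 (- k2) (- k1) *m (block_mx a b b a) ^t* = J.
Proof.
move=> h1 h2.
have -> : block_mx a b b a *m block_mx k1 k2 (- k2) (- k1) =
    block_mx (a *m k1 - b *m k2) (a *m k2 - b *m k1)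
      (- (a *m k2 - b *m k1)) (- (a *m k1 - b *m k2)).
  by rewrite mulmx_block !mulmxN !opprB [b *m k1 - _]addrC [b *m k2 - _]addrC ![- _ + _]addrC.
have pq1 : (a *m k1 - b *m k2) + (a *m k2 - b *m k1) = (a - b) *m (k1 + k2).
  by rewrite mulmxBl !mulmxDr opprD (AC (2*2) ((1*3)*(4*2))).
have pq2 : (a *m k1 - b *m k2) - (a *m k2 - b *m k1) = (a + b) *m (k1 - k2).
  by rewrite mulmxDl !mulmxBr opprB (AC (2*2) ((1*4)*(3*2))).
move: (a *m k1 - b *m k2) (a *m k2 - b *m k1) pq1 pq2 => p q pq1 pq2.
rewrite tc_block mulmx_block !mulNmx -!opprD [q *m a ^t* + _]addrC [q *m b ^t* + _]addrC.
set u := p *m a ^t* + q *m b ^t*; set v := p *m b ^t* + q *m a ^t*.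
have uv1 : u + v = 1%:M.
  by rewrite -h1 -pq1 tcD mulmxDr !mulmxDl (AC (2*2) ((1*4)*(3*2))).
have uv2 : u - v = 1%:M.
  by rewrite -h2 -pq2 tcD tcN mulmxDr mulmxN !mulmxBl opprB opprD (AC (2*2) ((1*4)*(2*3))).
have u1 : u = 1%:M.
  have uu : u + u = 1%:M + 1%:M.
    by have := congr2 +%R uv1 uv2; rewrite addrACA subrr addr0.
  by rewrite -[LHS]half_add uu half_add.
have v0 : v = 0 by have := uv1; rewrite u1 => /(canRL (addKr _)); rewrite addNr.
by rewrite v0 u1 oppr0.
Qed.

(** [a + b] and [a - b] are the actions on the two eigenspaces of the swap, which must be inverse
    adjoints of each other. *)
Lemma unitary_blockP (a b : 'M[C]_m) : unitary R m m (block_mx a b b a) <->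
  (a + b) *m (a - b) ^t* = 1%:M.
Proof.
apply: (iff_trans (unitaryP _)); split=> [|h].
  rewrite tc_block /mx_pq !mulmx_block !blockE => /eq_block_mx [h1 /eqP h2 _ _].
  rewrite tcD tcN mulmxDl !mulmxDr !mulmxN.
  rewrite subr_eq0 in h2; rewrite (eqP h2) -h1.
  by rewrite addrA subrK.
have E := @swap_block_congr a b 1%:M 0; rewrite oppr0 !addr0 !mulmx1 in E.
by apply: E => //; rewrite -[a - b]tcK -tcM h tc1.
Qed.

(** The parameter is recovered as [A = a + b]; then [a - b] is its inverse adjoint, and half sums
    and differences give back the blocks of [GL_in_U A]. *)
Lemma GL_in_U_stab h : (realify @` (GL_in_U @` GL R[i] m)) h <->
  exists g, [/\ unitary R m m g, h = realify g & g *m swap_mx = swap_mx *m g].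
Proof.
split=> [[_ [A uA <-] <-]|[g [ug -> /comm_swap [a [b gE]]]]].
  exists (GL_in_U A); rewrite /GL_in_U.
  set B := invmx (A ^t*); have uAs : A ^t* \in unitmx by rewrite tc_unit.
  have BA : B *m A ^t* = 1%:M by rewrite mulVmx.
  have AB : A *m B ^t* = 1%:M by rewrite -[A in LHS]tcK -tcM BA tc1.
  rewrite scale_block_mx; split; last by apply/comm_swap; eexists; eexists.
    by apply/unitary_blockP; rewrite half_sum half_diff.
  by [].
rewrite gE in ug *; move/unitary_blockP: ug => AB.
have [uA uBs] := mulmx1_unit AB.
have BE : a - b = invmx ((a + b) ^t*).
  have uAs : (a + b) ^t* \in unitmx by rewrite tc_unit.
  have BA : (a - b) *m (a + b) ^t* = 1%:M by rewrite -[a - b]tcK -tcM AB tc1.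
  by rewrite -[LHS](mulmxK uAs) BA mul1mx.
exists (GL_in_U (a + b)); first by exists (a + b).
rewrite /GL_in_U -BE scale_block_mx.
have -> : a + b + (a - b) = a + a by rewrite addrACA subrr addr0.
have -> : a + b - (a - b) = b + b by rewrite opprB addrC addrA subrK.
by rewrite !half_add.
Qed.

(* With a + b = 1, the two conditions of swap_block_congr say that a - b is the inverse
   of k1 + k2. *)
Lemma swap_correction (V : normedModType R) (K : V -> 'M[C]_d) x :
  csmooth_at K x -> K x = J ->
  exists c : V -> 'M[C]_d, csmooth_at c x /\
  \forall y \near x, (K y) ^t* = K y -> swap_mx *m K y = - (K y *m swap_mx ^t*) ->
    c y *m K y *m (c y) ^t* = J /\ c y *m swap_mx = swap_mx *m c y.
Proof.
move=> sK Kx.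
pose S y := ulsubmx (K y) + ursubmx (K y).
have sS : csmooth_at S x.
  by apply: csmooth_atD; [exact: csmooth_at_ul|exact: csmooth_at_ur].
have Sx : S x = 1%:M by rewrite /S Kx block_mxKul block_mxKur addr0.
have uSx : S x \in unitmx by rewrite Sx unitmx1.
pose be y := invmx (S y).
have sbe : csmooth_at be x by exact: csmooth_at_inv.
pose h : V -> R := fun=> 2^-1.
have hE y : real_complex R (h y) = 2^-1 by rewrite /h fmorphV rmorph_nat.
pose c y : 'M[C]_d := block_mx (real_complex R (h y) *: (1%:M + be y))
  (real_complex R (h y) *: (1%:M - be y)) (real_complex R (h y) *: (1%:M - be y))
  (real_complex R (h y) *: (1%:M + be y)).
have sh : smooth_at h x by exact: smooth_at_cst.
have sp : csmooth_at (fun y => real_complex R (h y) *: (1%:M + be y)) x.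
  by apply: csmooth_atZ => //; apply: csmooth_atD => //; exact: csmooth_at_cst.
have sm : csmooth_at (fun y => real_complex R (h y) *: (1%:M - be y)) x.
  apply: csmooth_atZ => //; apply: csmooth_atD; first exact: csmooth_at_cst.
  exact: csmooth_atN.
exists c; split; first exact: csmooth_at_block.
have nS := near_cunitmx sS uSx.
apply: filterS nS => y uS Kh Ksk; split; last first.
  by apply/comm_swap; eexists; eexists.
(* Skewness of the swap leaves two free blocks, and Hermitian symmetry makes [k1 - k2] the adjoint
   of [k1 + k2], so a single inverse settles both conditions. *)
have [k1 [k2 [KE Sk]]] : exists k1 k2, [/\ K y = block_mx k1 k2 (- k2) (- k1),
    S y = k1 + k2 & (k1 + k2) ^t* = k1 - k2].
  exists (ulsubmx (K y)), (ursubmx (K y)); split => //.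
    move: Ksk; rewrite swap_mx_tc -{1 2}[K y]submxK !mulmx_block opp_block_mx !blockE.
    by move=> /eq_block_mx [dl dr _ _]; rewrite -[LHS]submxK dl dr.
  move: Ksk Kh; rewrite swap_mx_tc -{1 2 3 4}[K y]submxK !mulmx_block opp_block_mx.
  rewrite !blockE tc_block => /eq_block_mx [dl dr _ _] /eq_block_mx [h1 h2 _ _].
  by move: h2; rewrite dl tcN => h2; rewrite tcD h1 -[in RHS]h2 opprK.
move=> Sks; have bS : be y *m (k1 + k2) = 1%:M by rewrite -Sk /be mulVmx.
rewrite /c KE hE; apply: swap_block_congr; rewrite half_sum half_diff.
  by rewrite bS tc1 mulmx1.
by rewrite mul1mx -Sks -tcM bS tc1.
Qed.

Lemma eigen_orth (E : 'M[C]_d) (U U' : 'M[C]_(m, d)) :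
  E *m J = - (J *m E ^t*) -> U *m E = U -> U' *m E = U' -> U *m J *m U' ^t* = 0.
Proof.
move=> EJ UE UE'; have h : U *m J *m U' ^t* = - (U *m J *m U' ^t*).
  rewrite -{1}UE -!mulmxA (mulmxA E) EJ mulNmx mulmxN -!mulmxA -tcM UE'.
  by [].
by rewrite -[LHS]half_add {1}h addNr scaler0.
Qed.

(** The eigenspaces of [b] are isotropic, so the whole form is contained in their mutual pairing
    [k]. Once [V'] is rescaled to [V2], the vectors [V + V2] and [V - V2] are orthonormal of
    opposite signs, and [b] exchanges them. *)
Lemma swap_basis (b : 'M[C]_d) : b *m b = 1%:M -> b *m J = - (J *m b ^t*) ->
  \rank (b - 1%:M)%R = \rank (b + 1%:M)%R ->
  exists p, p *m J *m p ^t* = J /\ p *m b = swap_mx *m p.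
Proof.
move=> bb bJ rk; have [V [V' [hV hV' uV]]] := involution_basis (two_neq0 C) bb rk.
have V0 : V *m J *m V ^t* = 0 by exact: (eigen_orth bJ hV hV).
have V0' : V' *m J *m V' ^t* = 0.
  have Nb : (- b) *m J = - (J *m (- b) ^t*) by rewrite mulNmx bJ tcN mulmxN.
  by apply: (eigen_orth Nb); rewrite mulmxN hV' opprK.
pose k := V *m J *m V' ^t*.
have kt : V' *m J *m V ^t* = k ^t* by rewrite /k !tcM tcK mx_pq_tc mulmxA.
have uk : k \in unitmx.
  have : col_mx V V' *m J *m (col_mx V V') ^t* = block_mx 0 k (k ^t*) 0.
    rewrite tr_col_mx map_row_mx mul_col_mx mul_col_row V0 V0' kt.
    by [].
  move=> kE; have : block_mx 0 k (k ^t*) 0 \in unitmx.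
    by rewrite -kE !unitmx_mul uV mx_pq_unit tc_unit.
  have -> : block_mx 0 k (k ^t*) 0 = block_mx k 0 0 (k ^t*) *m swap_mx.
    by rewrite mulmx_block !blockE.
  by rewrite unitmx_mul => /andP [+ _]; rewrite unitmxE det_ublock unitrM -!unitmxE => /andP [].
(* The factor 1/2 makes the form equal to 1 on [V + V2], where the pairing of [V] with [V2] enters
   twice. *)
pose V2 := 2^-1 *: ((invmx k) ^t* *m V').
have V2b : V2 *m b = - V2 by rewrite /V2 -scalemxAl -mulmxA hV' mulmxN scalerN.
have VV2 : V *m J *m V2 ^t* = 2^-1 *: 1%:M.
  by rewrite /V2 tcZ_half tcM tcK -scalemxAr mulmxA mulmxV.
have V2V : V2 *m J *m V ^t* = 2^-1 *: 1%:M.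
  have := congr1 (fun X => X ^t*) VV2.
  by rewrite !tcM tcK mx_pq_tc tcZ_half tc1 mulmxA.
have V22 : V2 *m J *m V2 ^t* = 0.
  rewrite /V2 tcZ_half tcM tcK -!scalemxAl -!scalemxAr -!mulmxA (mulmxA J) (mulmxA V').
  by rewrite (mulmxA V') V0' mul0mx mulmx0 !scaler0.
exists (col_mx (V + V2) (V - V2)); split.
  rewrite tr_col_mx map_row_mx mul_col_mx mul_col_row !tcD tcN.
  rewrite !mulmxDl !mulmxDr !mulNmx !mulmxN V0 V22 VV2 V2V.
  rewrite !(add0r, addr0, oppr0) subrr addNr -opprD -scalerDr half_add.
  by [].
rewrite mul_col_mx !mulmxDl mulNmx hV V2b opprK /swap_mx mul_block_col.
by rewrite !mul0mx !mul1mx add0r addr0.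
Qed.

Lemma swap_model :
  homogeneous_model (realify @` unitary R m m) (realify @` (GL_in_U @` GL R[i] m))
    (model_set 1 (-1)) (realify swap_mx).
Proof.
have sN1 (b : 'M[C]_d) : b *m b = 1%:M ->
    (b *m (- imag)%:M) *m (b *m (- imag)%:M) = - 1%:M.
  move=> bb; rewrite -mulmxA (mulmxA _ b) -scalar_mxC -mulmxA -scalar_mxM mulmxA bb mul1mx.
  by rewrite mulrNN imagM raddfN.
apply: (unitary_model (lam := 1)).
- by rewrite mulr1.
- by rewrite -realifyM swap_mxK realify1.
- exact: swap_mx_J.
- move=> B /model_setP [b [BE sB bJ _]].
  have := sB; rewrite BE => /(is_split1_realify m0) [bb rk].
  by exists b; split=> //; [rewrite -realifyM bb realify1|exact: swap_basis].
- move=> g ug; apply: (model_set_conj m0) => //; [by left|by right|].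
  apply: model_set_realify; last 1 first.
  + by apply: (is_splitN1_realify m0); apply: sN1; exact: swap_mxK.
  + apply/(is_split1_realify m0); split; first exact: swap_mxK.
    (* The swap anticommutes with [mx_pq m m], so conjugation by the latter exchanges its two
       eigenspaces. *)
    rewrite -(mxrank_conj (swap_mx - 1%:M) mx_pq_unit) mulmxBr mulmx1 mulmxBl.
    rewrite mulmxV ?mx_pq_unit // -[J *m swap_mx]opprK -[X in - - (J *m X)]swap_mx_tc.
    by rewrite -swap_mx_J mulNmx mulmxK ?mx_pq_unit // -opprD eqmx_opp.
  + exact: swap_mx_J.
- exact: GL_in_U_stab.
- exact: swap_correction.
Qed.

End SwapModel.

(** * The case lam = -1, ell = 1 *)

Section SignedModel.
Context {R : realType}.
Local Notation C := R[i].

Definition lt_sign (F : numFieldType) m n : 'rV[F]_m := \row_k (if (k < n)%N then 1 else -1).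

Lemma lt_signP (F : numFieldType) m n : is_sign (lt_sign F m n).
Proof. by move=> i; rewrite mxE; case: ifP; [left|right]. Qed.

Lemma npos_lt_sign (F : numFieldType) m n : (n <= m)%N -> npos (lt_sign F m n) = n.
Proof.
move=> nm; rewrite -[RHS](card_ord n) /npos.
have inj : injective (widen_ord nm) by move=> i j /(congr1 val) /= /val_inj.
rewrite -(card_imset _ inj).
apply: eq_card => i; rewrite !inE mxE; case: ifP => lt.
  rewrite eqxx; apply/esym/imsetP; exists (Ordinal lt) => //.
  exact/val_inj.
rewrite m1_neq1; apply/esym/negbTE/imsetP => -[j _ ij].
by move: lt; rewrite ij /= ltn_ord.
Qed.

Lemma sign_diagK (F : numFieldType) n (e : 'rV[F]_n) : is_sign e ->
  diag_mx e *m diag_mx e = 1%:M.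
Proof.
move=> se; rewrite mulmx_diag -diag_const_mx; congr diag_mx.
by apply/matrixP => i j; rewrite !mxE; case: (se j) => ->; rewrite ?mulrNN mulr1.
Qed.

Lemma sign_diag_tc n (e : 'rV[C]_n) : is_sign e -> (diag_mx e) ^t* = diag_mx e.
Proof. by move=> se; rewrite tr_diag_mx map_diag_mx conj_sign. Qed.

Lemma is_signN (F : numFieldType) n (e : 'rV[F]_n) : is_sign e -> is_sign (- e).
Proof. by move=> se i; rewrite mxE; case: (se i) => ->; rewrite ?opprK; [right|left]. Qed.

Lemma is_sign_row (F : numFieldType) p q (e : 'rV[F]_p) (f : 'rV[F]_q) :
  is_sign e -> is_sign f -> is_sign (row_mx e f).
Proof. by move=> se sf i; rewrite mxE; case: (fintype.split i) => j. Qed.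

Lemma unitaryE p q (A : 'M[C]_(p, p)) (B : 'M[C]_(p, q)) (D : 'M[C]_(q, p)) (E : 'M[C]_(q, q)) :
  unitary R p q (block_mx A B D E) <->
  [/\ A ^t* *m A - D ^t* *m D = 1%:M, A ^t* *m B - D ^t* *m E = 0,
      B ^t* *m A - E ^t* *m D = 0 & B ^t* *m B - E ^t* *m E = - 1%:M].
Proof.
rewrite /unitary /= tc_block /mx_pq !mulmx_block !blockE.
by split=> [/eq_block_mx [-> -> -> ->]|[-> -> -> ->]].
Qed.

Lemma lt_sign_row n q : lt_sign C (n + q) n = row_mx (const_mx 1) (const_mx (-1)).
Proof.
by apply/matrixP => i j; rewrite !mxE; case: splitP => k _; rewrite mxE.
Qed.

(** Chosen so that, under [mx_pq m m], the eigenspace for 1 has signature (n, m - n) and the one for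
    -1 has signature (m - n, n); their isometry groups are the factors of [UxU]. *)
Definition pm_sign m n : 'rV[C]_(m + m) := row_mx (lt_sign C m n) (- lt_sign C m n).

Lemma pm_signP m n : is_sign (pm_sign m n).
Proof. by apply: is_sign_row; [|apply: is_signN]; exact: lt_signP. Qed.

Lemma diag_mxN (V : zmodType) n (e : 'rV[V]_n) : diag_mx (- e) = - diag_mx e.
Proof. exact: raddfN. Qed.

Lemma UxU_unitaryP n q (a1 : 'M[C]_(n, n)) (a2 : 'M[C]_(n, q)) (a3 : 'M[C]_(q, n))
    (a4 : 'M[C]_(q, q)) (d1 : 'M[C]_(q, q)) (d2 : 'M[C]_(q, n)) (d3 : 'M[C]_(n, q))
    (d4 : 'M[C]_(n, n)) :
  unitary R (n + q) (n + q)
    (block_mx (block_mx a1 0 0 d1) (block_mx 0 a2 d2 0)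
              (block_mx 0 d3 a3 0) (block_mx d4 0 0 a4)) <->
  unitary R n q (block_mx a1 a2 a3 a4) /\ unitary R q n (block_mx d1 d2 d3 d4).
Proof.
rewrite !unitaryE !tc_block !tc0 !mulmx_block !blockE !opp_block_mx !add_block_mx.
rewrite !oppr0 !addr0 -!block_mx0 !scalar_mx_block !opp_block_mx !oppr0.
split.
  by move=> [] /eq_block_mx [? _ _ ?] /eq_block_mx [_ ? ? _] /eq_block_mx [_ ? ? _]
    /eq_block_mx [? _ _ ?].
by move=> [[-> -> -> ->] [-> -> -> ->]].
Qed.

(** Commuting with the signs kills the entries between coordinates of opposite sign. The equation
    [e] is a variable so that [m] can be replaced by [n + q], which removes the [castmx]. *)
Lemma UxU_commP n q m (e : (n + q = m)%N) (g : 'M[C]_(m + m)) :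
  (exists A D, [/\ unitary R n q A, unitary R q n D
     & g = castmx (congr2 addn e e, congr2 addn e e) (UxU_in_U A D)]) <->
  unitary R m m g /\ g *m diag_mx (pm_sign m n) = diag_mx (pm_sign m n) *m g.
Proof.
case: m / e g => g; rewrite /pm_sign lt_sign_row diag_mx_row.
rewrite diag_mxN diag_mx_row !diag_const_mx raddfN opp_block_mx !oppr0 opprK.
split.
  move=> [A [D [uA uD ->]]]; rewrite castmx_id /UxU_in_U; split.
    by apply/UxU_unitaryP; rewrite !submxK.
  by rewrite !mulmx_block !blockE.
move=> [ug]; rewrite -[g]submxK -[ulsubmx g]submxK -[ursubmx g]submxK
  -[dlsubmx g]submxK -[drsubmx g]submxK.
rewrite !mulmx_block !blockE.
move=> /eq_block_mx [] /eq_block_mx [_ /esym/opp_fix ul1 /opp_fix ul2 _].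
move=> /eq_block_mx [/esym/opp_fix ur1 _ _ /opp_fix ur2].
move=> /eq_block_mx [/opp_fix dl1 _ _ /esym/opp_fix dl2].
move=> /eq_block_mx [_ /opp_fix dr1 /esym/opp_fix dr2 _].
move: ug; rewrite -[g]submxK -[ulsubmx g]submxK -[ursubmx g]submxK
  -[dlsubmx g]submxK -[drsubmx g]submxK.
rewrite ul1 ul2 ur1 ur2 dl1 dl2 dr1 dr2 => /UxU_unitaryP [uA uD].
eexists; eexists; split; [exact: uA|exact: uD|].
by rewrite castmx_id /UxU_in_U !(block_mxKul, block_mxKur, block_mxKdl, block_mxKdr).
Qed.

Lemma congr_mulmx p q r (A : 'M[C]_(p, q)) (B : 'M[C]_(q, r)) (K : 'M[C]_r) :
  (A *m B) *m K *m (A *m B) ^t* = A *m (B *m K *m B ^t*) *m A ^t*.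
Proof. by rewrite tcM !mulmxA. Qed.

Lemma block_congr p q (S A : 'M[C]_p) (S' A' : 'M[C]_q) :
  block_mx S 0 0 S' *m block_mx A 0 0 A' *m (block_mx S 0 0 S') ^t* =
  block_mx (S *m A *m S ^t*) 0 0 (S' *m A' *m S' ^t*).
Proof. by rewrite tc_block !tc0 !mulmx_block !blockE. Qed.

Section Model.
Variables (m n : nat).
Hypotheses (m0 : (0 < m)%N) (nm : (n <= m)%N).
Local Notation d := (m + m)%N.
Local Notation J := (mx_pq m m : 'M[C]_d).
Local Notation f := (lt_sign C m n).
Local Notation Df := (diag_mx (lt_sign C m n)).
Local Notation E0 := (diag_mx (pm_sign m n)).

Definition pm_mx : 'M[C]_d := imag *: E0.

Lemma four_mul : (4 * m = d + d)%N.
Proof. by rewrite !addnn -!mul2n mulnA. Qed.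

Definition sorted_sign : 'rV[R]_(d + d) :=
  \row_i (if (i < 4 * n)%N then 1
           else if (i < 4 * n + (4 * m - 4 * n))%N then -1 else 0).

(** The positive and negative counts exhaust the size, so the value 0 in [has_signature] does not
    occur. *)
Lemma sorted_signE : sorted_sign = lt_sign R (d + d) (4 * n).
Proof.
apply/matrixP => i j; rewrite !mxE; case: ifP => // _.
by rewrite subnKC ?leq_mul2l // four_mul ltn_ord.
Qed.

Lemma cplx_mx_tc p q (A : 'M[R]_(p, q)) : (cplx_mx A) ^t* = cplx_mx A^T.
Proof. by apply/matrixP => i j; rewrite !mxE conj_real. Qed.

Lemma npos_cplx k (e : 'rV[R]_k) : npos (cplx_mx e) = npos e.
Proof.
apply: eq_card => i; rewrite !inE mxE.
by rewrite -(inj_eq (fmorph_inj (real_complex R))) rmorph1.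
Qed.

Lemma is_sign_cplx k (e : 'rV[R]_k) : is_sign e -> is_sign (cplx_mx e).
Proof.
by move=> se i; rewrite mxE; case: (se i) => ->; rewrite ?rmorphN rmorph1; [left|right].
Qed.

Lemma realify_sign_diag (e : 'rV[R]_d) :
  realify (diag_mx (cplx_mx e)) = diag_mx (row_mx e e).
Proof.
rewrite realifyE diag_mx_row; congr (block_mx _ _ _ _);
  by apply/matrixP => i j; rewrite !mxE; case: (i == j); rewrite ?mulr1n ?mulr0n ?oppr0.
Qed.

(* The real form of a diagonal Hermitian form counts every sign twice. *)
Lemma has_signature_sign (e : 'rV[R]_d) : is_sign e ->
  has_signature (4 * n) (4 * m - 4 * n) (realify (diag_mx (cplx_mx e))) <->
  npos e = (n + n)%N.
Proof.
move=> se; rewrite realify_sign_diag /has_signature -/sorted_sign sorted_signE.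
have ls := @lt_signP R (d + d) (4 * n).
have le : (4 * n <= d + d)%N by rewrite -four_mul leq_mul2l.
have see : is_sign (row_mx e e) by exact: is_sign_row.
have nE : (npos (row_mx e e) = 4 * n)%N <-> npos e = (n + n)%N.
  have -> : (4 * n = (n + n) + (n + n))%N by rewrite !addnn -!mul2n mulnA.
  rewrite npos_row; move: (npos e) (n + n)%N => k l.
  by split=> [|-> //]; rewrite !addnn => /double_inj.
rewrite -nE; split=> [[P uP PE]|ee].
  have E : cplx_mx P *m diag_mx (cplx_mx (row_mx e e)) *m (cplx_mx P) ^t* =
      diag_mx (cplx_mx (lt_sign R (d + d) (4 * n))).
    rewrite cplx_mx_tc; have := congr1 (@cplx_mx R _ _) PE.
    by rewrite !cplx_mx_mul /cplx_mx !map_diag_mx.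
  have := inertia _ (is_sign_cplx see) (is_sign_cplx ls) E.
  by rewrite !npos_cplx npos_lt_sign // cplx_mx_unit => <-.
have [|s sE] := sign_sort see ls; first by rewrite npos_lt_sign.
by exists (perm_mx s); [exact: unitmx_perm|].
Qed.

Lemma pm_mx_sq : pm_mx *m pm_mx = - 1%:M.
Proof.
rewrite /pm_mx -scalemxAl -scalemxAr scalerA imagM sign_diagK ?scaleN1r //.
exact: pm_signP.
Qed.

Lemma pm_mx_tc : pm_mx ^t* = - pm_mx.
Proof.
rewrite /pm_mx linearZ /= map_mxZ /= conj_imag scaleNr; congr (- (_ *: _)).
exact/sign_diag_tc/pm_signP.
Qed.

Lemma pm_mx_J : pm_mx *m J = - (J *m pm_mx ^t*).
Proof.
rewrite pm_mx_tc mulmxN opprK /pm_mx -scalemxAl -scalemxAr mx_pqE.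
by rewrite diag_mxC.
Qed.

Lemma imag_neq0 : (imag : C) != 0.
Proof. by rewrite /imag eq_complex /= oner_eq0 andbF. Qed.

(** [pm_mx] is skew-Hermitian, so its being skew for [K y] means that the sign matrix commutes with
    [K y]; elimination preserves this commutation. *)
Lemma pm_correction (V : normedModType R) (K : V -> 'M[C]_d) x :
  csmooth_at K x -> K x = J ->
  exists c : V -> 'M[C]_d, csmooth_at c x /\
  \forall y \near x, (K y) ^t* = K y -> pm_mx *m K y = - (K y *m pm_mx ^t*) ->
    c y *m K y *m (c y) ^t* = J /\ c y *m pm_mx = pm_mx *m c y.
Proof.
move=> sK Kx; have Kx' : K x = diag_mx jsign by rewrite Kx mx_pqE.
have [c sc cP] := smooth_ldl sK (@jsignP R m) Kx'.
exists c; split=> //; apply: filterS cP => y h Kh Ksk.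
have [cK cE] := h Kh; split; first by rewrite cK mx_pqE.
have EK : E0 *m K y = K y *m E0.
  apply: (scalerI imag_neq0); rewrite scalemxAl scalemxAr -/pm_mx Ksk.
  by rewrite pm_mx_tc mulmxN opprK.
by rewrite /pm_mx -scalemxAl -scalemxAr (cE _ EK).
Qed.

Lemma UxU_stab h : (realify @` UxU R nm) h <->
  exists g, [/\ unitary R m m g, h = realify g & g *m pm_mx = pm_mx *m g].
Proof.
have comE g : g *m pm_mx = pm_mx *m g <-> g *m E0 = E0 *m g.
  rewrite /pm_mx -scalemxAl -scalemxAr; split=> [|-> //].
  exact: (scalerI imag_neq0).
split=> [[g /(UxU_commP (subnKC nm)) [ug gE] <-]|[g [ug -> /comE gE]]].
  by exists g; split => //; apply/comE.
by exists g => //; apply/(UxU_commP (subnKC nm)).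
Qed.

(* Exchanges the k-th vectors of the two halves for k >= n: it carries the adapted
   basis, where the form is E0 and the involution is J, to the standard one, where
   their roles are exchanged. *)
Definition pm_rot : 'M[C]_d :=
  block_mx (2^-1 *: (1%:M + Df)) (2^-1 *: (1%:M - Df))
           (2^-1 *: (1%:M - Df)) (2^-1 *: (1%:M + Df)).

Lemma pm_signE : E0 = block_mx Df 0 0 (- Df).
Proof. by rewrite diag_mx_row diag_mxN. Qed.

Lemma pm_rot_congr : pm_rot *m E0 *m pm_rot ^t* = J.
Proof.
have DD := sign_diagK (@lt_signP C m n).
have E := @swap_block_congr R m (2^-1 *: (1%:M + Df)) (2^-1 *: (1%:M - Df)) Df 0.
rewrite !half_sum !half_diff !oppr0 !addr0 tc1 mulmx1 mul1mx in E.
rewrite pm_signE; apply: E => //.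
by rewrite sign_diag_tc //; exact: lt_signP.
Qed.

Lemma pm_rotJ : pm_rot *m J = E0 *m pm_rot.
Proof.
have DD := sign_diagK (@lt_signP C m n).
have h1 : Df *m (2^-1 *: (1%:M + Df)) = 2^-1 *: (1%:M + Df).
  by rewrite -scalemxAr mulmxDr mulmx1 DD addrC.
have h2 : Df *m (2^-1 *: (1%:M - Df)) = - (2^-1 *: (1%:M - Df)).
  by rewrite -scalemxAr mulmxDr mulmxN mulmx1 DD -scalerN opprB.
by rewrite pm_signE /pm_rot /mx_pq !mulmx_block !blockE h1 h2 opprK.
Qed.

(** [E = - imag *: b] is a self-adjoint involution, so its eigenspaces are orthogonal and carry
    forms [k] and [k']. Their signatures are determined by the two sign counts below; sorting the
    signs and applying [pm_rot] reaches the standard position. *)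
Lemma pm_basis (b : 'M[C]_d) : b *m J = - (J *m b ^t*) ->
  is_split 1 (realify (b *m (- imag)%:M)) -> b *m b = - 1%:M ->
  has_signature (4 * n) (4 * m - 4 * n) (realify (b *m (- imag)%:M *m J)) ->
  exists p, p *m J *m p ^t* = J /\ p *m b = pm_mx *m p.
Proof.
move=> bJ /(is_split1_realify m0) [EE rk] bb sig.
set E := b *m (- imag)%:M in EE rk sig.
have EZ : E = - imag *: b by rewrite /E mul_mx_scalar.
have EJ : E *m J = J *m E ^t*.
  rewrite EZ linearZ /= map_mxZ /= rmorphN /= conj_imag opprK.
  by rewrite -scalemxAl -scalemxAr bJ scaleNr scalerN opprK.
have bE : b = imag *: E by rewrite EZ scalerA mulrN imagM opprK scale1r.
clearbody E; clear EZ.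
have [V [V' [hV hV' uV]]] := involution_basis (two_neq0 C) EE rk.
have V0 : V *m J *m V' ^t* = 0.
  apply: opp_fix; rewrite -{1}hV -(mulmxA V) EJ mulmxA -mulmxA -tcM hV'.
  by rewrite tcN mulmxN.
have V0' : V' *m J *m V ^t* = 0.
  by have := congr1 (fun X => X ^t*) V0; rewrite !tcM tcK mx_pq_tc tc0 mulmxA.
pose k := V *m J *m V ^t*; pose k' := V' *m J *m V' ^t*.
have Vk : col_mx V V' *m J *m (col_mx V V') ^t* = block_mx k 0 0 k'.
  by rewrite tr_col_mx map_row_mx mul_col_mx mul_col_row V0 V0'.
have kt : k ^t* = k by rewrite /k !tcM tcK mx_pq_tc mulmxA.
have kt' : k' ^t* = k' by rewrite /k' !tcM tcK mx_pq_tc mulmxA.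
clearbody k k'.
have : block_mx k 0 0 k' \in unitmx.
  by rewrite -Vk !unitmx_mul uV mx_pq_unit tc_unit.
rewrite unitmxE det_ublock unitrM -2!unitmxE => /andP [uk uk'].
have [Q [e [uQ se Qe]]] := hermitian_diag kt uk.
have [Q' [e' [uQ' se' Qe']]] := hermitian_diag kt' uk'.
(* Stated for arbitrary factors because it serves twice: with unsorted signs to count them, then
   with sorted ones. *)
have diagP (S S' : 'M[C]_m) g g' : S *m k *m S ^t* = diag_mx g ->
    S' *m k' *m S' ^t* = diag_mx g' ->
    let p := block_mx S 0 0 S' *m col_mx V V' in
    p *m J *m p ^t* = diag_mx (row_mx g g') /\ p *m E = J *m p.
  move=> Sg Sg' p; split.
    rewrite /p congr_mulmx Vk.
    by rewrite block_congr Sg Sg' diag_mx_row.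
  rewrite /p -(mulmxA _ _ E) (mul_col_mx V V' E) hV hV' mulmxA /mx_pq mulmx_block !blockE.
  by rewrite !mul_block_col !mul0mx !addr0 !add0r mulmxN mulNmx.
have [pJ pE] := diagP Q Q' e e' Qe Qe'.
set p := block_mx Q 0 0 Q' *m col_mx V V' in pJ pE.
have up : p \in unitmx.
  by rewrite unitmx_mul uV andbT unitmxE det_ublock unitrM -2!unitmxE uQ.
have see : is_sign (row_mx e e') by exact: is_sign_row.
have cnt1 : (npos e + npos e')%N = m.
  rewrite -npos_row -[RHS](@npos_jsign R m).
  by apply: (inertia up (@jsignP R m) see); rewrite -mx_pqE.
pose g := row_mx e (- e').
have sg : is_sign g by apply: is_sign_row => //; exact: is_signN.
have gE : cplx_mx (re_mx g) = g.
  apply/matrixP => i j; rewrite !mxE ord1.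
  by case: (sg j); rewrite mxE => ->; rewrite /real_complex_def /=; simpc.
have sgr : is_sign (re_mx g).
  by move=> i; rewrite mxE; case: (sg i) => -> /=; [left|right].
have pEJ : p *m (E *m J) *m p ^t* = diag_mx g.
  rewrite (mulmxA p) pE -(mulmxA J) -(mulmxA J) pJ.
  rewrite /g !diag_mx_row diag_mxN /mx_pq mulmx_block.
  by rewrite !blockE.
(* On the second eigenspace [E J] is the opposite of the form, hence the sign in [- e']. The
   signature 4n of the real form is 2n over C. *)
have cnt2 : (npos e + npos (- e'))%N = (n + n)%N.
  rewrite -npos_row -/g -{1}gE npos_cplx; apply/(has_signature_sign sgr).
  rewrite gE -pEJ (realifyM _ (p ^t*)) (realifyM p) realify_tc.
  exact/(has_signature_conj _ _ _ (realify_unit up)).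
have cnt3 := nposN se'.
(* The form has m positive signs in all, so [e] and [- e'] have equally many, and these add up to
   2n. *)
have ne : npos e = n.
  have xe : npos (- e') = npos e by apply/eqP; rewrite -(eqn_add2r (npos e')) cnt3 cnt1.
  by move: cnt2; rewrite xe; move: (npos e) => l; rewrite !addnn => /double_inj.
have sf := @lt_signP C m n.
have ne' : npos e' = npos (- f).
  have nf := nposN sf; rewrite npos_lt_sign // in nf.
  by apply/eqP; rewrite -(eqn_add2r n) nf addnC -[X in (X + _)%N]ne cnt1.
have [s sE] : exists s : {perm 'I_m}, perm_mx s *m diag_mx e *m (perm_mx s)^T = Df.
  by apply: sign_sort => //; rewrite npos_lt_sign.
have [s' sE'] := sign_sort se' (is_signN sf) ne'.
pose S := perm_mx s *m Q; pose S' := perm_mx s' *m Q'.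
have Sk : S *m k *m S ^t* = Df by rewrite /S congr_mulmx Qe perm_mx_tc.
have Sk' : S' *m k' *m S' ^t* = diag_mx (- f) by rewrite /S' congr_mulmx Qe' perm_mx_tc.
have [tJ tE] := diagP S S' _ _ Sk Sk'.
move: (block_mx S 0 0 S' *m col_mx V V') tJ tE => t tJ tE.
exists (pm_rot *m t); split; first by rewrite congr_mulmx tJ pm_rot_congr.
by rewrite bE -scalemxAr -(mulmxA pm_rot) tE (mulmxA pm_rot J) pm_rotJ /pm_mx -scalemxAl mulmxA.
Qed.

Lemma signed_model :
  homogeneous_model (realify @` unitary R m m) (realify @` UxU R nm)
    (model_set_n n) (realify pm_mx).
Proof.
have sqN1 (b : 'M[C]_d) : realify b *m realify b = (-1)%:M -> b *m b = - 1%:M.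
  rewrite -realifyM => E; apply: (@realify_inj R).
  by rewrite E realifyN realify1 raddfN.
have formE (b : 'M[C]_d) : realify b *m (- Jcplx d) *m realify J =
    realify (b *m (- imag)%:M *m J).
  by rewrite !realifyM [(- imag)%:M]raddfN realifyN realify_imag.
have pmE : pm_mx *m (- imag)%:M = E0.
  by rewrite mul_mx_scalar /pm_mx scalerA mulNr imagM opprK scale1r.
apply: (unitary_model (lam := -1)).
- by rewrite mulrNN mulr1.
- by rewrite -realifyM pm_mx_sq realifyN realify1 raddfN.
- exact: pm_mx_J.
- move=> B [/model_setP [b [BE sB bJ sE]] sig].
  have [BB _] := sB; exists b; split; [exact: BE|exact: BB|exact: bJ|].
  apply: pm_basis bJ sE _ _; first by apply: sqN1; rewrite -BE.
  by rewrite -formE -BE.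
- move=> g ug; have uug := unitary_unit ug; have urg := realify_unit uug; split.
    apply: (model_set_conj m0) ug _; [by right|by left|].
    apply: model_set_realify; last 1 first.
    + rewrite pmE; apply/(is_split1_realify m0); split.
        exact/sign_diagK/pm_signP.
      rewrite pm_signE [1%:M]scalar_mx_block opp_block_mx !add_block_mx !oppr0 !addr0.
      rewrite !rank_diag_block_mx addnC -opprD eqmx_opp; congr (_ + _)%N.
      by rewrite -[in RHS]eqmx_opp opprD opprK.
    + by apply: (is_splitN1_realify m0); exact: pm_mx_sq.
    + exact: pm_mx_J.
  have -> : realify (g *m pm_mx *m invmx g) *m (- Jcplx d) *m realify J =
      realify g *m (realify pm_mx *m (- Jcplx d) *m realify J) *m (realify g)^T.
    rewrite -{1}(realify_unitary ug) -{1}(realify_conjJ uug) !realifyM realifyV //.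
    move: (realify g) (realify pm_mx) (realify J) urg => X A P uX.
    by rewrite !mulmxA !mulmxKV.
  apply/has_signature_conj => //; rewrite formE pmE.
  pose r : 'rV[R]_d := row_mx (lt_sign R m n) (lt_sign R m n).
  (* The sign change in the second half of [E0] cancels that of [mx_pq m m]: two copies of the same
     n positive signs remain. *)
  have rE : E0 *m J = diag_mx (cplx_mx r).
    have lE : cplx_mx (lt_sign R m n) = f.
      by apply/matrixP => i j; rewrite !mxE; case: ifP; rewrite ?rmorphN rmorph1.
    rewrite pm_signE /cplx_mx map_row_mx -/(cplx_mx _) lE diag_mx_row /mx_pq.
    by rewrite mulmx_block !blockE.
  rewrite rE; apply/has_signature_sign; last by rewrite npos_row npos_lt_sign.
  by apply: is_sign_row; exact: lt_signP.
- exact: UxU_stab.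
- exact: pm_correction.
Qed.

End Model.

End SignedModel.

(** * Integrable structures as sections of the bundles *)

Lemma integrable_fibre (R : realType) (d : nat) (M : manifold R d) (w : symplectic M)
    (lam ell : R) S p :
  integrable_structure w lam ell S -> fibre w lam ell p (S p).
Proof.
move=> [[_ spl skew _] com]; have [c s] := com p.
by split; [exact: spl|exact: skew|exact: c|exact: s].
Qed.

Lemma integrable_section (R : realType) (d : nat) (M : manifold R d) (w : symplectic M)
    (lam ell : R) N (G H : set 'M[R]_N) S :
  integrable_structure w lam ell S -> smooth_section_of (fibre w lam ell) G H S.
Proof.
move=> iS; apply: smooth_sectionP; first by case: iS => -[].
by move=> p; exact: integrable_fibre.
Qed.

Theorem theorem4p10 (R : realType) (m : nat) (M : manifold R (m + m))
    (w : symplectic M) :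
  (0 < m)%N ->
  [/\ sections_of_bundle (integrable_structure w 1 1) (fibre w 1 1)
        (GL R (m + m)) (GLxGL R m),
      sections_of_bundle (integrable_structure w 1 (-1)) (fibre w 1 (-1))
        (realify @` unitary R m m) (realify @` (GL_in_U @` GL R[i] m)),
      forall (n : nat) (nm : (n <= m)%N),
        sections_of_bundle (integrable_structure_n w n) (fibre_n w n)
          (realify @` unitary R m m) (realify @` UxU R nm)
    & sections_of_bundle (integrable_structure w (-1) (-1)) (fibre w (-1) (-1))
        (GL R (m + m)) (realify @` GL R[i] m)].
Proof.
move=> m0; have d0 : (0 < m + m)%N by rewrite addn_gt0 m0.
have p1 : (1 : R) = 1 \/ (1 : R) = -1 by left.
have n1 : (-1 : R) = 1 \/ (-1 : R) = -1 by right.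
split.
- split=> [|S]; last exact: integrable_section.
  apply: (fibre_bundle_of_model (w := w) _ (GLxGL_model m0)).
    by move=> c p A; exact: fibre_in_chart.
  by move=> W0 _ _; exact: real_local_model.
- split=> [|S]; last exact: integrable_section.
  apply: (fibre_bundle_of_model (w := w) _ (swap_model m0)).
    by move=> c p A; exact: fibre_in_chart.
  by move=> W0 Wt uW; apply: complex_local_model => //; rewrite mul1r.
- move=> n nm; split=> [|S [iS sig]].
    apply: (fibre_bundle_of_model (w := w) _ (signed_model m0 nm)).
      by move=> c p A; exact: fibre_n_in_chart.
    by move=> W0; exact: complex_local_model_n.
  apply: smooth_sectionP; first by case: iS => -[].
  by move=> p; split; [exact: integrable_fibre|exact: sig].
- split=> [|S]; last exact: integrable_section.
  apply: (fibre_bundle_of_model (w := w) _ (GLC_model m0)).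
    by move=> c p A; exact: fibre_in_chart.
  by move=> W0 _ _; exact: real_local_model.
Qed.
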